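(* Let $M$ be a complete Riemannian manifold and let $\Omega \subset M$ be a bounded open domain with (nonempty) smooth boundary. Let $\tau$ be the first exit time of Brownian motion from $\Omega$, and for each positive integer $k$ let $$T_k(\Omega) = \int_\Omega \mathbb{E}^x[\tau^k]\, dx,$$ where the integration is with respect to the measure induced by the Riemannian structure. Suppose that $\lambda$ is a Dirichlet eigenvalue associated to the domain $\Omega$, let $E_\lambda$ be the eigenspace corresponding to $\lambda$, and let $a_\lambda^2$ be the square of the $L^2(\Omega)$-norm of the orthogonal projection of the constant function $1$ on $E_\lambda$. Then for every positive integer $k$, $$\left(\frac{k!\, a_{\lambda}^2}{T_k(\Omega)}\right)^{\frac{1}{k}} \leq \lambda.$$
   Context: $\Delta = \operatorname{div}\nabla$ is the Laplace operator of $M$. Brownian motion $X_t$ on $M$ is the diffusion with infinitesimal generator $\Delta$ (not $\tfrac12\Delta$); $\mathbb{P}^x$ is the probability measure charging Brownian paths started at $x$, and $\mathbb{E}^x$ is the corresponding expectation. The first exit time is $\tau = \inf\{t \ge 0 : X_t \notin \Omega\}$. A Dirichlet eigenvalue of $\Omega$ is a number $\lambda$ for which $-\Delta\phi = \lambda\phi$ in $\Omega$, $\phi = 0$ on $\partial\Omega$ has a nonzero solution; $E_\lambda\subset L^2(\Omega)$ is the (finite-dimensional) space of all its solutions, and orthogonal projection is with respect to the $L^2(\Omega)$ inner product. Background fact: $\mathbb{E}^x[\tau^k] = u_k(x)$, where $u_0 = 1$ and, for $k\ge 1$, $\Delta u_k = -k u_{k-1}$ in $\Omega$, $u_k = 0$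 on $\partial\Omega$. *)

(* Defs.v *)
From HB Require Import structures.
From mathcomp Require Import all_boot all_order all_algebra.
From mathcomp Require Import all_classical all_reals all_analysis.

Set Implicit Arguments.
Unset Strict Implicit.
Unset Printing Implicit Defensive.

Import Order.TTheory GRing.Theory Num.Theory.
Import numFieldNormedType.Exports.

Local Open Scope classical_set_scope.
Local Open Scope ring_scope.

Section euclidean.
Context {R : realType}.

Definition pder n (i : 'I_n) (f : 'rV[R]_n -> R) (x : 'rV[R]_n) : R :=
  'D_(delta_mx 0 i) f x.

(* [U] is meant to be open: then this is the usual class C^k(U). *)
Fixpoint Ck n (k : nat) (U : set 'rV[R]_n) (f : 'rV[R]_n -> R) : Prop :=
  (forall x, U x -> {for x, continuous f}) /\
  match k with
  | 0 => True
  | k'.+1 => forall i, (forall x, U x -> derivable f x (delta_mx 0 i)) /\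
                       Ck k' U (pder i f)
  end.

Definition Cinfty n (U : set 'rV[R]_n) (f : 'rV[R]_n -> R) : Prop :=
  forall k, Ck k U f.

(* By Tonelli, this iterated integral is the integral of [f] for the Lebesgue
   measure of R^n when [f] is nonnegative and Borel, the only case in use. *)
Fixpoint integral_rV n : ('rV[R]_n -> \bar R) -> \bar R :=
  match n with
  | 0 => fun f => f 0
  | n'.+1 => fun f =>
      (\int[lebesgue_measure]_x
         integral_rV (fun v : 'rV[R]_n' => f (row_mx (x%:M : 'rV_1) v)))%E
  end.

End euclidean.

Record chart (R : realType) (n : nat) (M : topologicalType) := Chart {
  cdom : set M ;
  ccod : set 'rV[R]_n ;
  cmap : M -> 'rV[R]_n ;
  cinv : 'rV[R]_n -> M ;
  open_cdom : open cdom ;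
  open_ccod : open ccod ;
  cmap_cod : forall p, cdom p -> ccod (cmap p) ;
  cinv_dom : forall x, ccod x -> cdom (cinv x) ;
  cmapK : forall p, cdom p -> cinv (cmap p) = p ;
  cinvK : forall x, ccod x -> cmap (cinv x) = x ;
  cmap_continuous : forall p, cdom p -> {for p, continuous cmap} ;
  cinv_continuous : forall x, ccod x -> {for x, continuous cinv}
}.

Definition transition (R : realType) n (M : topologicalType)
  (c c' : chart R n M) : 'rV[R]_n -> 'rV[R]_n := cmap c' \o cinv c.

(* The metric is given by its matrices in the charts of the atlas: vectors are
   rows, [v] having square norm [v *m g *m v^T], and the differential of a map
   acts on rows through [v *m 'J f x].  The carrier is not assumed connected. *)
Record riemannian_manifold (R : realType) (n : nat) := RiemannianManifold {
  carrier :> ptopologicalType ;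
  carrier_hausdorff : hausdorff_space carrier ;
  carrier_second_countable : @second_countable carrier ;
  atlas : set (chart R n carrier) ;
  atlas_cover : forall p : carrier, exists2 c, atlas c & cdom c p ;
  atlas_smooth : forall c c', atlas c -> atlas c' -> forall j,
    Cinfty (ccod c `&` cinv c @^-1` cdom c') (fun x => transition c c' x 0 j) ;
  metric : chart R n carrier -> 'rV[R]_n -> 'M[R]_n ;
  metric_smooth : forall c, atlas c -> forall i j,
    Cinfty (ccod c) (fun x => metric c x i j) ;
  metric_sym : forall c, atlas c -> forall x, ccod c x ->
    (metric c x)^T = metric c x ;
  metric_posdef : forall c, atlas c -> forall x, ccod c x ->
    forall v : 'rV[R]_n, v != 0 -> 0 < (v *m metric c x *m v^T) 0 0 ;
  metric_compat : forall c c', atlas c -> atlas c' ->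
    forall x, ccod c x -> cdom c' (cinv c x) ->
    metric c x = jacobian (transition c c') x
                 *m metric c' (transition c c' x)
                 *m (jacobian (transition c c') x)^T
}.

Section geometry.
Context {R : realType} {n : nat} (M : riemannian_manifold R n).

(* [f] is C^k, resp. smooth, on the open subset [U] of [M]. *)
Definition Ck_on (k : nat) (U : set M) (f : M -> R) : Prop :=
  forall c, atlas c -> Ck k (ccod c `&` cinv c @^-1` U) (f \o cinv c).

Definition smooth_on (U : set M) (f : M -> R) : Prop :=
  forall k, Ck_on k U f.

(* [segment p q l]: a C^1 curve inside one chart, of length [l], joins [p] to
   [q].  A piecewise C^1 curve is a concatenation of such segments. *)
Definition segment (p q : M) (l : R) : Prop :=
  exists c : chart R n M, exists gamma : R -> 'rV[R]_n,
    [/\ atlas c,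
        (forall t, derivable gamma t 1) /\ continuous (derive1 gamma),
        forall t, 0 <= t <= 1 -> ccod c (gamma t),
        cinv c (gamma 0) = p /\ cinv c (gamma 1) = q &
        l = \int[lebesgue_measure]_(t in `[0, 1])
              Num.sqrt ((derive1 gamma t *m metric c (gamma t)
                         *m (derive1 gamma t)^T) 0 0)].

Inductive joined (p : M) : M -> R -> Prop :=
| joined_nil : joined p p 0
| joined_cons q r l l' :
    joined p q l -> segment q r l' -> joined p r (l + l').

Definition rdist (p q : M) : \bar R := ereal_inf [set l%:E | l in joined p q].

Definition complete_manifold : Prop :=
  forall u : nat -> M,
  (forall e : R, 0 < e -> exists N, forall i j, (N <= i)%N -> (N <= j)%N ->
     (rdist (u i) (u j) < e%:E)%E) ->
  exists p, forall e : R, 0 < e -> exists N, forall i, (N <= i)%N ->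
     (rdist (u i) p < e%:E)%E.

Definition bounded_domain (Omega : set M) : Prop :=
  exists p : M, exists r : R, forall q, Omega q -> (rdist p q <= r%:E)%E.

Definition bdry (Omega : set M) : set M := closure Omega `\` interior Omega.

(* Near each boundary point, [Omega] is the sublevel set [rho < 0] of a smooth
   function whose differential does not vanish at that point. *)
Definition smooth_boundary (Omega : set M) : Prop :=
  forall p, bdry Omega p -> exists U : set M, exists rho : M -> R,
    [/\ open U, U p, smooth_on U rho,
        forall q, U q -> (Omega q <-> rho q < 0) &
        forall c, atlas c -> cdom c p ->
          exists i, pder i (rho \o cinv c) (cmap c p) != 0].

Definition gradient (c : chart R n M) (f : M -> R) (x : 'rV[R]_n) : 'rV[R]_n :=
  (\row_j pder j (f \o cinv c) x) *m invmx (metric c x).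

Definition divergence (c : chart R n M) (V : 'rV[R]_n -> 'rV[R]_n)
    (x : 'rV[R]_n) : R :=
  (Num.sqrt (\det (metric c x)))^-1 *
  \sum_i pder i (fun y => Num.sqrt (\det (metric c y)) * V y 0 i) x.

(* [h] is the Laplacian div (grad f) on [U]. *)
Definition laplacian_on (U : set M) (f h : M -> R) : Prop :=
  forall c, atlas c -> forall x, ccod c x -> U (cinv c x) ->
  h (cinv c x) = divergence c (gradient c f) x.

Definition borel_manifold := g_sigma_algebraType (@open M).

Definition riemannian_measure
    (vol : {measure set borel_manifold -> \bar R}) : Prop :=
  forall c, atlas c -> forall A : set borel_manifold,
  measurable A -> A `<=` cdom c ->
  vol A = integral_rV (fun x =>
    (Num.sqrt (\det (metric c x)) * \1_(ccod c `&` cinv c @^-1` A) x)%:E).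

(* Classical solutions of the Dirichlet problem
   Delta f = h in Omega, f = 0 on the boundary. *)
Definition dirichlet_solution (Omega : set M) (f h : M -> R) : Prop :=
  [/\ Ck_on 2 Omega f, laplacian_on Omega f h,
      {within closure Omega, continuous f} &
      forall p, bdry Omega p -> f p = 0].

Definition dirichlet_eigenspace (Omega : set M) (lambda : R) : set (M -> R) :=
  [set phi | dirichlet_solution Omega phi (fun x => - (lambda * phi x))].

Definition dirichlet_eigenvalue (Omega : set M) (lambda : R) : Prop :=
  exists2 phi, dirichlet_eigenspace Omega lambda phi & exists2 x, Omega x & phi x != 0.

Definition l2dot (vol : {measure set borel_manifold -> \bar R})
    (Omega : set M) (f g : M -> R) : R :=
  \int[vol]_(x in (Omega : set borel_manifold)) (f x * g x).

Definition orthogonal_projection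
    (vol : {measure set borel_manifold -> \bar R}) (Omega : set M)
    (E : set (M -> R)) (f p : M -> R) : Prop :=
  E p /\ forall psi, E psi -> l2dot vol Omega (fun x => f x - p x) psi = 0.

End geometry.

Definition martingale (R : realType) (d : measure_display)
    (W : measurableType d) (P : probability W R)
    (F : R -> set (set W)) (N : R -> W -> R) : Prop :=
  [/\ forall t, 0 <= t -> forall B, measurable B -> F t (N t @^-1` B),
      forall t, 0 <= t -> P.-integrable setT (EFin \o N t) &
      forall s t, 0 <= s -> s <= t -> forall A, F s A ->
        \int[P]_(w in A) N t w = \int[P]_(w in A) N s w].

Section brownian.
Context {R : realType} {n : nat} (M : riemannian_manifold R n).
Context {d : measure_display} {W : measurableType d}.

(* Paths may explode: [None] is the point at infinity. *)
Definition process := R -> W -> one_point_compactification M.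

Definition past (X : process) (t : R) : set (set W) :=
  <<s [set A | exists2 s, 0 <= s <= t &
         exists2 B, open B & A = X s @^-1` B] >>.

(* Diffusion with generator Delta, in the sense of the martingale problem:
   functions on [M] are extended by 0 at infinity, where paths are absorbed
   (completeness of [M] does not exclude explosion in finite time). *)
Definition brownian_motion (P : M -> probability W R) (X : process) : Prop :=
  [/\ forall t, 0 <= t -> forall B, open B -> measurable (X t @^-1` B),
      forall w, {within `[0, +oo[, continuous (fun t => X t w)},
      forall w s t, 0 <= s -> s <= t -> X s w = None -> X t w = None,
      forall x, {ae P x, forall w, X 0 w = Some x} &
      forall (f h : M -> R) x,
        smooth_on setT f -> compact (closure [set y | f y != 0]) ->
        laplacian_on setT f h ->
        martingale (P x) (past X) (fun t w =>
          oapp f 0 (X t w) - oapp f 0 (X 0 w)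
          - \int[lebesgue_measure]_(s in `[0, t]) oapp h 0 (X s w))].

Definition exit_time (X : process) (Omega : set M) (w : W) : \bar R :=
  ereal_inf [set t%:E | t in [set t | 0 <= t /\ ~ (Some @` Omega) (X t w)]].

Definition exit_moment (P : M -> probability W R) (X : process)
    (Omega : set M) (k : nat) (x : M) : \bar R :=
  (\int[P x]_w (exit_time X Omega w) ^+ k)%E.

(* The functions x |-> E^x[tau^k] solve the Poisson hierarchy
   Delta u_k = - k u_(k-1) with u_0 = 1 and zero boundary values. *)
Definition moment_hierarchy (P : M -> probability W R) (X : process)
    (Omega : set M) : Prop :=
  exists u : nat -> M -> R,
    [/\ forall x, Omega x -> u 0%N x = 1,
        forall k, (0 < k)%N ->
          dirichlet_solution Omega (u k) (fun x => - (k%:R * u k.-1 x)) &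
        forall k x, Omega x -> exit_moment P X Omega k x = (u k x)%:E].

Definition total_moment (vol : {measure set (borel_manifold M) -> \bar R})
    (P : M -> probability W R) (X : process) (Omega : set M) (k : nat) : \bar R :=
  (\int[vol]_(x in (Omega : set (borel_manifold M))) exit_moment P X Omega k x)%E.

End brownian.

(* Main.v *)
Require Import Defs.
From HB Require Import structures.
From mathcomp Require Import finmap.
From mathcomp Require Import all_boot all_order all_algebra.
From mathcomp Require Import all_classical all_reals all_analysis.
From mathcomp Require Import measurable_realfun ring lra.

Set Implicit Arguments.
Unset Strict Implicit.
Unset Printing Implicit Defensive.

Import Order.TTheory GRing.Theory Num.Theory.
Import numFieldNormedType.Exports.

Local Open Scope classical_set_scope.
Local Open Scope ring_scope.

(** Let [u_k] solve the moment hierarchy, let [p] be the projection of [1] and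
    [a^2 = (p, p)].  Green's formula gives [(u_k, p) = k! a^2 / lambda^k], and
    [(u_k, u_0) / k! = (u_i, u_j) / (i! j!)] whenever [i + j = k].  Hence, for
    [w_k = u_k / k! - p / lambda^k], which satisfies [- Delta w_(k+1) = w_k],
    [T_k / k! - a^2 / lambda^k] is [(w_m, w_m)] if [k = 2 m] and
    [(w_(m+1), - Delta w_(m+1))] if [k = 2 m + 1]: it is nonnegative.

    The solutions are only continuous up to the boundary, so Green's formula is
    applied to [f] and [g] through the test functions [f rho_d(f^2 + g^2)] and
    [g rho_d(f^2 + g^2)], where [rho_d] vanishes on [[0, d]] and tends to [1]:
    they have compact support in the domain, whose closure is compact by the
    Hopf-Rinow theorem.  A first use of these test functions bounds the energy
    of [f] and [g] where [f^2 + g^2 > 0], and then dominated convergence lets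
    [d] tend to [0]. *)

(** Expanding [1] in eigenfunctions would make [T_k / k!] the sum of [a_mu^2 / mu^k] over all
    eigenvalues. [w_k] is the part of [u_k / k!] orthogonal to [E_lambda], and the quantity shown
    nonnegative is the rest of that sum once the term of [lambda] is removed. Its sign comes from an
    [L^2] square when [k] is even and from a Dirichlet energy when [k] is odd. The obstacle is the
    boundary, near which the gradients may a priori be unbounded. One cutoff in [h = f^2 + g^2]
    serves both functions: the products [grad f . grad g] then cancel in the symmetric identity, and
    differentiating the cutoff costs at most a constant times
    [h rho_d'(h) (|grad f|^2 + |grad g|^2)], where [h rho_d'(h)] is bounded uniformly in [d]. In the
    energy estimate the corresponding term is a multiple of [|grad h|^2] and has the good sign. The
    value [lambda = 0] is settled separately: the identity for [(u_k, p)] then forces [a^2 = 0]. *)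

(** * Differentiability and C^1 calculus on R^n *)

Section differentiability.
Context {R : realType}.

Lemma norm_rV_le n (x : 'rV[R]_n) (e : R) : 0 <= e ->
  (`|x| <= e) <-> (forall i, `|x 0 i| <= e).
Proof.
move=> e0; rewrite [ `|x|]/Num.Def.normr/= mx_normrE; split => [H i|H].
  by apply: le_trans H; exact: (le_bigmax _ (fun ij : 'I_1 * 'I_n => `|x ij.1 ij.2|) (ord0, i)).
by apply: bigmax_le => // -[i j] _ /=; rewrite ord1.
Qed.

Lemma norm_coord_le n (x : 'rV[R]_n) i : `|x 0 i| <= `|x|.
Proof. by move: i; apply/norm_rV_le. Qed.

Lemma rV_sum_delta n (v : 'rV[R]_n) : v = \sum_i v 0 i *: delta_mx 0 i.
Proof. by rewrite {1}[v]row_sum_delta. Qed.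

Lemma is_derive_line n (f : 'rV[R]_n -> R) (y e : 'rV[R]_n) (t : R) :
  derivable f (y + t *: e) e ->
  is_derive t 1 (fun s => f (y + s *: e)) ('D_e f (y + t *: e)).
Proof.
have E : (fun h : R => h^-1 *: (((fun s => f (y + s *: e)) \o shift t) (h *: 1)
            - f (y + t *: e)))
       = (fun h => h^-1 *: ((f \o shift (y + t *: e)) (h *: e) - f (y + t *: e))).
  apply/funext => h /=; congr (_ *: (f _ - _)).
  by rewrite [h%:A]mulr1 scalerDl addrCA.
by move=> df; split; rewrite /derivable /derive E.
Qed.

(** The increment [b] may have either sign, as it will be a coordinate of a displacement; the two
    signs are two applications of the one-variable theorem. *)
Lemma mean_value_line n (f : 'rV[R]_n -> R) (y e : 'rV[R]_n) (b : R) :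
  (forall t : R, `|t| <= `|b| -> derivable f (y + t *: e) e) ->
  exists2 c, `|c| <= `|b| & f (y + b *: e) - f y = b * 'D_e f (y + c *: e).
Proof.
move=> df; set g := fun s => f (y + s *: e).
have dg (t : R) : `|t| <= `|b| -> is_derive t 1 g ('D_e f (y + t *: e)).
  by move=> /df; exact: is_derive_line.
have cg (t : R) : `|t| <= `|b| -> {for t, continuous g}.
  move=> /dg [dg' _]; apply: differentiable_continuous.
  exact/derivable1_diffP.
have g0 : g 0 = f y by rewrite /g scale0r addr0.
have [b0|b0] := leP 0 b.
  have [||c] := @MVT_segment _ g (fun t => 'D_e f (y + t *: e)) _ _ b0.
  - move=> x; rewrite in_itv/= => /andP[/ltW x0 /ltW xb]; apply: dg.
    by rewrite !ger0_norm.
  - apply: continuous_in_subspaceT => x; rewrite inE/= in_itv/= => /andP[x0 xb].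
    by apply: cg; rewrite !ger0_norm.
  rewrite in_itv/= => /andP[c0 cb]; rewrite g0 subr0 mulrC => H; exists c => //.
  by rewrite !ger0_norm.
have [||c] := @MVT_segment _ g (fun t => 'D_e f (y + t *: e)) _ _ (ltW b0).
- move=> x; rewrite in_itv/= => /andP[/ltW x0 /ltW xb]; apply: dg.
  by rewrite !ler0_norm ?lerN2 // ltW.
- apply: continuous_in_subspaceT => x; rewrite inE/= in_itv/= => /andP[x0 xb].
  by apply: cg; rewrite !ler0_norm ?lerN2 // ltW.
rewrite in_itv/= => /andP[c0 cb]; rewrite g0 sub0r mulrN => H; exists c => //.
  by rewrite !ler0_norm ?lerN2 // ltW.
by rewrite -/(g b) -opprB H opprK mulrC.
Qed.

(** The vertices of the broken line from [0] to [h] that follows the coordinate axes. *)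
Definition row_prefix n (k : nat) (h : 'rV[R]_n) : 'rV[R]_n :=
  \row_j (if (j < k)%N then h 0 j else 0).

Lemma row_prefixS n (h : 'rV[R]_n) (i : 'I_n) :
  row_prefix i.+1 h = row_prefix i h + h 0 i *: delta_mx 0 i.
Proof.
apply/rowP => j; rewrite !mxE eqxx /= ltnS leq_eqVlt.
have [->|ji] := eqVneq j i; first by rewrite eqxx ltnn /= mulr1 add0r.
by rewrite (_ : (_ == _ :> nat) = false) ?(negbTE ji) ?mulr0 ?addr0//=; apply/negbTE.
Qed.

Lemma row_prefix_norm n (h : 'rV[R]_n) (i : 'I_n) (c : R) : `|c| <= `|h 0 i| ->
  `|row_prefix i h + c *: delta_mx 0 i| <= `|h|.
Proof.
move=> ch; apply/norm_rV_le => // j; rewrite !mxE eqxx /=.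
have [->|ji] := eqVneq j i.
  by rewrite ltnn add0r mulr1 (le_trans ch)// norm_coord_le.
by rewrite mulr0 addr0; case: ifP => _; rewrite ?normr0 ?norm_coord_le.
Qed.

Lemma differentiable_intro (V W : normedModType R) (f : V -> W)
    (df : {linear V -> W}) x :
  continuous df -> f \o shift x = cst (f x) + df +o_ 0 id -> differentiable f x.
Proof.
by move=> dfc H; apply/diff_locallyP; rewrite (diff_unique dfc H).
Qed.

(* Telescope along the coordinate axes and apply the mean value theorem on each
   edge of the broken line. *)
Lemma partial_differentiable n (f : 'rV[R]_n -> R) x :
  (\forall y \near x, forall i, derivable f y (delta_mx 0 i)) ->
  (forall i, {for x, continuous (pder i f)}) -> differentiable f x.
Proof.
move=> df cf.
pose L (v : 'rV[R]_n) := \sum_i v 0 i * pder i f x.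
have L_lin : linear L.
  move=> a u v; rewrite /L scaler_sumr -big_split /=; apply: eq_bigr => i _.
  by rewrite !mxE mulrDl -mulrA.
pose Lm := GRing.isLinear.Build _ _ _ _ _ L_lin.
pose LL : {linear _ -> _} := HB.pack L Lm.
apply: (@differentiable_intro _ _ _ LL).
  move=> v; rewrite /LL /= (_ : L = \sum_i (fun v : 'rV[R]_n => v 0 i * pder i f x)).
    apply: differentiable_continuous; apply: differentiable_sum => i.
    by apply: differentiableM => //; exact: differentiable_coord.
  by apply/funext => u; rewrite /L; elim/big_ind2 : _ => // f1 a f2 b -> ->.
apply/eqaddoP => e e0.
(* There are [n] edges, each with an error of at most [e' * |h|]; dividing by [n + 1] also covers
   [n = 0]. *)
pose e' := e / n.+1%:R.
have e'0 : 0 < e' by rewrite divr_gt0.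
have near1 : \forall y \near x, (forall i, derivable f y (delta_mx 0 i)) /\
    (forall i, `|pder i f x - pder i f y| <= e').
  near=> y; split; first by near: y.
  near: y; apply: filter_forall => i.
  by have /cvgrPdist_le /(_ _ e'0) := cf i.
have /nbhs_normP[r /= r0 rP] := near1.
have near0 : \forall h \near (0 : 'rV[R]_n), `|h| < r by exact: nbhs0_lt.
rewrite -nbhs_nearE nbhs_simpl /=; near=> h.
have hr : `|h| < r by near: h; exact: near0.
have inb v : `|v| <= `|h| -> (forall i, derivable f (x + v) (delta_mx 0 i)) /\
    (forall i, `|pder i f x - pder i f (x + v)| <= e').
  move=> vh; apply: rP; rewrite /= opprD addrA subrr sub0r normrN.
  exact: le_lt_trans hr.
have step (i : 'I_n) : `|f (x + row_prefix i.+1 h) - f (x + row_prefix i h)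
     - h 0 i * pder i f x| <= e' * `|h|.
  rewrite row_prefixS addrA.
  have [t th|c ch ->] := @mean_value_line n f (x + row_prefix i h) (delta_mx 0 i) (h 0 i).
    by rewrite -addrA; apply inb; exact: row_prefix_norm.
  rewrite -mulrBr normrM mulrC ler_pM ?norm_coord_le// distrC -addrA.
  by apply inb; exact: row_prefix_norm.
have -> : (f \o shift x - (cst (f x) + LL)) h =
   \sum_(i < n) (f (x + row_prefix i.+1 h) - f (x + row_prefix i h)
     - h 0 i * pder i f x).
  rewrite sumrB -(big_mkord xpredT (fun i => f (x + row_prefix i.+1 h) - f (x + row_prefix i h))).
  rewrite telescope_sumr// opprD addrA -[LHS]/(f (h + x) - f x - L h); congr (f _ - f _ - _).
    by rewrite addrC; congr (_ + _); apply/rowP => j; rewrite mxE ltn_ord.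
  by rewrite -[LHS]addr0; congr (_ + _); apply/rowP => j; rewrite !mxE ltn0.
apply: le_trans (ler_norm_sum _ _ _) _.
apply: le_trans (ler_sum _ (fun i _ => step i)) _.
rewrite sumr_const card_ord -mulrnAl ler_wpM2r// /e' -mulr_natr -mulrA ler_piMr//.
  exact: ltW.
by rewrite mulrC ler_pdivrMr// mul1r ler_nat.
Unshelve. all: by end_near. Qed.

Lemma derive_pder n (f : 'rV[R]_n -> R) x v : differentiable f x ->
  'D_v f x = \sum_i v 0 i * pder i f x.
Proof.
move=> df; rewrite deriveE// {1}[v]rV_sum_delta linear_sum /=.
by apply: eq_bigr => i _; rewrite linearZ /= /pder deriveE.
Qed.

Lemma derive_comp n m (f : 'rV[R]_m -> R) (T : 'rV[R]_n -> 'rV[R]_m) x v :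
  differentiable T x -> differentiable f (T x) ->
  'D_v (f \o T) x = 'D_('D_v T x) f (T x).
Proof.
move=> dT df; rewrite !deriveE//; last exact: differentiable_comp.
by rewrite diff_comp.
Qed.

Lemma differentiable_rV (V : normedModType R) n (T : V -> 'rV[R]_n) x :
  (forall j, differentiable (fun y => T y 0 j) x) -> differentiable T x.
Proof.
move=> dT; have -> : T = \sum_j (fun y => T y 0 j *: (delta_mx 0 j : 'rV[R]_n)).
  apply/funext => y; rewrite {1}[T y]rV_sum_delta.
  by elim/big_ind2 : _ => // f1 a f2 b -> ->.
by apply: differentiable_sum => j; exact: differentiableZl.
Qed.

(* Being C^1 near [x] is weakened to: differentiable near [x], with directional
   derivatives continuous at [x]; this is stable under the operations below. *)
Definition C1 n (f : 'rV[R]_n -> R) (x : 'rV[R]_n) : Prop :=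
  (\forall y \near x, differentiable f y) /\
  forall v, {for x, continuous ('D_v f)}.

Lemma near_continuous (T U : topologicalType) (f g : T -> U) x :
  (\forall y \near x, f y = g y) -> {for x, continuous f} -> {for x, continuous g}.
Proof.
move=> fg cf; have fgx : f x = g x := nbhs_singleton fg.
suff : g @ x --> f x by rewrite fgx.
apply: cvg_trans cf; apply: near_eq_cvg.
by apply: filterS fg => y ->.
Qed.

Lemma near_differentiable (V W : normedModType R) (f g : V -> W) x :
  (\forall y \near x, f y = g y) -> differentiable f x -> differentiable g x.
Proof.
move=> fg df; have fgx : f x = g x := nbhs_singleton fg.
have [dfc /eqaddoP dfo] := (diff_locallyP _ _).1 df.
apply: (differentiable_intro dfc); apply/eqaddoP => e e0.
have fg0 : \forall h \near (0 : V), f (h + x) = g (h + x).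
  by have := fg; rewrite (near_shift 0) /= subr0.
move: (dfo e e0); apply: filter_app; apply: filterS fg0.
move=> h /= fgh; rewrite -fgx.
by rewrite -![(_ - _ : _ -> _) _]/(_ - _) /= fgh.
Unshelve. all: by end_near. Qed.

Lemma C1_diff n (f : 'rV[R]_n -> R) x : C1 f x -> differentiable f x.
Proof. by case=> /nbhs_singleton. Qed.

Lemma C1_continuous n (f : 'rV[R]_n -> R) x : C1 f x -> {for x, continuous f}.
Proof. by move=> /C1_diff; exact: differentiable_continuous. Qed.

Lemma C1_near n (f g : 'rV[R]_n -> R) x :
  (\forall y \near x, f y = g y) -> C1 f x -> C1 g x.
Proof.
move=> fg [df cf].
have fg2 : \forall y \near x, \forall z \near y, f z = g z by exact: nbhs_interior fg.
split.
  near=> y; have fgy : \forall z \near y, f z = g z by near: y.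
  have dfy : differentiable f y by near: y.
  exact: near_differentiable fgy dfy.
move=> v; apply: near_continuous (cf v); near=> y.
by apply: near_eq_derive; near: y.
Unshelve. all: by end_near. Qed.

Lemma C1_cst n (a : R) (x : 'rV[R]_n) : C1 (fun=> a) x.
Proof.
split; first by near=> y; exact: differentiable_cst.
move=> v; rewrite (_ : 'D_v _ = fun=> 0) ; first exact: cst_continuous.
by apply/funext => y; rewrite derive_cst.
Unshelve. all: by end_near. Qed.

Lemma C1D n (f g : 'rV[R]_n -> R) x : C1 f x -> C1 g x -> C1 (fun y => f y + g y) x.
Proof.
move=> [df cf] [dg cg]; split; first by near=> y; apply: differentiableD; near: y.
move=> v; apply: near_continuous (continuousD (cf v) (cg v)).
near=> y; rewrite deriveD//; apply: diff_derivable; by near: y.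
Unshelve. all: by end_near. Qed.

Lemma C1M n (f g : 'rV[R]_n -> R) x : C1 f x -> C1 g x -> C1 (fun y => f y * g y) x.
Proof.
move=> f1 g1; have [df cf] := f1; have [dg cg] := g1.
split; first by near=> y; apply: differentiableM; near: y.
move=> v; apply: near_continuous
  (continuousD (continuousM (C1_continuous f1) (cg v)) (continuousM (C1_continuous g1) (cf v))).
near=> y; rewrite deriveM//; apply: diff_derivable; by near: y.
Unshelve. all: by end_near. Qed.

Lemma C1N n (f : 'rV[R]_n -> R) x : C1 f x -> C1 (fun y => - f y) x.
Proof.
move=> f1; apply: (@C1_near _ (fun y => -1 * f y)); last exact/C1M/f1/C1_cst.
by near=> y; rewrite mulN1r.
Unshelve. all: by end_near. Qed.

Lemma C1B n (f g : 'rV[R]_n -> R) x : C1 f x -> C1 g x -> C1 (fun y => f y - g y) x.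
Proof. by move=> f1 g1; exact: (C1D f1 (C1N g1)). Qed.

Lemma C1_sum n (I : Type) (r : seq I) (P : pred I) (f : I -> 'rV[R]_n -> R) x :
  (forall i, P i -> C1 (f i) x) -> C1 (fun y => \sum_(i <- r | P i) f i y) x.
Proof.
move=> fP; elim: r => [|i r IH].
  by rewrite (_ : (fun _ => _) = fun=> 0); [exact: C1_cst|apply/funext => y; rewrite big_nil].
have [Pi|Pi] := boolP (P i).
  rewrite (_ : (fun _ => _) = fun y => f i y + \sum_(i <- r | P i) f i y).
    by apply: C1D => //; exact: fP.
  by apply/funext => y; rewrite big_cons Pi.
rewrite (_ : (fun _ => _) = fun y => \sum_(i <- r | P i) f i y)//.
by apply/funext => y; rewrite big_cons (negbTE Pi).
Qed.

Lemma C1_prod n (I : Type) (r : seq I) (f : I -> 'rV[R]_n -> R) x :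
  (forall i, C1 (f i) x) -> C1 (fun y => \prod_(i <- r) f i y) x.
Proof.
move=> fP; elim: r => [|i r IH].
  by rewrite (_ : (fun _ => _) = fun=> 1); [exact: C1_cst|apply/funext => y; rewrite big_nil].
rewrite (_ : (fun _ => _) = fun y => f i y * \prod_(i <- r) f i y).
  by apply: C1M => //; exact: fP.
by apply/funext => y; rewrite big_cons.
Qed.

Lemma derive_comp1 n (f : 'rV[R]_n -> R) (phi : R -> R) (dphi : R) x v :
  differentiable f x -> is_derive (f x) 1 phi dphi ->
  'D_v (phi \o f) x = dphi * 'D_v f x.
Proof.
move=> df [phi1 <-]; have /derivable1_diffP phi' := phi1.
rewrite deriveE; last exact: differentiable_comp.
rewrite diff_comp//= (deriv1E phi1).
by rewrite -(deriveE _ df) derive1E [_ *: _]mulrC.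
Qed.

(** Derivability of [phi] is asked only near [f x], which admits the inverse and the square root. *)
Lemma C1_comp n (f : 'rV[R]_n -> R) (phi dphi : R -> R) x : C1 f x ->
  (\forall t \near f x, is_derive (t : R) 1 phi (dphi t)) -> {for f x, continuous dphi} ->
  C1 (fun y => phi (f y)) x.
Proof.
move=> f1 phi1 cphi; have [df cf] := f1.
have near_phi : \forall y \near x, is_derive (f y) 1 phi (dphi (f y)).
  exact: (C1_continuous f1 phi1).
split.
  near=> y; apply: (@differentiable_comp _ _ _ _ f phi); first by near: y.
  have [] : is_derive (f y) 1 phi (dphi (f y)) by near: y.
  by move=> /derivable1_diffP.
move=> v; apply: near_continuous
  (continuousM (continuous_comp (C1_continuous f1) cphi) (cf v)).
near=> y; apply/esym/derive_comp1; near: y; [exact: df|exact: near_phi].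
Unshelve. all: by end_near. Qed.

Lemma C1V n (f : 'rV[R]_n -> R) x : C1 f x -> f x != 0 -> C1 (fun y => (f y)^-1) x.
Proof.
move=> f1 fx0; apply: (@C1_comp _ f (fun t => t^-1) (fun t => - t ^- 2)) => //.
  near=> t; have t0 : t != 0 by near: t; exact: open_nbhs_nbhs (conj (@open_neq R 0) fx0).
  apply: is_derive_eq; first by apply: is_deriveV.
  by rewrite [_ *: _]mulr1.
apply: continuousN; apply: continuousV; first by rewrite expf_neq0.
exact: exprn_continuous.
Unshelve. all: by end_near. Qed.

Lemma C1_sqrt n (f : 'rV[R]_n -> R) x : C1 f x -> 0 < f x -> C1 (fun y => Num.sqrt (f y)) x.
Proof.
move=> f1 fx0; apply: (@C1_comp _ f Num.sqrt (fun t => (2 * Num.sqrt t)^-1)) => //.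
  near=> t; apply: is_derive1_sqrt.
  by near: t; exact: open_nbhs_nbhs (conj (@open_gt R 0) fx0).
apply: continuousV; first by rewrite gt_eqF// mulr_gt0// sqrtr_gt0.
by apply: continuousM; [exact: cst_continuous|exact: sqrt_continuous].
Unshelve. all: by end_near. Qed.

Lemma C1_det n m (A : 'rV[R]_n -> 'M[R]_m) x :
  (forall i j, C1 (fun y => A y i j) x) -> C1 (fun y => \det (A y)) x.
Proof.
move=> A1; apply: C1_sum => s _; apply: C1M; first exact: C1_cst.
by apply: C1_prod => i; exact: A1.
Qed.

Lemma C1_invmx n m (A : 'rV[R]_n -> 'M[R]_m) x i j :
  (\forall y \near x, A y \in unitmx) ->
  (forall i j, C1 (fun y => A y i j) x) -> C1 (fun y => invmx (A y) i j) x.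
Proof.
move=> uA A1; apply: (@C1_near _ (fun y => (\det (A y))^-1 * cofactor (A y) j i)).
  by near=> y; rewrite /invmx (near uA y) // !mxE.
apply: C1M.
  apply: C1V; first exact: C1_det.
  by have := nbhs_singleton uA; rewrite unitmxE unitfE.
apply: C1M; first exact: C1_cst.
apply: C1_det => k l.
rewrite (_ : (fun _ => _) = (fun y => A y (lift j k) (lift i l)))//.
by apply/funext => y; rewrite !mxE.
Unshelve. all: by end_near. Qed.

Lemma Ck1_C1 n (U : set 'rV[R]_n) f x : open U -> Ck 1 U f -> U x -> C1 f x.
Proof.
move=> oU [_ fU] Ux.
have dU y : U y -> differentiable f y.
  move=> Uy; apply: partial_differentiable.
    have := open_nbhs_nbhs (conj oU Uy); apply: filterS => z Uz i.
    by apply fU.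
  by move=> i; apply fU.
split; first by have := open_nbhs_nbhs (conj oU Ux); apply: filterS.
move=> v; apply: (@near_continuous _ _ (fun y => \sum_i v 0 i * pder i f y)).
  have := open_nbhs_nbhs (conj oU Ux); apply: filterS => z Uz.
  by rewrite derive_pder//; exact: dU.
rewrite (_ : (fun _ => _) = \sum_i (fun y => v 0 i * pder i f y)); last first.
  by apply/funext => u; elim/big_ind2 : _ => // f1 a f2 b -> ->.
rewrite -big_enum; elim: (enum _) => [|i r IH]; first by rewrite big_nil; exact: cst_continuous.
rewrite big_cons; apply: continuousD => //; apply: continuousM; first exact: cst_continuous.
by apply fU.
Qed.

Lemma Ck_C1 n k (U : set 'rV[R]_n) f x : open U -> Ck k.+1 U f -> U x -> C1 f x.
Proof.
move=> oU fU; apply: Ck1_C1 => //.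
case: fU => [cf fU]; split => // i; have [di ci] := fU i; split => //.
by case: k ci {fU} => [|k] [].
Qed.

Lemma Ck2_pder n (U : set 'rV[R]_n) f i x : open U -> Ck 2 U f -> U x -> C1 (pder i f) x.
Proof. by move=> oU [_ fU] Ux; apply: (Ck1_C1 oU) => //; apply fU. Qed.

End differentiability.

Notation borel T := (g_sigma_algebraType (@open T)).

(** * Borel sets of R^n, Lebesgue measure and integration of partial derivatives *)

Section borel.
Context {R : realType}.

Lemma borel_open (T : ptopologicalType) (U : set T) : open U -> measurable (U : set (borel T)).
Proof. exact: sub_sigma_algebra. Qed.

Lemma borel_closed (T : ptopologicalType) (U : set T) : closed U -> measurable (U : set (borel T)).
Proof.
by move=> cU; rewrite -[U]setCK; apply: measurableC; apply: borel_open; exact: closed_openC.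
Qed.

Lemma open_setI_preimage (T U : topologicalType) (D : set T) (f : T -> U) (B : set U) :
  open D -> (forall x, D x -> {for x, continuous f}) -> open B -> open (D `&` f @^-1` B).
Proof.
move=> oD cf oB; rewrite openE => x [Dx Bfx].
apply: filterI; first exact: open_nbhs_nbhs.
by apply: cf => //; exact: open_nbhs_nbhs.
Qed.

Lemma continuous_borel (T : ptopologicalType) (D : set T) (f : T -> R) : open D ->
  (forall x, D x -> {for x, continuous f}) -> measurable_fun (D : set (borel T)) f.
Proof.
move=> oD cf; apply: (measurability _ (RGenOpens.measurableE R)) => _ [_ [a [b ->] <-]].
by apply: borel_open; exact: open_setI_preimage.
Qed.

(** Rational balls form a countable base of R^n. The radius is taken below [e / 2], so that a
    rational ball containing [x] stays within [e] of it. *)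
Lemma rV_rational_ball n (x : 'rV[R]_n) (e : R) : 0 < e ->
  exists c : 'rV[rat]_n, exists q : rat,
    ball (map_mx ratr c : 'rV[R]_n) (ratr q) x /\
    ball (map_mx ratr c : 'rV[R]_n) (ratr q) `<=` ball x e.
Proof.
move=> e0.
have [q] := rat_in_itvoo (divr_gt0 e0 (ltr0n R 2)).
rewrite in_itv/= => /andP[q0 qe].
have /choice [c cP] : forall i, exists p : rat, `|x 0 i - ratr p| < ratr q.
  move=> i; have [p] := @rat_in_itvoo R (x 0 i - ratr q) (x 0 i + ratr q) ltac:(lra).
  rewrite in_itv/= => /andP[p1 p2]; exists p; rewrite ltr_norml; apply/andP; split; lra.
have xc : ball (map_mx ratr (\row_i c i) : 'rV[R]_n) (ratr q) x.
  by split => // i j; rewrite !mxE ord1 /ball /= distrC; exact: cP.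
exists (\row_i c i), q; split => // y cy.
by apply: (@le_ball _ _ x (ratr q + ratr q)); [lra|apply: ball_triangle cy; exact: ball_sym].
Qed.

(** An open set is a countable union of rational balls. The source carries an arbitrary
    sigma-algebra because [row_cons] starts from a product sigma-algebra, not from the Borel sets of
    a product topology. *)
Lemma borel_preimage_rV d (T : measurableType d) n (phi : T -> 'rV[R]_n) :
  (forall c r, measurable (phi @^-1` ball c r)) ->
  measurable_fun setT (phi : T -> borel 'rV[R]_n).
Proof.
move=> mphi; apply: (@measurability _ _ _ (borel 'rV[R]_n) _ _ (@open 'rV[R]_n)) => // _ [U oU <-].
rewrite setTI.
pose F (i : 'rV[rat]_n * rat) : set 'rV[R]_n :=
  if `[< ball (map_mx ratr i.1 : 'rV[R]_n) (ratr i.2) `<=` U >]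
  then ball (map_mx ratr i.1 : 'rV[R]_n) (ratr i.2) else set0.
have -> : U = \bigcup_i F i.
  rewrite eqEsubset; split => [x Ux|x [i _]]; last first.
    by rewrite /F; case: asboolP => // iU /iU.
  have /nbhs_ballP[e /= e0 eU] := open_nbhs_nbhs (conj oU Ux).
  have [c [q [cx cU]]] := rV_rational_ball x e0.
  exists (c, q) => //; rewrite /F /=; case: asboolP => // -[].
  exact: subset_trans eU.
rewrite preimage_bigcup; apply: countable_bigcupT_measurable => //.
by move=> i; rewrite /F; case: asboolP => _; [exact: mphi|rewrite preimage_set0].
Qed.

(** The map through which [integral_rV] splits off the first coordinate. *)
Definition row_cons n (xv : R * 'rV[R]_n) : 'rV[R]_n.+1 := row_mx (xv.1%:M : 'rV_1) xv.2.

Lemma row_cons0 n (xv : R * 'rV[R]_n) : row_cons xv 0 ord0 = xv.1.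
Proof.
have -> : ord0 = lshift n (ord0 : 'I_1) by exact/val_inj.
by rewrite [LHS](row_mxEl (xv.1%:M : 'rV_1)) mxE eqxx.
Qed.

Lemma row_consS n (xv : R * 'rV[R]_n) (i : 'I_n) : row_cons xv 0 (lift ord0 i) = xv.2 0 i.
Proof.
have -> : lift ord0 i = rshift 1 i by exact/val_inj.
exact: (row_mxEr (xv.1%:M : 'rV_1)).
Qed.

Lemma row_cons_ball n (c : 'rV[R]_n.+1) r : 0 < r ->
  @row_cons n @^-1` ball c r =
  ball (c 0 ord0) r `*` ball (\row_(i < n) c 0 (lift ord0 i)) r.
Proof.
move=> r0; rewrite eqEsubset; split => -[x v] /=.
  move=> [_ H]; split; first by have := H 0 ord0; rewrite row_cons0.
  by split => // i j; have := H 0 (lift ord0 j); rewrite ord1 row_consS mxE.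
move=> [xb [_ H]]; split => // i j; rewrite ord1.
case: (unliftP ord0 j) => [k ->|->]; last by rewrite row_cons0.
by have := H 0 k; rewrite mxE row_consS.
Qed.

Lemma measurable_row_cons n :
  measurable_fun setT (@row_cons n : measurableTypeR R * borel 'rV[R]_n -> borel 'rV[R]_n.+1).
Proof.
apply: borel_preimage_rV => c r; have [r0|r0] := ltP 0 r; last first.
  have -> : ball c r = set0 by apply/seteqP; split => // y [r1]; lra.
  by rewrite preimage_set0.
rewrite row_cons_ball//; apply: measurableX; first exact: measurable_ball.
by apply: borel_open; exact: ball_open.
Qed.

Lemma row_cons_continuous n (xv : R * 'rV[R]_n) : {for xv, continuous (@row_cons n)}.
Proof.
apply/cvgrPdist_lt => e e0; have := nbhsx_ballx xv e e0; apply: filterS => yw yb.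
have : ball (row_cons xv) e (row_cons yw).
  case: yb => yb1 [_ yb2]; split => // i j; rewrite ord1.
  case: (unliftP ord0 j) => [k ->|->]; first by rewrite !row_consS; exact: yb2.
  by rewrite !row_cons0.
by rewrite -ball_normE.
Qed.

Lemma continuous_row_consl n (v : 'rV[R]_n) (x : R) : {for x, continuous (fun x => row_cons (x, v))}.
Proof.
apply: (@continuous_comp _ _ _ (fun x => (x, v)) (@row_cons n)); last exact: row_cons_continuous.
move=> A /= [[P Q] [/= Px Qw] PQ]; apply: filterS Px => u Qu.
by apply: PQ; split => //=; exact: nbhs_singleton Qw.
Qed.

Lemma continuous_slice n (g : 'rV[R]_n.+1 -> R) (v : 'rV[R]_n) : continuous g ->
  continuous (fun x : R => g (row_cons (x, v))).
Proof.
move=> cg x; apply: (@continuous_comp _ _ _ (fun x => row_cons (x, v)) g); last exact: cg.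
exact: continuous_row_consl.
Qed.

Lemma norm_row_consl n (x : R) (v : 'rV[R]_n) : `|x| <= `|row_cons (x, v)|.
Proof. by rewrite -[x in `|x|](row_cons0 (x, v)) norm_coord_le. Qed.

Lemma norm_row_consr n (x : R) (v : 'rV[R]_n) : `|v| <= `|row_cons (x, v)|.
Proof. by apply/norm_rV_le => // i; rewrite -(row_consS (x, v)) norm_coord_le. Qed.

(** Fubini's theorem in the induction of [rV_measure] requires sigma-finiteness; cubes of known mass
    exhaust the space. *)
Lemma rV_sigma_finite n (m : {measure set (borel 'rV[R]_n) -> \bar R}) :
  (forall c r, 0 < r -> m (ball c r) = ((r *+ 2) ^+ n)%:E) -> sigma_finite setT m.
Proof.
move=> mb; exists (fun k => ball (0 : 'rV[R]_n) k.+1%:R).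
  apply/esym/seteqP; split => // x _; exists (Num.truncn `|x|) => //.
  by rewrite -ball_normE /= sub0r normrN truncnS_gt.
move=> k; split; first by apply: borel_open; exact: ball_open.
by rewrite mb// ltry.
Qed.

Lemma derive_row_cons n (f : 'rV[R]_n.+1 -> R) x v w :
  'D_(row_cons (0, w)) f (row_cons (x, v)) = 'D_w (fun w => f (row_cons (x, w))) v.
Proof.
have E : (fun h : R => h^-1 *: ((f \o shift (row_cons (x, v))) (h *: row_cons (0, w)) - f (row_cons (x, v))))
  = (fun h => h^-1 *: (((fun w => f (row_cons (x, w))) \o shift v) (h *: w) - f (row_cons (x, v)))).
  apply/funext => h /=; congr (_ *: (f _ - _)); apply/rowP => j; rewrite [LHS]mxE [X in X + _]mxE.
  by case: (unliftP ord0 j) => [k ->|->]; rewrite ?row_consS ?row_cons0/= ?mulr0 ?add0r// !mxE.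
by rewrite /derive E.
Qed.

Lemma C1_row_cons n (f : 'rV[R]_n.+1 -> R) x v : C1 f (row_cons (x, v)) ->
  C1 (fun w => f (row_cons (x, w))) v.
Proof.
move=> [df cf].
have crow (w : 'rV[R]_n) : {for w, continuous (fun w => row_cons (x, w))}.
  apply: (@continuous_comp _ _ _ (pair x) (@row_cons n)).
      move=> A /= [[P Q] [/= Px Qw] PQ]; apply: filterS Qw => u Qu.
    by apply: PQ; split => //=; exact: nbhs_singleton Px.
  exact: row_cons_continuous.
have drow (w : 'rV[R]_n) : differentiable (fun w => row_cons (x, w)) w.
  apply: differentiable_rV => j; case: (unliftP ord0 j) => [k ->|->].
    rewrite (_ : (fun _ => _) = fun w : 'rV[R]_n => w 0 k); first exact: differentiable_coord.
    by apply/funext => w'; rewrite row_consS.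
  rewrite (_ : (fun _ => _) = cst x); first exact: differentiable_cst.
  by apply/funext => w'; rewrite row_cons0.
split; first by near=> w; apply: (@differentiable_comp _ _ _ _ _ f) => //; near: w; exact: (crow v _ df).
move=> w; rewrite (_ : 'D_w _ = fun v => 'D_(row_cons (0, w)) f (row_cons (x, v))); last first.
  by apply/funext => u; rewrite derive_row_cons.
apply: (@continuous_comp _ _ _ (fun v => row_cons (x, v)) ('D_(row_cons (0, w)) f)).
  exact: crow.
exact: cf.
Unshelve. all: by end_near. Qed.

Lemma pder_row_consS n (f : 'rV[R]_n.+1 -> R) (i : 'I_n) x v :
  pder (lift ord0 i) f (row_cons (x, v)) = pder i (fun w => f (row_cons (x, w))) v.
Proof.
rewrite /pder -derive_row_cons; congr ('D_ _ f _).
apply/rowP => j; rewrite mxE eqxx /=.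
case: (unliftP ord0 j) => [k ->|->]; rewrite ?row_consS ?row_cons0 ?(inj_eq lift_inj)//=.
by rewrite mxE eqxx.
Qed.

Lemma pder_row_cons0 n (f : 'rV[R]_n.+1 -> R) x v : differentiable f (row_cons (x, v)) ->
  is_derive x 1 (fun x => f (row_cons (x, v))) (pder ord0 f (row_cons (x, v))).
Proof.
move=> df.
have E y : row_cons (y, v) = row_cons (0, v) + y *: delta_mx 0 ord0.
  apply/rowP => j; rewrite [RHS]mxE [X in _ + X]mxE.
  case: (unliftP ord0 j) => [k ->|->]; rewrite ?row_consS ?row_cons0/= mxE eqxx /=.
    by rewrite mulr0 addr0.
  by rewrite mulr1 add0r.
rewrite (_ : (fun _ => _) = fun y => f (row_cons (0, v) + y *: delta_mx 0 ord0)).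
  by rewrite E; apply: is_derive_line; rewrite -E; exact: diff_derivable.
by apply/funext => y; rewrite E.
Qed.

Lemma compact_norm_ball n (x0 : 'rV[R]_n) (r : R) : compact [set x : 'rV[R]_n | `|x - x0| <= r].
Proof.
apply: bounded_closed_compact.
  exists (r + `|x0|); split; rewrite ?num_real// => B AB x /= xr.
  by rewrite -[x](subrK x0) (le_trans (ler_normD _ _))// (le_trans _ (ltW AB))// lerD2r.
rewrite (_ : mkset _ = (fun x => `|x - x0|) @^-1` [set s | s <= r])//.
apply: closed_comp; last exact: closed_le.
move=> x _; apply: continuous_comp; last exact: norm_continuous.
by apply: continuousB; [exact: cvg_id|exact: cst_continuous].
Qed.

Lemma compact_support_bounded n (g : 'rV[R]_n -> R) (A : R) : continuous g ->
  (forall x, A <= `|x| -> g x = 0) -> exists2 C, 0 <= C & forall x, `|g x| <= C.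
Proof.
move=> cg g0.
have cK : compact [set x : 'rV[R]_n | `|x| <= A].
  rewrite (_ : mkset _ = [set x | `|x - 0| <= A]); first exact: compact_norm_ball.
  by apply/seteqP; split => x /=; rewrite subr0.
have := continuous_compact (continuous_subspaceT cg) cK.
move=> /compact_bounded [M [_ MP]].
exists (`|M| + 1); first by rewrite addr_ge0.
move=> x; have [xA|/ltW xA] := leP `|x| A; last by rewrite g0// normr0 addr_ge0.
apply: (MP (`|M| + 1)); last by exists x.
by rewrite (le_lt_trans (ler_norm _))// ltrDl.
Qed.

Lemma continuous_bounded_integrable n (m : {measure set (borel 'rV[R]_n) -> \bar R}) (g : 'rV[R]_n -> R) (A : R) :
  (forall c r, 0 < r -> m (ball c r) = ((r *+ 2) ^+ n)%:E) ->
  continuous g -> (forall x, A <= `|x| -> g x = 0) ->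
  m.-integrable setT (EFin \o g).
Proof.
move=> mb cg g0.
have [C C0 gC] := compact_support_bounded cg g0.
have mg : measurable_fun (setT : set (borel 'rV[R]_n)) g.
  by apply: continuous_borel => [|x _]; [exact: openT|exact: cg].
apply/integrableP; split; first exact/measurable_EFinP.
have [A0|A0] := leP A 0.
  rewrite (eq_integral (fun=> 0%E)) ?integral0 ?ltry// => x _ /=.
  by rewrite g0 ?normr0// (le_trans A0).
pose B := ball (0 : 'rV[R]_n) A.
have mB : measurable (B : set (borel 'rV[R]_n)) by apply: borel_open; exact: ball_open.
apply: (@le_lt_trans _ _ (\int[m]_(x in B) (C%:E))%E).
  rewrite [leRHS]integral_mkcond; apply: ge0_le_integral => //=.
  - by apply/measurable_EFinP; exact: measurableT_comp.
  - by apply/(measurable_restrictT _ _).1 => //; exact: measurable_cst.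
  move=> x _; rewrite patchE; case: ifPn => [_|]; first by rewrite lee_fin.
  rewrite notin_setE /B -ball_normE /= sub0r normrN => /negP; rewrite -leNgt => Ax.
  by rewrite g0// normr0.
by rewrite integral_cst// mb// -EFinM ltry.
Qed.

Lemma integral_derive_compact (f df : R -> R) (A : R) : 0 < A ->
  (forall x : R, is_derive x 1 f (df x)) -> continuous df ->
  (forall x, A <= `|x| -> f x = 0) -> (forall x, A <= `|x| -> df x = 0) ->
  (\int[lebesgue_measure]_x (df x)%:E = 0)%E.
Proof.
move=> A0 fdf cdf f0 df0.
have cf : continuous f.
  by move=> x; apply: differentiable_continuous; apply/derivable1_diffP; have [] := fdf x.
have E : (EFin \o df) \_ `[- A, A] = EFin \o df.
  apply/funext => x; rewrite patchE; case: ifPn => //; rewrite notin_setE/= in_itv/= => /negP xA.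
  rewrite df0// leNgt; apply: contra xA; rewrite ltr_norml => /andP[/ltW -> /ltW ->//].
rewrite -[X in integral _ _ X]E -integral_mkcond (@continuous_FTC2 _ df f).
- by rewrite !f0 ?subee// ?normrN ger0_norm// ltW.
- by lra.
- exact: continuous_subspaceT.
- split; first by move=> x _; have [] := fdf x.
    by apply: cvg_at_right_filter; exact: cf.
  by apply: cvg_at_left_filter; exact: cf.
- by move=> x _; rewrite derive1E; have [_ ->] := fdf x.
Qed.

(** The radius grows from [A] to [A + 1] because [f] has to vanish near the point, not only at
    it. *)
Lemma pder_support n (f : 'rV[R]_n -> R) (A : R) i : (forall x, A <= `|x| -> f x = 0) ->
  forall x, A + 1 <= `|x| -> pder i f x = 0.
Proof.
move=> f0 x xA; rewrite /pder (@near_eq_derive _ _ _ f (cst 0)) ?derive_cst//.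
have oA : open (Num.norm @^-1` [set r | A < r] : set 'rV[R]_n).
  by apply: open_comp => [y _|]; [exact: norm_continuous|exact: open_gt].
have xA' : (Num.norm @^-1` [set r | A < r] : set 'rV[R]_n) x by rewrite /=; lra.
by have := open_nbhs_nbhs (conj oA xA'); apply: filterS => y /ltW /f0.
Qed.

Lemma integral_pder_slice n (f : 'rV[R]_n.+1 -> R) (A : R) (v : 'rV[R]_n) : 0 < A ->
  (forall x, C1 f x) -> (forall x, A <= `|x| -> f x = 0) ->
  (\int[lebesgue_measure]_x (pder ord0 f (row_cons (x, v)))%:E = 0)%E.
Proof.
move=> A0 f1 f0.
apply: (@integral_derive_compact (fun x => f (row_cons (x, v))) (fun x => pder ord0 f (row_cons (x, v))) (A + 1)).
- by rewrite addr_gt0.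
- by move=> x; apply: pder_row_cons0; exact: C1_diff.
- by apply: continuous_slice => x; have [_] := f1 x; apply.
- by move=> x xA; rewrite f0// (le_trans _ (norm_row_consl _ _))//; lra.
- move=> x xA; apply: (pder_support ord0 f0).
  by rewrite (le_trans xA)// norm_row_consl.
Qed.

Section sigma_finite_copy.
Context d (T : measurableType d) (m : {measure set T -> \bar R}).
Hypothesis sfm : sigma_finite setT m.
(** An alias of [m] that carries the proof of sigma-finiteness, so that the canonical structure can
    be attached to a measure obtained from an existential statement. *)
Definition with_sigma_finite & sigma_finite setT m : set T -> \bar R := m.
HB.instance Definition _ := Measure.on (with_sigma_finite sfm).
HB.instance Definition _ := Measure_isSigmaFinite.Build _ _ _ (with_sigma_finite sfm) sfm.
End sigma_finite_copy.

(* Fubini in the first coordinate reduces both the mass of cubes and the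
   vanishing of integrated partial derivatives to dimension [n]. *)
Lemma rV_measure n : exists m : {measure set (borel 'rV[R]_n) -> \bar R},
  [/\ forall f : 'rV[R]_n -> \bar R, measurable_fun (setT : set (borel 'rV[R]_n)) f ->
       (forall x, 0 <= f x)%E -> integral_rV f = (\int[m]_x f x)%E,
      forall c r, 0 < r -> m (ball c r) = ((r *+ 2) ^+ n)%:E &
      forall (f : 'rV[R]_n -> R) (A : R), 0 < A -> (forall x, C1 f x) ->
       (forall x, A <= `|x| -> f x = 0) ->
       forall i, (\int[m]_x (pder i f x)%:E = 0)%E].
Proof.
elim: n => [|n [m [mint mball mpder]]].
  exists (\d_ (0 : borel 'rV[R]_0)); split.
  - by move=> f mf f0; rewrite integral_dirac// diracT mul1e.
  - move=> c r r0; rewrite expr0 /= diracE mem_set//.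
    by split => // i [].
  - by move=> f A _ _ _ [].
pose m' := with_sigma_finite (rV_sigma_finite mball).
pose mu := (@lebesgue_measure R \x m')%E.
have mphi := @measurable_row_cons n.
pose M := measure_function_pushforward__canonical__measure_function_Measure mu mphi.
have Mball (c : 'rV[R]_n.+1) r : 0 < r -> M (ball c r) = ((r *+ 2) ^+ n.+1)%:E.
  move=> r0; rewrite /M /= /pushforward row_cons_ball// product_measure1E//; first last.
  - by apply: borel_open; exact: ball_open.
  - exact: measurable_ball.
  transitivity ((r *+ 2)%:E * ((r *+ 2) ^+ n)%:E)%E; last by rewrite -EFinM exprS.
  by congr (_ * _)%E; [exact: lebesgue_measure_ball (ltW r0)|exact: (mball _ _ r0)].
exists M; split => //.
- move=> f mf f0; rewrite [RHS]ge0_integral_pushforward//.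
  rewrite preimage_setT fubini_tonelli1//; first last.
    by move=> x; exact: f0.
    exact: measurableT_comp.
  apply: eq_integral => x _; apply: mint => [|v]; last exact: f0.
  have mx : measurable_fun setT (fun v : borel 'rV[R]_n => @row_cons n (x, v) : borel 'rV[R]_n.+1).
    exact: (measurableT_comp mphi (pair1_measurable x)).
  exact: (measurableT_comp mf mx).
move=> f A A0 f1 f0 i.
have cpf : continuous (pder i f) by move=> x; have [_] := f1 x; apply.
have pf0 x : A + 1 <= `|x| -> pder i f x = 0 by exact: pder_support.
have mpf : measurable_fun (setT : set (borel 'rV[R]_n.+1)) (EFin \o pder i f).
  by apply/measurable_EFinP; apply: continuous_borel => [|x _]; [exact: openT|exact: cpf].
have ipf : M.-integrable setT (EFin \o pder i f) by exact: continuous_bounded_integrable Mball cpf pf0.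
have imu : mu.-integrable setT ((EFin \o pder i f) \o @row_cons n).
  apply/integrableP; split; first exact: (measurableT_comp mpf mphi).
  have /integrableP[_] := ipf.
  by rewrite ge0_integral_pushforward//; apply: (measurableT_comp _ mpf).
rewrite [LHS]integral_pushforward// preimage_setT.
(* A derivative along a later coordinate is a derivative of a slice, integrated first by the
   induction hypothesis; along the first coordinate, the lines are integrated first. *)
case: (unliftP ord0 i) imu => [j ->|->] imu.
  rewrite -integral12_prod_meas1//.
  apply: integral0_eq => x _; rewrite /fubini_F /=.
  under eq_integral do rewrite pder_row_consS.
  apply: (mpder _ A) => // [v|v vA]; first exact: C1_row_cons.
  by rewrite f0// (le_trans vA)// norm_row_consr.
rewrite -integral21_prod_meas1//.
by apply: integral0_eq => v _; apply: (integral_pder_slice v A0).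
Qed.

End borel.

(** * Positive definite matrices *)

Section posdef_matrix.
Context {R : realType}.

Definition posdef n (G : 'M[R]_n) := forall v : 'rV[R]_n, v != 0 -> 0 < (v *m G *m v^T) 0 0.

Lemma posdef_det_neq0 n (G : 'M[R]_n) : posdef G -> \det G != 0.
Proof.
move=> pG; apply/negP => /det0P[v v0 vG]; have := pG v v0.
by rewrite vG mul0mx mxE ltxx.
Qed.

Lemma posdef1 n : posdef (1%:M : 'M[R]_n).
Proof.
move=> v v0; rewrite mulmx1 mxE.
have [i vi] : exists i, v 0 i != 0.
  apply/existsP; rewrite -negb_forall; apply: contra v0 => /forallP H.
  by apply/eqP/rowP => i; rewrite mxE; exact/eqP.
rewrite (bigD1 i)//= ltr_pwDl// ?mxE -?expr2 ?exprn_even_gt0//.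
by apply: sumr_ge0 => j _; rewrite mxE -expr2 sqr_ge0.
Qed.

(* Deform [G] to the identity through positive definite matrices: the
   determinant keeps its sign. *)
Lemma posdef_det_gt0 n (G : 'M[R]_n) : posdef G -> 0 < \det G.
Proof.
move=> pG.
(* Along the segment from the identity to [G] the determinant is a polynomial in the parameter, so a
   change of sign would produce a root. *)
pose p : {poly R} := \det (map_mx polyC (1%:M : 'M[R]_n) + 'X *: map_mx polyC (G - 1%:M)).
have pE t : p.[t] = \det (1%:M + t *: (G - 1%:M)).
  rewrite -horner_evalE -det_map_mx; congr (\det _).
  by apply/matrixP => i j; rewrite !mxE /= horner_evalE !hornerE.
have p1 : p.[1] = \det G by rewrite pE scale1r addrC subrK.
have p0 : p.[0] = 1 by rewrite pE scale0r addr0 det1.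
have path t : 0 <= t <= 1 -> posdef (1%:M + t *: (G - 1%:M)).
  move=> /andP[t0 t1] v v0.
  have -> : 1%:M + t *: (G - 1%:M) = (1 - t) *: 1%:M + t *: G.
    by apply/matrixP => i j; rewrite !mxE; ring.
  rewrite mulmxDr mulmxDl -!scalemxAr -!scalemxAl !mxE.
  have := pG v v0; have := posdef1 v0; rewrite mulmx1.
  rewrite [X in 0 < X -> _]mxE [X in _ -> 0 < X -> _]mxE.
  set a := \sum_j _; set b := \sum_j _ => a0 b0.
  have [->|tn] := eqVneq t 0; first by rewrite subr0 mul1r mul0r addr0.
  rewrite ltr_wpDl// ?mulr_ge0 ?(ltW a0) ?subr_ge0// mulr_gt0//.
  by rewrite lt_neqAle eq_sym tn.
rewrite ltNge; apply/negP => detG.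
(* [poly_ivt] expects values going from nonpositive to nonnegative, hence [- p]. *)
have [||t t01] := @poly_ivt R (- p) 0 1; first exact: ler01.
  by rewrite !hornerN p0 p1 oppr_le0 oppr_ge0 ler01.
 rewrite rootN /root pE => /eqP d0.
by have := posdef_det_neq0 (path t t01); rewrite d0 eqxx.
Qed.

Lemma posdef_unit n (G : 'M[R]_n) : posdef G -> G \in unitmx.
Proof. by move=> pG; rewrite unitmxE unitfE posdef_det_neq0. Qed.

Lemma posdef_invmx_ge0 n (G : 'M[R]_n) (d : 'rV[R]_n) : posdef G -> G^T = G ->
  0 <= (d *m invmx G *m d^T) 0 0.
Proof.
move=> pG sG; have uG := posdef_unit pG.
have -> : d *m invmx G *m d^T = d *m invmx G *m G *m (d *m invmx G)^T.
  by rewrite mulmxKV// trmx_mul trmx_inv sG mulmxA.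
have [->|v0] := eqVneq (d *m invmx G) 0; last exact/ltW/pG.
by rewrite !mul0mx mxE.
Qed.

(** The duality between a vector [v] and a covector [d]: the discriminant of the square norm of
    [v - t u], where [u = d G^-1] is the vector dual to [d]. It will bound the derivative of a
    function along a curve by the norm of its gradient times the speed. *)
Lemma posdef_cauchy_schwarz n (G : 'M[R]_n) (v d : 'rV[R]_n) : posdef G -> G^T = G ->
  ((v *m d^T) 0 0) ^+ 2 <= (v *m G *m v^T) 0 0 * (d *m invmx G *m d^T) 0 0.
Proof.
move=> pG sG; have uG := posdef_unit pG.
set a := (d *m invmx G *m d^T) 0 0; set b := (v *m d^T) 0 0; set c := (v *m G *m v^T) 0 0.
have H t : 0 <= c - t * b *+ 2 + t ^+ 2 * a.
  pose u := d *m invmx G; pose w := v - t *: u.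
  have : 0 <= (w *m G *m w^T) 0 0.
    have [->|w0] := eqVneq w 0; last exact/ltW/pG.
    by rewrite !mul0mx mxE.
  suff -> : (w *m G *m w^T) 0 0 = c - t * b *+ 2 + t ^+ 2 * a by [].
  have uGE : u *m G = d by rewrite /u mulmxKV.
  have GuE : G *m u^T = d^T by rewrite -{1}sG -trmx_mul uGE.
  have wG : w *m G = v *m G - t *: d by rewrite /w mulmxBl -scalemxAl uGE.
  have wT : w^T = v^T - t *: u^T by rewrite /w linearB /= linearZ.
  rewrite wG wT mulmxBr !mulmxBl -!scalemxAl -!scalemxAr.
  rewrite -[v *m G *m u^T]mulmxA GuE.
  have -> : d *m v^T = (v *m d^T)^T by rewrite trmx_mul trmxK.
  have -> : d *m u^T = (u *m d^T)^T by rewrite [RHS]trmx_mul trmxK.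
  rewrite !mxE; rewrite /a /b /c !mxE; ring.
have a0 : 0 <= a by exact: posdef_invmx_ge0.
have [aE|an] := eqVneq a 0.
  have [-> |bn] := eqVneq b 0; first by rewrite expr0n /= aE mulr0.
  (* With [a = 0] the quadratic is affine in [t]; this [t] gives it the value [-1]. *)
  have := H ((c + 1) / (b *+ 2)); rewrite aE mulr0 addr0.
  have -> : (c + 1) / (b *+ 2) * b *+ 2 = c + 1 by rewrite -mulrnAr divfK// mulrn_eq0.
  by rewrite opprD addrA subrr; lra.
have ap : 0 < a by rewrite lt_neqAle eq_sym an.
have := H (b / a).
have -> : c - b / a * b *+ 2 + (b / a) ^+ 2 * a = (c * a - b ^+ 2) / a by field.
by rewrite pmulr_lge0 ?invr_gt0// subr_ge0.
Qed.

(** The hypothesis bears on the whole product because the matrix known to be invertible is the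
    metric of one chart written in terms of another; the invertibility of [J] follows. *)
Lemma congruence_invmx n (J G : 'M[R]_n) : J *m G *m J^T \in unitmx ->
  J^T *m invmx (J *m G *m J^T) *m J = invmx G.
Proof.
move=> uJ; have := uJ; rewrite !unitmx_mul unitmx_tr => /andP[/andP[Ju Gu] _].
have JtU : J^T \in unitmx by rewrite unitmx_tr.
set X := invmx _.
have E : J^T *m X *m J *m G = 1%:M.
  transitivity (J^T *m (X *m (J *m G *m J^T)) *m invmx J^T); first by rewrite !mulmxA mulmxK.
  by rewrite mulVmx// mulmx1 mulmxV.
by rewrite -[LHS](mulmxK Gu) E mul1mx.
Qed.

End posdef_matrix.

(** * First-order calculus on the manifold *)

Section manifold_calculus.
Context {R : realType} {n : nat} (M : riemannian_manifold R n).
Implicit Types (c : chart R n M) (f g h : M -> R) (p q : M) (U : set M).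

Definition chart_codom c U := ccod c `&` cinv c @^-1` U.

Lemma open_chart_codom c U : open U -> open (chart_codom c U).
Proof.
move=> oU; apply: open_setI_preimage => //; first exact: open_ccod.
exact: cinv_continuous.
Qed.

Lemma near_cinv c p U : open U -> cdom c p -> U p ->
  \forall x \near cmap c p, chart_codom c U x.
Proof.
move=> oU cp Up; apply: open_nbhs_nbhs; split; first exact: open_chart_codom.
by split; [exact: cmap_cod|rewrite /preimage /= cmapK].
Qed.

Lemma near_chart c p (P : M -> Prop) : cdom c p ->
  (\forall q \near p, P q) -> \forall x \near cmap c p, P (cinv c x).
Proof.
move=> cp Pp; have := @cinv_continuous _ _ _ c (cmap c p) (cmap_cod cp).
by apply; rewrite cmapK.
Qed.

Definition MC1 f p := forall c, atlas c -> cdom c p -> C1 (f \o cinv c) (cmap c p).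

Lemma MC1_near f g p : (\forall q \near p, f q = g q) -> MC1 f p -> MC1 g p.
Proof. by move=> fg f1 c ac cp; apply: C1_near (f1 c ac cp); exact: (@near_chart c p (fun q => f q = g q)). Qed.

Lemma MC1_continuous f p : MC1 f p -> {for p, continuous f}.
Proof.
have [c ac cp] := atlas_cover p => f1.
apply: (@near_continuous _ _ ((f \o cinv c) \o cmap c)).
  have := open_nbhs_nbhs (conj (@open_cdom _ _ _ c) cp).
  by apply: filterS => q cq /=; rewrite cmapK.
apply: continuous_comp; first exact: cmap_continuous.
exact/C1_continuous/f1.
Qed.

Lemma Ck_on_MC1 k U f p : open U -> Ck_on k.+1 U f -> U p -> MC1 f p.
Proof.
move=> oU fU Up c ac cp; apply: (@Ck_C1 _ _ k (chart_codom c U)); [exact: open_chart_codom|exact: fU|].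
by split; [exact: cmap_cod|rewrite /preimage /= cmapK].
Qed.

Lemma MC1_cst (a : R) p : MC1 (fun=> a) p.
Proof. by move=> c _ _; exact: C1_cst. Qed.

Lemma MC1D f g p : MC1 f p -> MC1 g p -> MC1 (fun q => f q + g q) p.
Proof. by move=> f1 g1 c ac cp; exact: (C1D (f1 c ac cp) (g1 c ac cp)). Qed.

Lemma MC1M f g p : MC1 f p -> MC1 g p -> MC1 (fun q => f q * g q) p.
Proof. by move=> f1 g1 c ac cp; exact: (C1M (f1 c ac cp) (g1 c ac cp)). Qed.

Lemma MC1V f p : MC1 f p -> f p != 0 -> MC1 (fun q => (f q)^-1) p.
Proof. by move=> f1 fp c ac cp; apply: (C1V (f1 c ac cp)); rewrite /= cmapK. Qed.

Lemma MC1_comp f (phi dphi : R -> R) p : MC1 f p ->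
  (forall t : R, is_derive t 1 phi (dphi t)) -> continuous dphi ->
  MC1 (fun q => phi (f q)) p.
Proof.
move=> f1 phi1 cphi c ac cp; apply: (C1_comp (f1 c ac cp) _ (cphi _)).
by near=> t; exact: phi1.
Unshelve. all: by end_near. Qed.

Lemma MC1_sum (I : Type) (r : seq I) (f : I -> M -> R) p :
  (forall i, MC1 (f i) p) -> MC1 (fun q => \sum_(i <- r) f i q) p.
Proof.
by move=> f1 c ac cp; apply: (@C1_sum _ _ I r xpredT (fun i => f i \o cinv c)) => i _; exact: f1.
Qed.

(* The differential of [f] read in the chart [c], and the inner product
   of two gradients. *)
Definition dchart c f (x : 'rV[R]_n) : 'rV[R]_n := \row_j pder j (f \o cinv c) x.

Definition gdot_chart c f g (x : 'rV[R]_n) : R :=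
  (dchart c f x *m invmx (metric c x) *m (dchart c g x)^T) 0 0.

Lemma transition_C1 c c' x j : atlas c -> atlas c' -> ccod c x -> cdom c' (cinv c x) ->
  C1 (fun y => transition c c' y 0 j) x.
Proof.
move=> ac ac' cx c'x.
apply: (@Ck_C1 _ _ 0 (chart_codom c (cdom c'))) => //.
  by apply: open_chart_codom; exact: open_cdom.
exact: (atlas_smooth ac ac' j).
Qed.

Lemma derive_dchart c f x v : differentiable (f \o cinv c) x ->
  'D_v (f \o cinv c) x = (v *m (dchart c f x)^T) 0 0.
Proof. by move=> df; rewrite derive_pder// mxE; apply: eq_bigr => i _; rewrite !mxE. Qed.

Lemma dchart_transition c c' f x : atlas c -> atlas c' -> ccod c x -> cdom c' (cinv c x) ->
  MC1 f (cinv c x) ->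
  dchart c f x = dchart c' f (transition c c' x) *m (jacobian (transition c c') x)^T.
Proof.
move=> ac ac' cx c'x f1.
have dT : differentiable (transition c c') x.
  by apply: differentiable_rV => j; apply/C1_diff; exact: transition_C1.
have df' : differentiable (f \o cinv c') (transition c c' x) by exact/C1_diff/f1.
have df : differentiable (f \o cinv c) x.
  by have := C1_diff (f1 c ac (cinv_dom cx)); rewrite cinvK.
have near_eq : \forall y \near x, (f \o cinv c) y = ((f \o cinv c') \o transition c c') y.
  have := @near_cinv c (cinv c x) (cdom c') (@open_cdom _ _ _ c') (cinv_dom cx) c'x.
  by rewrite cinvK//; apply: filterS => y [cy c'y] /=; rewrite cmapK.
apply: (can_inj (@trmxK _ _ _)); rewrite trmx_mul trmxK.
apply/matrixP => i j; rewrite ord1.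
have D (A : 'cV[R]_n) : A i 0 = ((delta_mx 0 i : 'rV[R]_n) *m A) 0 0 by rewrite -rowE mxE.
rewrite [LHS]D [RHS]D -derive_dchart// (near_eq_derive _ near_eq) derive_comp//.
by rewrite deriveEjacobian// mulmxA -derive_dchart.
Qed.

Lemma metric_unit c x : atlas c -> ccod c x -> metric c x \in unitmx.
Proof. by move=> ac cx; apply: posdef_unit => v; exact: metric_posdef. Qed.

Lemma gdot_chart_transition c c' f g x : atlas c -> atlas c' -> ccod c x -> cdom c' (cinv c x) ->
  MC1 f (cinv c x) -> MC1 g (cinv c x) ->
  gdot_chart c f g x = gdot_chart c' f g (transition c c' x).
Proof.
move=> ac ac' cx c'x f1 g1; rewrite /gdot_chart !(dchart_transition ac ac' cx c'x)//.
have := metric_unit ac cx; rewrite (metric_compat ac ac' cx c'x) => uJ.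
by rewrite trmx_mul trmxK -(congruence_invmx uJ) !mulmxA.
Qed.

Definition chart_at p : chart R n M := projT1 (cid2 (atlas_cover p)).

Lemma chart_atP p : atlas (chart_at p) /\ cdom (chart_at p) p.
Proof. by rewrite /chart_at; case: cid2. Qed.

(** Computed in a chosen chart; [gdotE] shows that any chart of the atlas gives the same value on
    C^1 functions. *)
Definition gdot f g p := gdot_chart (chart_at p) f g (cmap (chart_at p) p).

Lemma gdotE c f g p : atlas c -> cdom c p -> MC1 f p -> MC1 g p ->
  gdot f g p = gdot_chart c f g (cmap c p).
Proof.
move=> ac cp f1 g1; have [ac' cp'] := chart_atP p.
rewrite /gdot (@gdot_chart_transition c (chart_at p)) ?cmapK//; last exact: cmap_cod.
by rewrite /transition /= cmapK.
Qed.

Lemma gdot_chartE c f g x : gdot_chart c f g x =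
  \sum_i \sum_j pder i (f \o cinv c) x * invmx (metric c x) i j * pder j (g \o cinv c) x.
Proof.
rewrite /gdot_chart mxE exchange_big; apply: eq_bigr => j _; rewrite !mxE mulr_suml.
by apply: eq_bigr => i _; rewrite !mxE.
Qed.

Lemma gdotC f g p : gdot f g p = gdot g f p.
Proof.
have [ac cp] := chart_atP p; rewrite /gdot /gdot_chart.
set x := cmap _ _; set G := metric _ x.
have sG : G^T = G by apply: Defs.metric_sym => //; exact: cmap_cod.
set d := dchart _ f x; set e := dchart _ g x.
have -> : d *m invmx G *m e^T = (e *m invmx G *m d^T)^T.
  by rewrite !trmx_mul trmxK trmx_inv sG mulmxA.
by rewrite mxE.
Qed.

Lemma gdot_ge0 f p : 0 <= gdot f f p.
Proof.
have [ac cp] := chart_atP p; apply: posdef_invmx_ge0.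
  by move=> v; apply: metric_posdef => //; exact: cmap_cod.
by apply: Defs.metric_sym => //; exact: cmap_cod.
Qed.

(** The sum, product and chain rules are all identities between differentials at [p]; this lemma
    transfers each of them to [gdot]. *)
Lemma gdot_linear_comb f g h (a b : R) k p : (forall c, atlas c -> cdom c p ->
   dchart c f (cmap c p) = a *: dchart c g (cmap c p) + b *: dchart c h (cmap c p)) ->
  gdot f k p = a * gdot g k p + b * gdot h k p.
Proof.
move=> H; have [ac cp] := chart_atP p; rewrite /gdot /gdot_chart H//.
by rewrite !mulmxDl -!scalemxAl !mxE.
Qed.

Lemma gdotD f g k p : MC1 f p -> MC1 g p ->
  gdot (fun q => f q + g q) k p = gdot f k p + gdot g k p.
Proof.
move=> f1 g1; rewrite (@gdot_linear_comb _ f g 1 1) ?mul1r// => c ac cp.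
rewrite !scale1r; apply/rowP => j; rewrite !mxE /pder.
by apply: deriveD; apply/diff_derivable/C1_diff; [exact: f1|exact: g1].
Qed.

Lemma gdotM f g k p : MC1 f p -> MC1 g p ->
  gdot (fun q => f q * g q) k p = f p * gdot g k p + g p * gdot f k p.
Proof.
move=> f1 g1; apply: gdot_linear_comb => c ac cp.
apply/rowP => j; rewrite !mxE /pder.
rewrite [LHS]deriveM /= ?cmapK//; apply/diff_derivable/C1_diff; [exact: f1|exact: g1].
Qed.

Lemma gdot_comp f (phi : R -> R) (dphi : R) k p : MC1 f p ->
  is_derive (f p) 1 phi dphi ->
  gdot (fun q => phi (f q)) k p = dphi * gdot f k p.
Proof.
move=> f1 phi1; rewrite (@gdot_linear_comb _ f f dphi 0) ?mul0r ?addr0// => c ac cp.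
rewrite scale0r addr0; apply/rowP => j; rewrite !mxE /pder.
have := @derive_comp1 R n (f \o cinv c) phi dphi (cmap c p) (delta_mx 0 j).
by apply; [exact/C1_diff/f1|rewrite /= cmapK].
Qed.

Lemma gdot_near f g k p : (\forall q \near p, f q = g q) -> gdot f k p = gdot g k p.
Proof.
move=> fg; have := @gdot_linear_comb f g g 1 0 k p; rewrite mul1r mul0r addr0; apply.
move=> c ac cp; rewrite scale1r scale0r addr0; apply/rowP => j; rewrite !mxE.
by apply: near_eq_derive; exact: (@near_chart c p (fun q => f q = g q)).
Qed.

Lemma metric_C1 c x i j : atlas c -> ccod c x -> C1 (fun y => metric c y i j) x.
Proof.
by move=> ac cx; apply: (@Ck_C1 _ _ 0 (ccod c)) => //; [exact: open_ccod|exact: metric_smooth].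
Qed.

Lemma invmetric_C1 c x i j : atlas c -> ccod c x -> C1 (fun y => invmx (metric c y) i j) x.
Proof.
move=> ac cx; apply: C1_invmx; last by move=> k l; exact: metric_C1.
have := open_nbhs_nbhs (conj (@open_ccod _ _ _ c) cx).
by apply: filterS => y cy; exact: metric_unit.
Qed.

Lemma gdot_continuous f g U p : open U -> U p -> (forall q, U q -> MC1 f q) ->
  (forall q, U q -> MC1 g q) -> {for p, continuous (gdot f g)}.
Proof.
move=> oU Up f1 g1; have [c ac cp] := atlas_cover p.
(* [gdot] changes chart from point to point, so it is first replaced near [p] by its expression in
   one fixed chart. *)
apply: (@near_continuous _ _ (gdot_chart c f g \o cmap c)).
  have oUc : open (U `&` cdom c) by apply: openI => //; exact: open_cdom.
  have := open_nbhs_nbhs (conj oUc (conj Up cp)).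
  by apply: filterS => q [Uq cq]; rewrite (gdotE ac cq) //; [exact: f1|exact: g1].
apply: continuous_comp; first exact: cmap_continuous.
rewrite (_ : gdot_chart c f g = \sum_i \sum_j (fun x => pder i (f \o cinv c) x *
   invmx (metric c x) i j * pder j (g \o cinv c) x)); last first.
  apply/funext => x; rewrite gdot_chartE.
  elim/big_ind2 : _ => // [f1' a f2' b -> ->//|i _].
  by elim/big_ind2 : _ => // f1' a f2' b -> ->.
have csum (I : Type) (r : seq I) (F : I -> 'rV[R]_n -> R) x :
    (forall i, {for x, continuous (F i)}) -> {for x, continuous (\sum_(i <- r) F i)}.
  move=> cF; elim: r => [|i r IH]; first by rewrite big_nil; exact: cst_continuous.
  by rewrite big_cons; apply: continuousD.
apply: (csum) => i; apply: (csum) => j; apply: continuousM; first apply: continuousM.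
- by have [_] := f1 p Up c ac cp; apply.
- by apply: C1_continuous; apply: invmetric_C1 => //; exact: cmap_cod.
- by have [_] := g1 p Up c ac cp; apply.
Qed.

End manifold_calculus.

(** * The squared positive part *)

Section cutoff_functions.
Context {R : realType}.

(** The square removes the corner of the positive part at [0]: the chain rules for [C1] and [MC1]
    ask for a continuous derivative. *)
Definition pos2 (t : R) : R := (Num.max 0 t) ^+ 2.

Lemma pos2_ge0 t : 0 <= pos2 t. Proof. exact: sqr_ge0. Qed.

Lemma max0_continuous : continuous (fun t : R => Num.max 0 t).
Proof. by move=> t; apply: continuous_max; [exact: cst_continuous|exact: cvg_id]. Qed.

Lemma is_derive_pos2 (t : R) : is_derive t 1 pos2 (2 * Num.max 0 t).
Proof.
have [t0|t0|t0] := ltgtP t 0.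
- apply: (@near_eq_is_derive _ _ _ (cst 0)).
    have := open_nbhs_nbhs (conj (@open_lt R 0) t0); apply: filterS => s /= s0.
    by rewrite /pos2 max_l ?expr0n// ltW.
  by rewrite mulr0; exact: is_derive_cst.
- apply: (@near_eq_is_derive R R R (fun s : R => s ^+ 2 : R)).
    have := open_nbhs_nbhs (conj (@open_gt R 0) t0); apply: filterS => s /= s0.
    by rewrite /pos2 max_r// ltW.
  apply: is_derive_eq.
  by rewrite ![_ *: _]mulr1 -mulr2n mulr_natl.
rewrite t0 mulr0.
have cv : (fun h : R => h^-1 *: ((pos2 \o shift 0) (h *: 1) - pos2 0)) @ 0^' --> (0 : R).
  apply/cvgrPdist_le => e e0; near=> h.
  have h0 : h != 0 by near: h; exact: nbhs_dnbhs_neq.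
  rewrite sub0r normrN /pos2 /= addr0 maxxx expr0n subr0 [h%:A]mulr1.
  have [hp|hn] := leP 0 h; last by rewrite expr0n/= scaler0 normr0 ltW.
  rewrite expr2 [_ *: _]mulKf//.
  by near: h; exact: dnbhs0_le.
by split; [apply/cvg_ex; exists 0|exact: cvg_lim cv].
Unshelve. all: by end_near. Qed.

Lemma continuous_dpos2 : continuous (fun t : R => 2 * Num.max 0 t).
Proof. by move=> t; apply: cvgM; [exact: cvg_cst|exact: max0_continuous]. Qed.

End cutoff_functions.

(** * Bump functions *)

Section bump.
Context {R : realType} {n : nat} (M : riemannian_manifold R n).
Implicit Types (c : chart R n M) (f g h : M -> R) (p q : M) (U K : set M).

Lemma compact_image_cinv c (K : set 'rV[R]_n) : compact K -> K `<=` ccod c ->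
  compact (cinv c @` K).
Proof.
move=> cK Kc; apply: continuous_compact => //.
apply: continuous_in_subspaceT => x; rewrite inE => /Kc.
exact: cinv_continuous.
Qed.

Lemma compact_image_cmap c K : compact K -> K `<=` cdom c -> compact (cmap c @` K).
Proof.
move=> cK Kc; apply: continuous_compact => //.
apply: continuous_in_subspaceT => x; rewrite inE => /Kc.
exact: cmap_continuous.
Qed.

Lemma compact_closed_manifold K : compact K -> closed K.
Proof. by apply: compact_closed; exact: carrier_hausdorff. Qed.

(** The Hausdorff axiom makes [K] closed, so [f] vanishes on a neighbourhood of [p]. *)
Lemma MC1_off_compact K f p : compact K -> (forall q, ~ K q -> f q = 0) -> ~ K p -> MC1 f p.
Proof.
move=> cK f0 Kp; apply: (@MC1_near _ _ _ (fun=> 0)); last exact: MC1_cst.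
have oK : open (~` K) by apply: closed_openC; exact: compact_closed_manifold.
by have := open_nbhs_nbhs (conj oK Kp); apply: filterS => q /f0 ->.
Qed.

(** The support lies in the domain of a single chart, which is what Green's formula needs in order
    to be proved in coordinates. *)
Definition is_bump c K psi p :=
  [/\ atlas c, compact K, K `<=` cdom c, (forall q, MC1 psi q) &
   [/\ forall q, 0 <= psi q, 0 < psi p & forall q, ~ K q -> psi q = 0]].

Lemma exists_bump U p : open U -> U p ->
  exists c K psi, K `<=` U /\ is_bump c K psi p.
Proof.
move=> oU Up; have [c ac cp] := atlas_cover p.
have /nbhs_ballP[e /= e0 eP] := near_cinv oU cp Up.
set x0 := cmap c p in eP.
pose r := e / 2; have r0 : 0 < r by rewrite divr_gt0.
pose K0 := [set x : 'rV[R]_n | `|x - x0| <= r].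
have K0P : K0 `<=` chart_codom c U.
  move=> x xr; apply: eP; rewrite -ball_normE /= distrC.
  by rewrite (le_lt_trans xr)// /r; lra.
have cK0 : compact K0 by exact: compact_norm_ball.
pose K := cinv c @` K0.
have KU : K `<=` U by move=> _ [x /K0P[_ +] <-].
have Kc : K `<=` cdom c by move=> _ [x /K0P[cx _] <-]; exact: cinv_dom.
have cK : compact K by apply: compact_image_cinv => // x /K0P[].
(* The norm on rows is a maximum and is not differentiable, so a sum of squares is used instead. It
   dominates the square of each coordinate, so [E > 0] still forces [x] into [K0]. *)
pose E (x : 'rV[R]_n) := r ^+ 2 - \sum_i (x 0 i - x0 0 i) ^+ 2.
pose psi q := if `[< cdom c q >] then pos2 (E (cmap c q)) else 0.
have psi0 q : ~ K q -> psi q = 0.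
  move=> Kq; rewrite /psi; case: asboolP => // cq.
  have : ~ K0 (cmap c q) by move=> H; apply: Kq; exists (cmap c q) => //; rewrite cmapK.
  move=> H; rewrite /pos2 max_l ?expr0n// /E subr_le0 leNgt; apply/negP => Er.
  apply: H; apply/norm_rV_le => [|i]; first exact: ltW.
  rewrite -(@ler_pXn2r _ 2) ?nnegrE ?(ltW r0)// real_normK ?num_real//.
  apply: le_trans (ltW Er); rewrite !mxE (bigD1 i)//= lerDl.
  by apply: sumr_ge0 => j _; exact: sqr_ge0.
exists c, K, psi; split => //; split => //; last first.
  split => // [q|].
    by rewrite /psi; case: asboolP => // _; exact: pos2_ge0.
  rewrite /psi; case: asboolP => // _; rewrite /E big1 ?subr0; last first.
    by move=> i _; rewrite subrr expr0n.
  by rewrite /pos2 max_r ?exprn_ge0 ?(ltW r0)// !exprn_gt0.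
move=> q; have [cq|cq] := pselect (cdom c q); last first.
  by apply: (MC1_off_compact cK) => // /Kc.
move=> c' ac' c'q.
apply: (@C1_near _ _ (fun y => pos2 (E (transition c' c y)))).
  have := @near_cinv _ _ M c' q (cdom c) (@open_cdom _ _ _ c) c'q cq.
  apply: filterS => y [_ cy] /=; rewrite /psi; case: asboolP => //.
apply: (@C1_comp _ _ _ pos2 (fun t => 2 * Num.max 0 t)); first last.
- exact: continuous_dpos2.
- by near=> t; exact: is_derive_pos2.
apply: C1B; first exact: C1_cst.
apply: C1_sum => i _.
have T1 : C1 (fun y => transition c' c y 0 i - x0 0 i) (cmap c' q).
  apply: C1B; last exact: C1_cst.
  by apply: transition_C1 => //; [exact: cmap_cod|rewrite cmapK].
exact: (C1M T1 T1).
Unshelve. all: by end_near. Qed.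

Lemma gdot_off_compact K f g p : compact K -> (forall q, ~ K q -> f q = 0) -> ~ K p ->
  gdot f g p = 0.
Proof.
move=> cK f0 Kp; have oK : open (~` K) by apply: closed_openC; exact: compact_closed_manifold.
rewrite (@gdot_near _ _ _ f (fun=> 0)); last first.
  by have := open_nbhs_nbhs (conj oK Kp); apply: filterS => q /f0 ->.
have := @gdot_comp _ _ _ (fun=> 0) (fun=> 0) 0 g p (@MC1_cst _ _ M 0 p).
by rewrite mul0r; apply; exact: is_derive_cst.
Qed.

Lemma gdot_bounded K f : compact K -> (forall q, MC1 f q) -> (forall q, ~ K q -> f q = 0) ->
  exists2 C, 0 < C & forall q, gdot f f q <= C.
Proof.
move=> cK f1 f0.
have cf : continuous (gdot f f).
  by move=> p; apply: (@gdot_continuous _ _ _ f f setT) => //; exact: openT.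
have := continuous_compact (continuous_subspaceT cf) cK.
move=> /compact_bounded [C [_ CP]]; exists (`|C| + 1); first by rewrite ltr_wpDl.
move=> q; have [Kq|Kq] := pselect (K q).
  rewrite (le_trans (ler_norm _))//; apply: (CP (`|C| + 1)); last by exists q.
  by rewrite (le_lt_trans (ler_norm _))// ltrDl.
by rewrite (gdot_off_compact _ cK)// addr_ge0.
Qed.

End bump.

(** * The fundamental theorem of calculus on [0, 1] *)

Section unit_interval.
Context {R : realType}.
Local Notation I01 := (`[0%R, 1%R]%classic : set R).

Lemma integrable01 (f : R -> R) : (forall t, 0 <= t <= 1 -> {for t, continuous f}) ->
  lebesgue_measure.-integrable I01 (EFin \o f).
Proof.
move=> cf; apply: continuous_compact_integrable; first exact: segment_compact.
by apply: continuous_in_subspaceT => t; rewrite inE/= in_itv/=; exact: cf.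
Qed.

Lemma Rintegral_derive01 (F f : R -> R) :
  (forall t : R, 0 <= t <= 1 -> is_derive t 1 F (f t)) ->
  (forall t, 0 <= t <= 1 -> {for t, continuous f}) ->
  \int[lebesgue_measure]_(t in I01) f t = F 1 - F 0.
Proof.
move=> dF cf.
have cF t : 0 <= t <= 1 -> {for t, continuous F}.
  by move=> /dF [dF' _]; apply: differentiable_continuous; exact/derivable1_diffP.
rewrite /Rintegral (@continuous_FTC2 _ f F)//.
- by apply: continuous_in_subspaceT => t; rewrite inE/= in_itv/=; exact: cf.
- split; first by move=> t; rewrite in_itv/= => /andP[/ltW t0 /ltW t1]; apply dF; rewrite t0.
    by apply: cvg_at_right_filter; apply: cF; rewrite lexx ler01.
  by apply: cvg_at_left_filter; apply: cF; rewrite lexx ler01.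
- move=> t; rewrite in_itv/= => /andP[/ltW t0 /ltW t1].
  by have [] := dF t; rewrite ?t0// derive1E.
Qed.

Lemma primitive01 (f : R -> R) : (forall t, 0 <= t <= 1 -> {for t, continuous f}) ->
  exists F : R -> R, forall t : R, 0 <= t <= 1 -> is_derive t 1 F (f t).
Proof.
(* Clamping extends the integrand continuously to the line. Integrating from [-1] then yields a
   two-sided derivative at [0] and at [1] as well. *)
move=> cf; pose clamp (t : R) := Num.min 1 (Num.max 0 t).
have clampP t : 0 <= clamp t <= 1.
  by rewrite /clamp ge_min lexx le_min ler01 le_max lexx.
have clampE t : 0 <= t <= 1 -> clamp t = t.
  by move=> /andP[t0 t1]; rewrite /clamp max_r// min_r.
pose g t := f (clamp t).
have cg : continuous g.
  move=> t; apply: (@continuous_comp _ _ _ clamp f); last exact: cf.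
  by apply: continuous_min; [exact: cst_continuous|exact: max0_continuous].
exists (fun x => \int[lebesgue_measure]_(t in `[-1, x]) g t) => t /andP[t0 t1].
have [||||dF FE] := @continuous_FTC1_closed _ g (-1) t 2.
- by lra.
- apply: continuous_compact_integrable; first exact: segment_compact.
  exact: continuous_subspaceT.
- by lra.
- exact: cg.
split => //; rewrite -derive1E FE /g clampE//; exact/andP.
Qed.

End unit_interval.

(** * Riemannian distance and the Hopf-Rinow theorem *)

Section riemannian_distance.
Context {R : realType} {n : nat} (M : riemannian_manifold R n).
Implicit Types (c : chart R n M) (f g h : M -> R) (p q : M) (U K : set M) (gamma : R -> 'rV[R]_n).

Definition speed c gamma t : R :=
  Num.sqrt ((derive1 gamma t *m metric c (gamma t) *m (derive1 gamma t)^T) 0 0).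

Lemma quadratic_formE (v : 'rV[R]_n) (G : 'M[R]_n) :
  (v *m G *m v^T) 0 0 = \sum_j (\sum_i v 0 i * G i j) * v 0 j.
Proof. by rewrite mxE; apply: eq_bigr => j _; rewrite !mxE. Qed.

Lemma continuous_sumf (T : topologicalType) (I : Type) (r : seq I) (F : I -> T -> R) x :
  (forall i, {for x, continuous (F i)}) -> {for x, continuous (fun y => \sum_(i <- r) F i y)}.
Proof.
move=> cF; elim: r => [|i r IH].
  by rewrite (_ : (fun _ => _) = cst 0); [exact: cst_continuous|apply/funext => y; rewrite big_nil].
rewrite (_ : (fun _ => _) = fun y => F i y + \sum_(i <- r) F i y).
  exact: continuousD.
by apply/funext => y; rewrite big_cons.
Qed.

Lemma metric_continuous c x i j : atlas c -> ccod c x -> {for x, continuous (fun y => metric c y i j)}.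
Proof. by move=> ac cx; exact/C1_continuous/metric_C1. Qed.

Lemma speed_continuous c gamma t : atlas c -> (forall t, derivable gamma t 1) ->
  continuous (derive1 gamma) -> ccod c (gamma t) -> {for t, continuous (speed c gamma)}.
Proof.
move=> ac dg cdg cgt.
have cg : {for t, continuous gamma} by apply: differentiable_continuous; exact/derivable1_diffP.
have ccoord i : {for t, continuous (fun s => derive1 gamma s 0 i)}.
  by apply: (@continuous_comp _ _ _ (derive1 gamma) (fun v : 'rV[R]_n => v 0 i)); [exact: cdg|exact: coord_continuous].
rewrite /speed; apply: continuous_comp; last exact: sqrt_continuous.
rewrite (_ : (fun _ => _) = fun s =>
  \sum_j (\sum_i derive1 gamma s 0 i * metric c (gamma s) i j) * derive1 gamma s 0 j); last first.
  by apply/funext => s; rewrite quadratic_formE.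
apply: continuous_sumf => j; apply: continuousM => //; apply: continuous_sumf => i.
apply: continuousM => //.
by apply: (@continuous_comp _ _ _ gamma (fun x => metric c x i j)); [exact: cg|exact: metric_continuous].
Qed.

Lemma segment_ge0 p q l : segment p q l -> 0 <= l.
Proof. by move=> [c [gamma [_ _ _ _ ->]]]; apply: Rintegral_ge0 => t _; exact: sqrtr_ge0. Qed.

Lemma affine_is_derive (a b t : R) : is_derive t 1 (fun s : R => a + (b - a) * s) (b - a).
Proof.
apply: is_derive_eq; rewrite add0r.
by rewrite mul1r [_ *: _]mulr1.
Qed.

Lemma derive1_affine gamma (a b t : R) : (forall t, derivable gamma t 1) ->
  derivable (fun s => gamma (a + (b - a) * s)) t 1 /\
  derive1 (fun s => gamma (a + (b - a) * s)) t = (b - a) *: derive1 gamma (a + (b - a) * t).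
Proof.
move=> dg.
have [dl lE] := affine_is_derive a b t.
have dl' : differentiable (fun s : R => a + (b - a) * s) t by exact/derivable1_diffP.
have dg' : differentiable gamma (a + (b - a) * t) by exact/derivable1_diffP.
have dc : differentiable (gamma \o (fun s : R => a + (b - a) * s)) t by exact: differentiable_comp.
split; first exact/derivable1_diffP.
rewrite derive1E -[LHS]/('D_1 (gamma \o (fun s : R => a + (b - a) * s)) t) deriveE// diff_comp//=.
by rewrite (deriv1E (dg _)) /= -(deriveE _ dl') lE.
Qed.

Lemma affine01 (a b t : R) : 0 <= a <= 1 -> 0 <= b <= 1 -> 0 <= t <= 1 -> 0 <= a + (b - a) * t <= 1.
Proof.
move=> /andP[a0 a1] /andP[b0 b1] /andP[t0 t1].
have -> : a + (b - a) * t = (1 - t) * a + t * b by ring.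
apply/andP; split; first by rewrite addr_ge0// mulr_ge0// subr_ge0.
have : (1 - t) * a <= (1 - t) * 1 by rewrite ler_wpM2l// subr_ge0.
have : t * b <= t * 1 by rewrite ler_wpM2l.
by lra.
Qed.

(* With [b < a] allowed, this also reverses segments. *)
Lemma subsegment p q l : segment p q l -> exists (z : R -> M) (F : R -> R),
  [/\ z 0 = p /\ z 1 = q, F 0 = 0 /\ F 1 = l, (forall t, 0 <= t <= 1 -> {for t, continuous F}) &
      forall a b, 0 <= a <= 1 -> 0 <= b <= 1 -> segment (z a) (z b) `|F b - F a| ].
Proof.
move=> [c [gamma [ac [dg cdg] gc [gp gq] lE]]].
have cs t : 0 <= t <= 1 -> {for t, continuous (speed c gamma)}.
  by move=> t01; apply: speed_continuous => //; exact: gc.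
have [F0 dF] := primitive01 cs.
have lF : l = F0 1 - F0 0 by rewrite lE -(Rintegral_derive01 dF).
exists (cinv c \o gamma), (fun t => F0 t - F0 0); split => //; first by rewrite subrr.
- move=> t t01; apply: continuousB; last exact: cst_continuous.
  by have [d _] := dF t t01; apply: differentiable_continuous; exact/derivable1_diffP.
move=> a b a01 b01; rewrite opprB addrA subrK.
exists c, (fun t => gamma (a + (b - a) * t)); split; first exact: ac.
- split; first by move=> t; have [] := derive1_affine a b t dg.
  rewrite (_ : derive1 _ = fun t => (b - a) *: derive1 gamma (a + (b - a) * t)); last first.
    by apply/funext => t; have [] := derive1_affine a b t dg.
  move=> t; apply: (@cvgZl_tmp _ _ _ _ _ (b - a) (fun t => derive1 gamma (a + (b - a) * t))).
  apply: (@continuous_comp _ _ _ (fun s => a + (b - a) * s) (derive1 gamma)); last exact: cdg.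
  by have [d _] := affine_is_derive a b t; apply: differentiable_continuous; exact/derivable1_diffP.
- by move=> t t01; apply: gc; exact: affine01.
- by rewrite mulr0 addr0 mulr1 addrC subrK; split.
have spE t : 0 <= t <= 1 ->
    Num.sqrt ((derive1 (fun t => gamma (a + (b - a) * t)) t *m metric c (gamma (a + (b - a) * t))
      *m (derive1 (fun t => gamma (a + (b - a) * t)) t)^T) 0 0) =
    `|b - a| * speed c gamma (a + (b - a) * t).
  move=> t01; have [_ ->] := derive1_affine a b t dg.
  rewrite linearZ /= -!scalemxAl -scalemxAr scalerA mxE -expr2 sqrtrM ?sqr_ge0// sqrtr_sqr.
  by [].
rewrite [RHS](_ : _ = \int[lebesgue_measure]_(t in `[0, 1]) (`|b - a| * speed c gamma (a + (b - a) * t))); last first.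
  by apply: eq_Rintegral => t; rewrite inE/= in_itv/=; exact: spE.
set I := Rintegral _ _ _.
have I0 : 0 <= I by apply: Rintegral_ge0 => t _; rewrite mulr_ge0// sqrtr_ge0.
(* Since [I] is nonnegative, it is enough to know it up to the sign of [b - a]; this treats both
   orientations at once, and [a = b] gives [0]. *)
suff IE : I = Num.sg (b - a) * (F0 b - F0 a).
  rewrite -[RHS]ger0_norm// IE normrM normr_sg subr_eq0.
  by have [->|_] := eqVneq b a; rewrite ?mul1r// subrr normr0 mulr0.
have dG (t : R) : 0 <= t <= 1 -> is_derive t 1 (fun t => Num.sg (b - a) * F0 (a + (b - a) * t))
    (`|b - a| * speed c gamma (a + (b - a) * t)).
  move=> t01; have := dF _ (affine01 a01 b01 t01); set y := a + (b - a) * t => dFy.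
  have dc : is_derive t 1 (F0 \o (fun s => a + (b - a) * s)) ((b - a) * speed c gamma y).
    rewrite mulrC; exact: (@is_derive1_comp _ F0 (fun s => a + (b - a) * s) t _ _ dFy (affine_is_derive a b t)).
  have -> : `|b - a| * speed c gamma y = Num.sg (b - a) *: ((b - a) * speed c gamma y).
    by rewrite normrEsg -[RHS]/(_ * _) mulrA.
  exact: (@is_deriveZ _ _ _ (F0 \o (fun s => a + (b - a) * s)) (Num.sg (b - a)) t 1 _ dc).
rewrite /I (Rintegral_derive01 dG).
  by rewrite mulr0 addr0 mulr1 [a + _]addrC subrK -mulrBr.
move=> t t01; apply: cvgM; first exact: cvg_cst.
apply: (@continuous_comp _ _ _ (fun s => a + (b - a) * s) (speed c gamma)).
  by have [d _] := affine_is_derive a b t; apply: differentiable_continuous; exact/derivable1_diffP.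
by apply: cs; exact: affine01.
Qed.

Lemma segment_sym p q l : segment p q l -> segment q p l.
Proof.
move=> s; have l0 := segment_ge0 s.
have [z [F [[z0 z1] [F0 F1] _ sub]]] := subsegment s.
have := sub 1 0; rewrite !lexx ler01 => /(_ isT isT).
by rewrite z0 z1 F0 F1 sub0r normrN ger0_norm.
Qed.

(** Arc length is continuous, so the curve can be cut at any length [m] in [[0, l]]; the assumption
    [l < a + b] leaves room for [l - b < m < a]. *)
Lemma segment_split p q l (a b : R) : segment p q l -> 0 < a -> 0 < b -> l < a + b ->
  exists z l1 l2, [/\ segment p z l1, segment z q l2, l1 < a & l2 < b].
Proof.
move=> s a0 b0 lab; have l0 := segment_ge0 s.
have [z [F [[z0 z1] [F0 F1] cF sub]]] := subsegment s.
have [m [m0 ml ma mb]] : exists m, [/\ 0 <= m, m <= l, m < a & l - m < b].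
  have [lb|bl] := ltP l b; first by exists 0; split => //; rewrite subr0.
  have [la|al] := leP l a.
    by exists (l - b / 2); split; lra.
  by exists ((l - b + a) / 2); split; lra.
have [|||t] := @IVT _ F 0 1 m.
- exact: ler01.
- by apply: continuous_in_subspaceT => t; rewrite inE/= in_itv/=; exact: cF.
- by rewrite F0 F1 min_l// max_r// m0.
rewrite in_itv/= => t01 Fm.
have s1 := sub 0 t; have s2 := sub t 1.
exists (z t), `|F t - F 0|, `|F 1 - F t|; split.
- by rewrite -z0; apply: s1 => //; rewrite lexx ler01.
- by rewrite -z1; apply: s2 => //; rewrite lexx ler01.
- by rewrite F0 Fm subr0 ger0_norm.
- by rewrite F1 Fm ger0_norm// subr_ge0.
Qed.

Lemma joined_segment p q l : segment p q l -> joined p q l.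
Proof. by move=> s; rewrite -[l]add0r; apply: joined_cons s; exact: joined_nil. Qed.

Lemma joined_trans p q r l l' : joined p q l -> joined q r l' -> joined p r (l + l').
Proof.
move=> pq; elim=> {r l'} [|r s l1 l2 _ IH rs]; first by rewrite addr0.
by rewrite addrA; exact: joined_cons rs.
Qed.

Lemma joined_sym p q l : joined p q l -> joined q p l.
Proof.
elim=> {q l} [|q r l l' _ IH qr]; first exact: joined_nil.
by rewrite addrC; apply: joined_trans IH; exact/joined_segment/segment_sym.
Qed.

(** The inequality is strict so that an infimum below [e] is witnessed by an actual chain of
    segments. *)
Definition within p q (e : R) := exists2 l, joined p q l & l < e.

Lemma rdist_within p q (e : R) : (rdist p q < e%:E)%E <-> within p q e.
Proof.
split => [/ereal_inf_lt[_ [l pql <-]]|[l pql le]].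
  by rewrite lte_fin => le; exists l.
by apply: (@le_lt_trans _ _ l%:E); rewrite ?lte_fin//; apply: ereal_inf_lbound; exists l.
Qed.

Lemma within_refl p (e : R) : 0 < e -> within p p e.
Proof. by move=> e0; exists 0 => //; exact: joined_nil. Qed.

Lemma within_sym p q (e : R) : within p q e -> within q p e.
Proof. by move=> [l pq le]; exists l => //; exact: joined_sym. Qed.

Lemma within_trans p q r (a b : R) : within p q a -> within q r b -> within p r (a + b).
Proof.
by move=> [l pq la] [l' qr lb]; exists (l + l'); [exact: joined_trans pq qr|exact: ltrD].
Qed.

Lemma within_le p q (a b : R) : a <= b -> within p q a -> within p q b.
Proof. by move=> ab [l pq la]; exists l => //; exact: lt_le_trans ab. Qed.

(** The property special to length spaces: in a general metric space a ball of radius [a + b] need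
    not be covered by the balls of radius [b] centred in the ball of radius [a]. The Hopf-Rinow
    argument rests on it. *)
Lemma within_split p q (a b : R) : 0 < a -> 0 < b -> within p q (a + b) ->
  exists z, within p z a /\ within z q b.
Proof.
move=> + + [l pq]; elim: pq a b => {q l} [|q r l l' pq IH qr] a b a0 b0 lab.
  by exists p; split; exact: within_refl.
have l'0 := segment_ge0 qr.
have [la|al] := ltP l a.
  have [|||z [l1 [l2 [pz zr l1a l2b]]]] := segment_split qr (a := a - l) (b := b); try lra.
  exists z; split; last by exists l2 => //; exact: joined_segment.
  by exists (l + l1); [exact: joined_cons pz|lra].
have [|||z [pz zq]] := IH a (b - l'); try lra.
exists z; split => //; have [l1 zl1 l1b] := zq.
by exists (l1 + l'); [exact: joined_cons qr|lra].
Qed.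

Lemma derive_along c gamma f t : atlas c -> derivable gamma t 1 -> ccod c (gamma t) ->
  MC1 f (cinv c (gamma t)) ->
  is_derive t 1 (fun s => f (cinv c (gamma s)))
    (\sum_i derive1 gamma t 0 i * pder i (f \o cinv c) (gamma t)).
Proof.
move=> ac dg cgt f1.
have df : differentiable (f \o cinv c) (gamma t).
  by have := C1_diff (f1 c ac (cinv_dom cgt)); rewrite cinvK.
have dg' : differentiable gamma t by exact/derivable1_diffP.
have dc : differentiable ((f \o cinv c) \o gamma) t by exact: differentiable_comp.
split; first exact/derivable1_diffP.
rewrite -derive_pder// -[LHS]/('D_1 ((f \o cinv c) \o gamma) t) deriveE// diff_comp//=.
by rewrite deriveE// derive1E deriveE.
Qed.

Lemma derive_along_le c gamma f t C : atlas c -> ccod c (gamma t) ->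
  MC1 f (cinv c (gamma t)) -> 0 <= C -> gdot f f (cinv c (gamma t)) <= C ^+ 2 ->
  \sum_i derive1 gamma t 0 i * pder i (f \o cinv c) (gamma t) <= C * speed c gamma t.
Proof.
move=> ac cgt f1 C0; rewrite (gdotE ac (cinv_dom cgt) f1 f1) cinvK// => fC.
have pG : posdef (metric c (gamma t)) by move=> v; exact: metric_posdef.
have := posdef_cauchy_schwarz (derive1 gamma t) (dchart c f (gamma t)) pG (Defs.metric_sym ac cgt).
set b := (_ *m _) 0 0; set q := (_ *m _ *m _) 0 0 => H.
have -> : \sum_i derive1 gamma t 0 i * pder i (f \o cinv c) (gamma t) = b.
  by rewrite /b mxE; apply: eq_bigr => i _; rewrite !mxE.
have q0 : 0 <= q.
  rewrite /q; have [->|v0] := eqVneq (derive1 gamma t) 0; last exact/ltW/pG.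
  by rewrite !mul0mx mxE.
have bq : b ^+ 2 <= (C * speed c gamma t) ^+ 2.
  rewrite exprMn /speed sqr_sqrtr// mulrC; apply: le_trans H _.
  by rewrite ler_wpM2l.
rewrite (le_trans (ler_norm _))//.
rewrite -(@ler_pXn2r _ 2) ?nnegrE// ?real_normK ?num_real//.
by rewrite mulr_ge0// sqrtr_ge0.
Qed.

(* A function with bounded gradient is Lipschitz for the distance: this is how
   the distance is bounded below, without tracking where curves exit charts. *)
Lemma segment_lipschitz f C p q l : (forall q, MC1 f q) -> 0 <= C ->
  (forall q, gdot f f q <= C ^+ 2) -> segment p q l -> f q - f p <= C * l.
Proof.
move=> f1 C0 fC [c [gamma [ac [dg cdg] gc [<- <-] ->]]].
pose df t := \sum_i derive1 gamma t 0 i * pder i (f \o cinv c) (gamma t).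
have cdf t : 0 <= t <= 1 -> {for t, continuous df}.
  move=> t01; apply: continuous_sumf => i; apply: continuousM.
    by apply: (@continuous_comp _ _ _ (derive1 gamma) (fun v : 'rV[R]_n => v 0 i)); [exact: cdg|exact: coord_continuous].
  apply: (@continuous_comp _ _ _ gamma (pder i (f \o cinv c))).
    by apply: differentiable_continuous; exact/derivable1_diffP.
  have [_] := f1 _ c ac (cinv_dom (gc t t01)); rewrite cinvK; last exact: gc.
  by apply.
have ddf (t : R) : 0 <= t <= 1 -> is_derive t 1 (fun s => f (cinv c (gamma s))) (df t).
  by move=> t01; apply: derive_along => //; exact: gc.
rewrite -(Rintegral_derive01 ddf cdf).
have cs t : 0 <= t <= 1 -> {for t, continuous (speed c gamma)}.
  by move=> t01; apply: speed_continuous => //; exact: gc.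
have intS := integrable01 cs.
rewrite -RintegralZl//; apply: le_Rintegral => //.
- exact: integrable01.
- apply: integrable01 => t t01; apply: cvgM; [exact: cvg_cst|exact: cs].
- move=> t; rewrite /= in_itv/= => t01; apply: derive_along_le => //; exact: gc.
Qed.

Lemma within_lipschitz f C p q e : (forall q, MC1 f q) -> 0 <= C ->
  (forall q, gdot f f q <= C ^+ 2) -> within p q e -> f p - C * e <= f q.
Proof.
move=> f1 C0 fC /within_sym[l pq le].
suff H : f p - f q <= C * l by have : C * l <= C * e by [rewrite ler_wpM2l// ltW]; lra.
elim: pq {le} => {p l} [|r p l l' _ IH rp]; first by rewrite subrr mulr0.
by have := segment_lipschitz f1 C0 fC rp; rewrite mulrDr; lra.
Qed.

(** A bump [psi] at [p] is Lipschitz with some constant [C]. Where [psi > psi p / 2], moving by less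
    than [psi p / (2 C)] keeps [psi] positive, hence stays in its support. So small balls for the
    distance are small for the topology. *)
Lemma locally_relatively_compact p U : open U -> U p ->
  exists V K (e : R), [/\ open V, V p, 0 < e, compact K /\ K `<=` U &
    forall x y, V x -> within x y e -> K y].
Proof.
move=> oU Up; have [c [K [psi [KU [ac cK Kc psi1 [psi0 psip psiK]]]]]] := exists_bump oU Up.
have [C0 C00 psiC] := gdot_bounded cK psi1 psiK.
pose C := Num.sqrt C0; have Cgt0 : 0 < C by rewrite sqrtr_gt0.
have psiC2 q : gdot psi psi q <= C ^+ 2 by rewrite sqr_sqrtr// ltW.
exists (psi @^-1` [set s | psi p / 2 < s]), K, (psi p / (2 * C)); split => //.
- by apply: open_comp => [q _|]; [exact: MC1_continuous|exact: open_gt].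
- by rewrite /= ltr_pdivrMr// ltr_pMr// ltr1n.
- by rewrite divr_gt0// mulr_gt0.
move=> x y /= Vx xy; have := within_lipschitz psi1 (ltW Cgt0) psiC2 xy.
have -> : C * (psi p / (2 * C)) = psi p / 2 by field; rewrite gt_eqF.
by move=> H; apply: contrapT => /psiK; lra.
Qed.

Lemma quadratic_form_le (v : 'rV[R]_n) (G : 'M[R]_n) (B : R) : 0 <= B ->
  (forall i j, `|G i j| <= B) ->
  (v *m G *m v^T) 0 0 <= (`|v| ^+ 2) * (n%:R ^+ 2 * B).
Proof.
move=> B0 GB; rewrite quadratic_formE.
have -> : `|v| ^+ 2 * (n%:R ^+ 2 * B) = \sum_(j < n) (\sum_(i < n) `|v| * B) * `|v|.
  have sc (a : R) : \sum_(i < n) a = n%:R * a by rewrite sumr_const card_ord mulr_natl.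
  by rewrite !sc; set N := n%:R; set V := `|v|; ring.
apply: ler_sum => j _; rewrite mulr_suml [leRHS]mulr_suml; apply: ler_sum => i _.
rewrite (le_trans (ler_norm _))// !normrM ler_pM// ?mulr_ge0// ?norm_coord_le//.
by rewrite ler_pM// norm_coord_le.
Qed.

Lemma is_derive_affine_line (V : normedModType R) (a v : V) (t : R) :
  is_derive t 1 (fun s : R => a + s *: v) v.
Proof.
have E : \forall h \near 0^', h^-1 *: (((fun s : R => a + s *: v) \o shift t) (h *: 1) - (a + t *: v)) = v.
  near=> h; rewrite /= [h%:A]mulr1 opprD addrACA subrr add0r -scalerBl addrK scalerA mulVf ?scale1r//.
  by near: h; exact: nbhs_dnbhs_neq.
by split; [exact: (is_cvg_near_cst v)|exact: lim_near_cst].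
Unshelve. all: by end_near. Qed.

(** The converse comparison of distance and topology: on a closed coordinate ball the metric
    coefficients are bounded, so straight coordinate segments are short. *)
Lemma locally_within p (e : R) : 0 < e ->
  exists U, [/\ open U, U p & forall x y, U x -> U y -> within x y e].
Proof.
move=> e0; have [c ac cp] := atlas_cover p; set x0 := cmap c p.
have /nbhs_ballP[r /= r0 rP] := open_nbhs_nbhs (conj (@open_ccod _ _ _ c) (cmap_cod cp)).
rewrite -/x0 in rP.
pose K := [set x : 'rV[R]_n | `|x - x0| <= r / 2].
have Kc : K `<=` ccod c.
  by move=> x /= xr; apply: rP; rewrite -ball_normE /= distrC (le_lt_trans xr)//; lra.
have [B [B0 GB]] : exists B, 0 <= B /\ forall x i j, K x -> `|metric c x i j| <= B.
  have bnd i j : exists B, 0 <= B /\ forall x, K x -> `|metric c x i j| <= B.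
    have cm : {within K, continuous (fun x => metric c x i j)}.
      by apply: continuous_in_subspaceT => x; rewrite inE => /Kc; exact: metric_continuous.
    have := continuous_compact cm (@compact_norm_ball _ _ x0 (r / 2)).
    move=> /compact_bounded [B [_ BP]]; exists (`|B| + 1); split; first by rewrite addr_ge0.
    move=> x Kx; apply: (BP (`|B| + 1)); last by exists x.
    by rewrite (le_lt_trans (ler_norm _))// ltrDl.
  have [Bf BfP] := choice (fun ij : 'I_n * 'I_n => bnd ij.1 ij.2).
  exists (\sum_ij Bf ij); split; first by apply: sumr_ge0 => ij _; apply BfP.
  move=> x i j Kx; rewrite (bigD1 (i, j))//=; have [_ /(_ x Kx) /= H] := BfP (i, j).
  by rewrite (le_trans H)// lerDl; apply: sumr_ge0 => kl _; apply BfP.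
pose D := Num.sqrt (n%:R ^+ 2 * B); have D0 : 0 <= D by exact: sqrtr_ge0.
(* Coordinates of two points of the ball differ by at most [2 s], so the speed is at most [2 s D].
   The [+ 1] keeps the quotient meaningful when [D = 0]. *)
pose s := Num.min (r / 2) (e / (2 * D + 1) / 2).
have D1 : 0 < 2 * D + 1 by rewrite ltr_wpDl// mulr_ge0.
have s0 : 0 < s by rewrite lt_min !divr_gt0.
have sr : s <= r / 2 by rewrite /s ge_min lexx.
have sD : (s *+ 2) * D < e.
  have : s <= e / (2 * D + 1) / 2 by rewrite /s ge_min lexx orbT.
  rewrite ler_pdivlMr// ler_pdivlMr// => H.
  have sD0 : 0 <= s * D by rewrite mulr_ge0// ltW.
  by rewrite mulr2n; nra.
exists (cdom c `&` cmap c @^-1` ball x0 s); split.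
- by apply: open_setI_preimage; [exact: open_cdom|exact: cmap_continuous|exact: ball_open].
- by split => //; exact: ballxx.
move=> x y [cx]; rewrite /preimage /= -ball_normE /= => xs [cy] /= ys.
pose gamma t := cmap c x + t *: (cmap c y - cmap c x).
have dgamma (t : R) : is_derive t 1 gamma (cmap c y - cmap c x).
  exact: is_derive_affine_line.
have gK t : 0 <= t <= 1 -> K (gamma t).
  move=> /andP[t0 t1]; rewrite /K /=.
  have -> : gamma t - x0 = (1 - t) *: (cmap c x - x0) + t *: (cmap c y - x0).
    by rewrite /gamma; apply/rowP => i; rewrite !mxE; ring.
  rewrite (le_trans (ler_normD _ _))// !normrZ !ger0_norm// ?subr_ge0//.
  have H1 : (1 - t) * `|cmap c x - x0| <= (1 - t) * s.
    by rewrite ler_wpM2l ?subr_ge0// distrC ltW.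
  have H2 : t * `|cmap c y - x0| <= t * s by rewrite ler_wpM2l// distrC ltW.
  by lra.
have dg1 : derive1 gamma = fun=> cmap c y - cmap c x.
  by apply/funext => t; rewrite derive1E; have [_ ->] := dgamma t.
have seg : segment x y (\int[lebesgue_measure]_(t in `[0, 1]) speed c gamma t).
  exists c, gamma; split; first exact: ac.
  - split; first by move=> t; have [] := dgamma t.
    by rewrite dg1; exact: cst_continuous.
  - by move=> t t01; apply: Kc; exact: gK.
  - by rewrite /gamma scale0r addr0 scale1r addrC subrK !cmapK.
  - by [].
exists (\int[lebesgue_measure]_(t in `[0, 1]) speed c gamma t); first exact: joined_segment.
apply: le_lt_trans sD.
have -> : (s *+ 2) * D = \int[lebesgue_measure]_(t in `[0, 1]) ((s *+ 2) * D).
  by rewrite Rintegral_cst//= lebesgue_measure_itv/= lte_fin ltr01 oppr0 adde0 mulr1.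
apply: le_Rintegral => //.
- apply: integrable01 => t t01; apply: speed_continuous => //.
  + by rewrite dg1; exact: cst_continuous.
  + by apply: Kc; exact: gK.
- by apply: integrable01 => t _; exact: cst_continuous.
move=> t; rewrite /= in_itv/= => t01.
rewrite /speed dg1 /D -(@ger0_norm _ (s *+ 2)) ?mulrn_wge0 ?(ltW s0)// -sqrtr_sqr -sqrtrM ?sqr_ge0//.
rewrite ler_sqrt; last by rewrite mulr_ge0 ?sqr_ge0// mulr_ge0// exprn_ge0.
apply: le_trans (quadratic_form_le _ B0 (fun i j => GB _ i j (gK t t01))) _.
rewrite ler_wpM2r ?mulr_ge0 ?exprn_ge0//.
rewrite ler_pXn2r ?nnegrE ?mulrn_wge0 ?(ltW s0)//.
have -> : cmap c y - cmap c x = (x0 - cmap c x) - (x0 - cmap c y) by rewrite opprB [RHS]addrC subrKA.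
by rewrite (le_trans (ler_normB _ _))// mulr2n lerD// ltW.
Qed.

Definition relatively_compact_ball x (r : R) :=
  exists2 K, compact K & forall y, within x y r -> K y.

(* Thicken: cover the compact set by small open sets, and replace the centre of
   the ball by nearby points. *)
Lemma relatively_compact_ball_grow x (r s : R) : 0 < s -> s < r ->
  (forall y, within x y r -> relatively_compact_ball y (r / 2)) ->
  relatively_compact_ball x s -> relatively_compact_ball x (s + r / 4).
Proof.
move=> s0 sr H [K cK Ks].
(* [eta <= r - s] keeps the new centres within [r] of [x], where [H] applies; [eta <= r / 8] keeps
   [eta + r / 4] below their radius [r / 2]. *)
pose eta := Num.min (r / 8) (r - s).
have eta0 : 0 < eta by rewrite lt_min; apply/andP; split; lra.
have etar : eta <= r / 8 by rewrite /eta ge_min lexx.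
have etas : eta <= r - s by rewrite /eta ge_min lexx orbT.
have /choice[V VP] := fun y => locally_within y eta0.
have L y : exists L, compact L /\ ((exists2 z, V y z & within x z s) ->
    forall q, within y q (r / 2) -> L q).
  have [[z Vz xz]|no] := pselect (exists2 z, V y z & within x z s); last first.
    by exists set0; split; [exact: compact0|move=> /no].
  have [_ Vy Vw] := VP y.
  have [|L cL LP] := H y; last by exists L.
  apply: (@within_le _ _ (s + eta)); first lra.
  by apply: within_trans xz _; exact: Vw.
have [L' L'P] := choice L.
have := cK; rewrite compact_cover => /(_ M K V) [].
- by move=> y _; have [] := VP y.
- by move=> y Ky; exists y => //; have [] := VP y.
move=> D DK KD; exists (\bigcup_(y in [set` D]) L' y).
  rewrite bigcup_fset; apply: bigsetU_compact => y _; exact: (L'P y).1.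
move=> q /(within_split s0) [|z [xz zq]]; first lra.
have [y Dy Vyz] := KD z (Ks z xz).
exists y => //; apply: (L'P y).2; first by exists z.
apply: (@within_le _ _ (eta + r / 4)); first lra.
apply: within_trans zq; have [_ Vy Vw] := VP y; exact: Vw.
Qed.

(** If all the half-radius balls were relatively compact, two growth steps of [r / 4] would lead
    from [r / 2] to [r]. *)
Lemma not_relatively_compact_halve x (r : R) : 0 < r -> ~ relatively_compact_ball x r ->
  exists y, within x y r /\ ~ relatively_compact_ball y (r / 2).
Proof.
move=> r0 Nx; apply: contrapT => /forallNP H.
have H' y : within x y r -> relatively_compact_ball y (r / 2).
  by move=> xy; apply: contrapT => Ny; apply: (H y).
apply: Nx; have R1 : relatively_compact_ball x (r / 2) by apply: H'; exact: within_refl.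
have -> : r = (r / 2 + r / 4) + r / 4 by field.
apply: (@relatively_compact_ball_grow _ r) => //; try lra.
by apply: relatively_compact_ball_grow => //; lra.
Qed.

(** Halving repeatedly a ball that is not relatively compact gives centres [u k] with bad balls of
    radius [r0 / 2^k]. The centres form a Cauchy sequence, and near its limit all small balls are
    relatively compact. *)
Lemma hopf_rinow : complete_manifold M -> forall x (r : R), 0 < r -> relatively_compact_ball x r.
Proof.
move=> Mc x0 r0 r0gt0; apply: contrapT => Nx0.
have /choice[f fP] : forall xr : M * R, exists y, 0 < xr.2 -> ~ relatively_compact_ball xr.1 xr.2 ->
    within xr.1 y xr.2 /\ ~ relatively_compact_ball y (xr.2 / 2).
  move=> [x r] /=; have [r0'|r0'] := ltP 0 r; last by exists x.
  have [Nx|] := pselect (~ relatively_compact_ball x r); last by exists x.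
  by have [y yP] := not_relatively_compact_halve r0' Nx; exists y.
pose rad k := r0 / 2 ^+ k.
have rad0 k : 0 < rad k by rewrite divr_gt0// exprn_gt0.
have radS k : rad k.+1 = rad k / 2 by rewrite /rad exprSr invfM mulrA.
pose u := fix u k := match k with 0 => x0 | k'.+1 => f (u k', rad k') end.
have Nu k : ~ relatively_compact_ball (u k) (rad k).
  elim: k => [|k IH]; first by rewrite /rad expr0 divr1.
  by rewrite radS; exact: (fP (u k, rad k) (rad0 k) IH).2.
have uS k : within (u k) (u k.+1) (rad k) by exact: (fP (u k, rad k) (rad0 k) (Nu k)).1.
have ud d k : within (u k) (u (k + d)%N) (rad k *+ 2).
  elim: d k => [|d IH] k; first by rewrite addn0; apply: within_refl; rewrite mulrn_wgt0.
  rewrite addnS -addSn mulr2n; apply: within_trans (uS k) _.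
  have -> : rad k = rad k.+1 *+ 2 by rewrite radS -mulr_natr divfK.
  exact: IH.
have rad_small (e : R) : 0 < e -> exists N, forall k, (N <= k)%N -> rad k *+ 2 < e.
  move=> e0; have [N _ NP] : \forall k \near \oo, 2 ^- k < e / (r0 *+ 2).
    have := @cvg_expr R 2^-1; rewrite gtr0_norm ?invr_gt0// invf_lt1 ?ltr1n// => /(_ isT).
    move=> /cvgrPdist_lt /(_ (e / (r0 *+ 2))); rewrite divr_gt0 ?mulrn_wgt0// => /(_ isT).
    by apply: filterS => k; rewrite sub0r normrN ger0_norm ?exprn_ge0 ?invr_ge0// exprVn.
  exists N => k /NP /=; rewrite ltr_pdivlMr ?mulrn_wgt0//.
  by rewrite /rad mulrnAr mulrC.
have [|p pP] := Mc u.
  move=> e /rad_small[N NP]; exists N => i j Ni Nj; apply/rdist_within.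
  have [ij|/ltnW ji] := leqP i j.
    by apply: (within_le (ltW (NP i Ni))); rewrite -(subnKC ij); exact: ud.
  by apply: within_sym; apply: (within_le (ltW (NP j Nj))); rewrite -(subnKC ji); exact: ud.
(* Convergence to [p] is known for the distance only. The second use of local compactness, inside
   [V], turns it into membership in [V], where balls of radius [e] lie in [K]. *)
have [V [K [e [oV Vp e0 [cK _] KP]]]] := @locally_relatively_compact p setT openT I.
have [V' [K' [e' [oV' Vp' e'0 [_ K'V] K'P]]]] := locally_relatively_compact oV Vp.
have [N1 N1P] := pP e' e'0; have [N2 N2P] := rad_small e e0.
pose N := maxn N1 N2; apply: (Nu N); exists K => // y uy; apply: (KP (u N)).
  apply: K'V; apply: (K'P p) => //; apply: within_sym; apply/rdist_within.
  by apply: N1P; exact: leq_maxl.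
apply: (within_le _ uy); apply: ltW; apply: le_lt_trans (N2P N (leq_maxr _ _)).
by rewrite mulr2n lerDl ltW.
Qed.

Lemma bounded_domain_compact U : complete_manifold M -> bounded_domain U -> compact (closure U).
Proof.
move=> Mc [p [r pr]].
have [|K cK KP] := @hopf_rinow Mc p (`|r| + 1); first by rewrite ltr_wpDl.
apply: (@subclosed_compact _ _ K) => //; first exact: closed_closure.
rewrite [K](closure_id _).1; last exact: compact_closed_manifold.
apply: closureS.
move=> q /pr pq; apply: KP; apply/rdist_within; apply: le_lt_trans pq _.
by rewrite lte_fin (le_lt_trans (ler_norm _))// ltrDl.
Qed.

End riemannian_distance.

(** * Change of variables with a density *)

Section density.
Local Open Scope ereal_scope.
Context {R : realType} d1 d2 (T1 : measurableType d1) (T2 : measurableType d2).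
Variables (mu : {measure set T1 -> \bar R}) (nu : {measure set T2 -> \bar R}).
Variables (D1 : set T1) (D2 : set T2) (phi : T1 -> T2) (w : T1 -> R).
Hypotheses (mD1 : measurable D1) (mD2 : measurable D2).
Hypotheses (mphi : measurable_fun D1 phi) (mw : measurable_fun D1 w).
Hypothesis w0 : forall x, D1 x -> (0 <= w x)%R.
Hypothesis phiD : forall x, D1 x -> D2 (phi x).
Hypothesis nuE : forall A, measurable A -> A `<=` D2 ->
  nu A = \int[mu]_(x in D1) (w x * \1_A (phi x))%:E.

Import HBNNSimple.

Lemma measurable_density (f : T2 -> \bar R) : measurable_fun D2 f ->
  measurable_fun D1 (fun x => (w x)%:E * f (phi x)).
Proof.
move=> mf; apply: emeasurable_funM; first exact/measurable_EFinP.
by apply: (measurable_comp mD2) => // _ [x Dx <-]; exact: phiD.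
Qed.

(** [nuE] is the case of indicators; linearity gives simple functions, and monotone convergence
    along their approximations gives [f]. *)
Lemma ge0_integral_density (f : T2 -> \bar R) : measurable_fun D2 f ->
  (forall y, D2 y -> 0 <= f y) ->
  \int[nu]_(y in D2) f y = \int[mu]_(x in D1) ((w x)%:E * f (phi x)).
Proof.
move=> mf f0; pose h := nnsfun_approx mD2 mf.
have mh n : measurable_fun D2 (EFin \o h n).
  by apply/measurable_EFinP; apply: measurable_funTS; exact/measurable_funP.
have -> : \int[nu]_(y in D2) f y = lim (\int[nu]_(y in D2) (EFin \o h n) y @[n --> \oo]).
  have fE y : D2 y -> f y = lim ((EFin \o h n) y @[n --> \oo]).
    by move=> Dy; apply/esym/cvg_lim => //; exact: cvg_nnsfun_approx.
  under eq_integral => y /[!inE] /fE -> //.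
  apply: monotone_convergence => //.
  - by move=> n y _ /=; rewrite lee_fin.
  - by move=> y _ a b ab; rewrite lee_fin; exact/lefP/nd_nnsfun_approx.
have -> : \int[mu]_(x in D1) ((w x)%:E * f (phi x)) =
    lim (\int[mu]_(x in D1) ((w x)%:E * (h n (phi x))%:E) @[n --> \oo]).
  have fE x : D1 x -> (w x)%:E * f (phi x) = lim ((w x)%:E * (h n (phi x))%:E @[n --> \oo]).
    move=> Dx; apply/esym/cvg_lim => //; apply: cvgeZl => //.
    by apply: cvg_nnsfun_approx => //; exact: phiD.
  under eq_integral => x /[!inE] /fE -> //.
  apply: monotone_convergence => //.
  - by move=> n; exact: (measurable_density (mh n)).
  - by move=> n x Dx /=; rewrite -EFinM lee_fin mulr_ge0// w0.
  - move=> x Dx a b ab; rewrite -!EFinM lee_fin ler_wpM2l ?w0//.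
    exact/lefP/nd_nnsfun_approx.
suff suf n : \int[nu]_(y in D2) (EFin \o h n) y = \int[mu]_(x in D1) ((w x)%:E * (h n (phi x))%:E).
  by under eq_fun do rewrite suf.
have mind y : measurable_fun D2 (fun x => (y * \1_(h n @^-1` [set y]) x)%:E).
  by apply/measurable_EFinP/measurable_funM => //; exact: measurable_cst.
transitivity (\int[nu]_(x in D2)
   (\sum_(y \in range (h n)) (y * \1_(h n @^-1` [set y]) x)%:E)).
  by apply: eq_integral => t tE; rewrite /= fimfunE -fsumEFin.
rewrite ge0_integral_fsum//; last by move=> y x Dx; exact: nnfun_muleindic_ge0.
transitivity (\int[mu]_(x in D1) (\sum_(y \in range (h n))
    ((w x)%:E * (y * \1_(h n @^-1` [set y]) (phi x))%:E))); last first.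
  apply: eq_integral => x xE.
  rewrite -ge0_mule_fsumr => [|y]; last exact: nnfun_muleindic_ge0.
  by rewrite fsumEFin // -(fimfunE _ (phi x)).
rewrite ge0_integral_fsum//; last 2 first.
  - by move=> y; exact: (measurable_density (mind y)).
  - by move=> y x Dx; apply: mule_ge0; [rewrite lee_fin w0|exact: nnfun_muleindic_ge0].
apply: eq_fsbigr => r rhn.
have r0 : (0 <= r)%R by move: rhn; rewrite inE => -[t _ <-].
under eq_integral do rewrite EFinM.
rewrite integralZl_indic_nnsfun//.
have mhr : measurable (h n @^-1` [set r]) by [].
rewrite integral_indic// (nuE (measurableI _ _ mhr mD2)); last by move=> y [].
under [RHS]eq_integral do rewrite -EFinM mulrCA EFinM.
rewrite ge0_integralZl_EFin//.
- congr (_ * _); apply: eq_integral => x /[!inE] Dx.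
  by rewrite indicI /= (_ : \1_D2 (phi x) = 1%R) ?mulr1// indicE mem_set//; exact: phiD.
- by move=> x Dx; rewrite lee_fin mulr_ge0// w0.
- apply/measurable_EFinP; apply: measurable_funM => //.
  by apply: (measurable_comp mD2) => // _ [x Dx <-]; exact: phiD.
Qed.

Lemma integral_density (f : T2 -> R) : measurable_fun D2 f ->
  \int[nu]_(y in D2) (f y)%:E = \int[mu]_(x in D1) (w x * f (phi x))%:E.
Proof.
move=> mf; have mEf : measurable_fun D2 (EFin \o f) by exact/measurable_EFinP.
rewrite integralE [RHS]integralE; congr (_ - _).
  rewrite ge0_integral_density//; last exact: measurable_funepos.
  apply: eq_integral => x /[!inE] Dx; rewrite !funeposE /= -!EFin_max -EFinM.
  by rewrite maxr_pMr ?w0// mulr0.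
rewrite ge0_integral_density//; last exact: measurable_funeneg.
apply: eq_integral => x /[!inE] Dx; rewrite !funenegE /= -!EFin_max -EFinM.
by rewrite maxr_pMr ?w0// mulr0 mulrN.
Qed.

End density.

(** Integrability is carried along with the null integral because additivity asks for it at each
    step of the induction. *)
Lemma integral_sum0 {R : realType} d (T : measurableType d) (mu : {measure set T -> \bar R})
    (I : eqType) (r : seq I) (F : I -> T -> R) :
  (forall i, i \in r -> mu.-integrable setT (EFin \o F i) /\ (\int[mu]_x (F i x)%:E = 0)%E) ->
  mu.-integrable setT (EFin \o (fun x => \sum_(i <- r) F i x)) /\
  (\int[mu]_x (\sum_(i <- r) F i x)%:E = 0)%E.
Proof.
elim: r => [|i r IH] FP.
  rewrite (_ : (fun _ => _) = cst 0); last by apply/funext => x; rewrite big_nil.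
  split; first exact: integrable0.
  by rewrite integral0_eq// => x _; rewrite big_nil.
have [iF F0] := FP i (mem_head _ _).
have [|iS S0] := IH; first by move=> j jr; apply: FP; rewrite inE jr orbT.
have E : EFin \o (fun x => \sum_(j <- i :: r) F j x) =
   (EFin \o F i) \+ (EFin \o (fun x => \sum_(j <- r) F j x)).
  by apply/funext => x /=; rewrite big_cons EFinD.
split; first by rewrite E; exact: integrableD.
under eq_integral do rewrite big_cons EFinD.
by rewrite integralD// [X in (X + _)%E]F0 [X in (_ + X)%E]S0 adde0.
Qed.

(** * The Riemannian volume and Green's formula for compactly supported functions *)

Section riemannian_volume.
Context {R : realType} {n : nat} (M : riemannian_manifold R n).
Variable vol : {measure set (borel_manifold M) -> \bar R}.
Hypothesis volM : riemannian_measure vol.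
(** Stands for the measure given by [rV_measure], known only through the three properties that
    follow. *)
Variable m : {measure set (borel 'rV[R]_n) -> \bar R}.
Hypothesis m_integral : forall f : 'rV[R]_n -> \bar R,
  measurable_fun (setT : set (borel 'rV[R]_n)) f ->
  (forall x, 0 <= f x)%E -> integral_rV f = (\int[m]_x f x)%E.
Hypothesis m_ball : forall c r, 0 < r -> m (ball c r) = ((r *+ 2) ^+ n)%:E.
Hypothesis m_pder : forall (f : 'rV[R]_n -> R) (A : R), 0 < A -> (forall x, C1 f x) ->
  (forall x, A <= `|x| -> f x = 0) -> forall i, (\int[m]_x (pder i f x)%:E = 0)%E.
Implicit Types (c : chart R n M) (f g h : M -> R) (p q : M) (U K : set M).

Definition sqrt_det c (x : 'rV[R]_n) : R := Num.sqrt (\det (metric c x)).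

Lemma det_metric_gt0 c x : atlas c -> ccod c x -> 0 < \det (metric c x).
Proof. by move=> ac cx; apply: posdef_det_gt0 => v; exact: metric_posdef. Qed.

Lemma sqrt_det_gt0 c x : atlas c -> ccod c x -> 0 < sqrt_det c x.
Proof. by move=> ac cx; rewrite sqrtr_gt0 det_metric_gt0. Qed.

Lemma sqrt_det_C1 c x : atlas c -> ccod c x -> C1 (sqrt_det c) x.
Proof.
move=> ac cx; apply: C1_sqrt; last exact: det_metric_gt0.
by apply: C1_det => i j; exact: metric_C1.
Qed.

Lemma measurable_ccod c : measurable (ccod c : set (borel 'rV[R]_n)).
Proof. by apply: borel_open; exact: open_ccod. Qed.

Lemma measurable_cdom c : measurable (cdom c : set (borel_manifold M)).
Proof. by apply: borel_open; exact: open_cdom. Qed.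

Lemma measurable_cinv c : measurable_fun (ccod c : set (borel 'rV[R]_n)) (cinv c : _ -> borel_manifold M).
Proof.
apply: (@measurability _ _ _ (borel M) _ _ (@open M)) => // _ [U oU <-].
by apply: borel_open; exact: open_chart_codom.
Qed.

Lemma measurable_indic_cinv c (A : set (borel_manifold M)) : measurable A ->
  measurable_fun (ccod c : set (borel 'rV[R]_n)) (fun x => \1_A (cinv c x) : R).
Proof.
move=> mA; have mI : measurable_fun setT (\1_A : borel_manifold M -> R) by [].
move=> mD Y mY; apply: (measurable_cinv mD (Y := \1_A @^-1` Y)).
by rewrite -[X in measurable X]setTI; exact: mI.
Qed.

Lemma measurable_sqrt_det c : atlas c -> measurable_fun (ccod c : set (borel 'rV[R]_n)) (sqrt_det c).
Proof.
move=> ac; apply: continuous_borel; first exact: open_ccod.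
by move=> x cx; exact/C1_continuous/sqrt_det_C1.
Qed.

(** Outside [ccod c] neither [metric c] nor [cinv c] is controlled. The indicator cuts the integrand
    to zero there, which makes it measurable on the whole space, as the passage from the iterated
    integral to [m] requires. *)
Lemma volE c (A : set (borel_manifold M)) : atlas c -> measurable A -> A `<=` cdom c ->
  vol A = (\int[m]_(x in ccod c) (sqrt_det c x * \1_A (cinv c x))%:E)%E.
Proof.
move=> ac mA Ac; rewrite (volM ac mA Ac).
pose g x := (sqrt_det c x * \1_A (cinv c x))%:E.
have E : (fun x => (sqrt_det c x * \1_(ccod c `&` cinv c @^-1` A) x)%:E) = g \_ (ccod c).
  apply/funext => x; rewrite patchE /g; case: ifPn; [rewrite inE|rewrite notin_setE] => cx.
    by rewrite indicI /= [\1_(ccod c) x]indicE mem_set// mul1r.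
  by rewrite indicE memNset ?mulr0// => -[].
have mg : measurable_fun (ccod c : set (borel 'rV[R]_n)) g.
  apply/measurable_EFinP; apply: measurable_funM; first exact: measurable_sqrt_det.
  exact: measurable_indic_cinv.
rewrite [RHS]integral_mkcond -[in LHS]/(sqrt_det c) E; apply: m_integral.
  by apply/(measurable_restrictT _ _).1 => //; exact: measurable_ccod.
by move=> x; rewrite patchE; case: ifP => // _; rewrite lee_fin mulr_ge0// sqrtr_ge0.
Qed.

Lemma integral_chart c (f : M -> R) : atlas c ->
  measurable_fun (cdom c : set (borel_manifold M)) f ->
  (\int[vol]_(q in (cdom c : set (borel_manifold M))) (f q)%:E =
   \int[m]_(x in ccod c) (sqrt_det c x * f (cinv c x))%:E)%E.
Proof.
move=> ac mf; apply: integral_density => //.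
- exact: measurable_ccod.
- exact: measurable_cdom.
- exact: measurable_cinv.
- exact: measurable_sqrt_det.
- by move=> x _; exact: sqrtr_ge0.
- by move=> x; exact: cinv_dom.
- by move=> A mA Ac; exact: volE.
Qed.

Lemma locally_finite_vol p : exists V, [/\ open V, V p & (vol V < +oo)%E].
Proof.
have [c ac cp] := atlas_cover p; set x0 := cmap c p.
have /nbhs_ballP[r /= r0 rP] := open_nbhs_nbhs (conj (@open_ccod _ _ _ c) (cmap_cod cp)).
rewrite -/x0 in rP.
pose K := [set x : 'rV[R]_n | `|x - x0| <= r / 2].
have Kc : K `<=` ccod c.
  by move=> x /= xr; apply: rP; rewrite -ball_normE /= distrC (le_lt_trans xr)//; lra.
have [B [B0 BP]] : exists B, 0 <= B /\ forall x, K x -> sqrt_det c x <= B.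
  have cm : {within K, continuous (sqrt_det c)}.
    by apply: continuous_in_subspaceT => x; rewrite inE => /Kc cx; exact/C1_continuous/sqrt_det_C1.
  have := continuous_compact cm (@compact_norm_ball _ _ x0 (r / 2)).
  move=> /compact_bounded [B [_ BP]]; exists (`|B| + 1); split; first by rewrite addr_ge0.
  move=> x Kx; rewrite (le_trans (ler_norm _))//; apply: (BP (`|B| + 1)); last by exists x.
  by rewrite (le_lt_trans (ler_norm _))// ltrDl.
pose b := ball x0 (r / 2).
have bK : b `<=` K by move=> x; rewrite /b -ball_normE /= distrC => /ltW.
have r20 : 0 < r / 2 by rewrite divr_gt0.
pose V := cdom c `&` cmap c @^-1` b.
have oV : open V.
  by apply: open_setI_preimage; [exact: open_cdom|exact: cmap_continuous|exact: ball_open].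
exists V; split => //; first by split => //; exact: ballxx.
have mV : measurable (V : set (borel_manifold M)) by exact: borel_open.
have mb : measurable (b : set (borel 'rV[R]_n)) by apply: borel_open; exact: ball_open.
rewrite (volE ac mV) => [|q []//].
apply: (@le_lt_trans _ _ (\int[m]_(x in ccod c) (B * \1_b x)%:E)%E).
  apply: ge0_le_integral => //.
  - exact: measurable_ccod.
  - by move=> x _; rewrite lee_fin mulr_ge0// sqrtr_ge0.
  - apply/measurable_EFinP; apply: measurable_funM; first exact: measurable_sqrt_det.
    exact: measurable_indic_cinv.
  - by apply/measurable_EFinP; apply: measurable_funM => //; exact: measurable_cst.
  move=> x cx; rewrite lee_fin; have [Vx|Vx] := pselect (V (cinv c x)); last first.
    by rewrite indicE memNset// mulr0 mulr_ge0.
  have bx : b x by case: Vx => _; rewrite /preimage /= cinvK.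
  by rewrite !indicE !mem_set// !mulr1; apply: BP; exact: bK.
under eq_integral do rewrite EFinM.
rewrite ge0_integralZl_EFin//; last 2 first.
  - exact: measurable_ccod.
  - by apply/measurable_EFinP.
rewrite integral_indic//; last exact: measurable_ccod.
apply: lte_mul_pinfty => //.
apply: (@le_lt_trans _ _ (m b)); last by rewrite m_ball// ltry.
by apply: le_measure; rewrite ?inE//; apply: measurableI => //; exact: measurable_ccod.
Qed.

Lemma compact_finite_vol K : compact K -> (vol K < +oo)%E.
Proof.
move=> cK; have /choice[V VP] := locally_finite_vol.
have mV y : measurable (V y : set (borel_manifold M)) by have [oV _ _] := VP y; exact: borel_open.
have := cK; rewrite compact_cover => /(_ M K V) [].
- by move=> y _; have [] := VP y.
- by move=> y Ky; exists y => //; have [] := VP y.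
move=> D DK KD.
have mK : measurable (K : set (borel_manifold M)).
  by apply: borel_closed; exact: compact_closed_manifold.
apply: (@le_lt_trans _ _ (vol (\big[setU/set0]_(y <- D) V y))).
  apply: le_measure; rewrite ?inE//; first exact: bigsetU_measurable.
  by rewrite -bigcup_fset.
have : forall r : seq M, (vol (\big[setU/set0]_(y <- r) V y) < +oo)%E.
  elim=> [|y r IH]; first by rewrite big_nil measure0.
  rewrite big_cons.
  have mr : measurable (\big[setU/set0]_(y <- r) V y : set (borel_manifold M)) by exact: bigsetU_measurable.
  apply: le_lt_trans (measureU2 _ _ _) _ => //.
  by rewrite lte_add_pinfty//; have [] := VP y.
exact.
Qed.

Lemma bounded_integrable (D : set (borel_manifold M)) f C : measurable D -> (vol D < +oo)%E ->
  measurable_fun D f -> (forall q, D q -> `|f q| <= C) -> vol.-integrable D (EFin \o f).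
Proof.
move=> mD vD mf fC; apply: (@le_integrable _ _ _ _ _ mD _ (cst C%:E)).
- exact/measurable_EFinP.
- by move=> q Dq /=; rewrite lee_fin (le_trans (fC q Dq))// ler_norm.
apply/integrableP; split; first exact: measurable_cst.
by rewrite integral_cst// lte_mul_pinfty.
Qed.

Lemma compact_support_integrable K f : compact K -> continuous f -> (forall q, ~ K q -> f q = 0) ->
  vol.-integrable setT (EFin \o f).
Proof.
move=> cK cf f0; have mK : measurable (K : set (borel_manifold M)).
  by apply: borel_closed; exact: compact_closed_manifold.
have mf : measurable_fun (setT : set (borel_manifold M)) f.
  by apply: (@continuous_borel _ M) => [|q _]; [exact: openT|exact: cf].
have E : (EFin \o f) \_ K = EFin \o f.
  by apply/funext => q; rewrite patchE; case: ifPn => //; rewrite notin_setE => Kq /=; rewrite f0.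
rewrite -E; apply/(integrable_mkcond _ mK).1.
have := continuous_compact (continuous_subspaceT cf) cK.
move=> /compact_bounded [C [_ CP]]; apply: (@bounded_integrable _ _ (`|C| + 1)) => //.
- exact: compact_finite_vol.
- exact: measurable_funTS.
move=> q Kq; apply: (CP (`|C| + 1)); last by exists q.
by rewrite (le_lt_trans (ler_norm _))// ltrDl.
Qed.

Lemma gradient_C1 c U g x i : atlas c -> open U -> Ck_on 2 U g -> chart_codom c U x ->
  C1 (fun y => gradient c g y 0 i) x.
Proof.
move=> ac oU gU Ux.
apply: (@C1_near _ _ (fun y => \sum_j pder j (g \o cinv c) y * invmx (metric c y) j i)).
  near=> y; rewrite /gradient [RHS]mxE; apply: eq_bigr => j _.
  by rewrite [X in _ = X * _]mxE.
apply: C1_sum => j _; apply: C1M; last by apply: invmetric_C1 => //; case: Ux.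
by apply: (@Ck2_pder _ _ (chart_codom c U)) => //; [exact: open_chart_codom|exact: gU].
Unshelve. all: by end_near. Qed.

Lemma gradient_dot c f g x : atlas c -> ccod c x ->
  \sum_i pder i (f \o cinv c) x * gradient c g x 0 i = gdot_chart c f g x.
Proof.
move=> ac cx; rewrite /gdot_chart.
set d := dchart c f x; set e := dchart c g x; set G := metric c x.
have -> : d *m invmx G *m e^T = d *m (e *m invmx G)^T.
  by rewrite trmx_mul trmx_inv (Defs.metric_sym ac cx) mulmxA.
by rewrite [RHS]mxE; apply: eq_bigr => i _; rewrite !mxE.
Qed.

(* The divergence theorem for the field [phi * grad g], which vanishes off [K]. *)
Lemma green_in_chart c K U phi g h : atlas c -> compact K -> K `<=` cdom c -> K `<=` U ->
  open U -> (forall q, MC1 phi q) -> (forall q, ~ K q -> phi q = 0) ->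
  Ck_on 2 U g -> laplacian_on U g h -> (forall q, U q -> {for q, continuous h}) ->
  vol.-integrable setT (EFin \o (fun q => phi q * h q + gdot phi g q)) /\
  (\int[vol]_q (phi q * h q + gdot phi g q)%:E = 0)%E.
Proof.
move=> ac cK Kc KU oU phi1 phi0 gU gh ch.
have g1 q : U q -> MC1 g q by move=> Uq; apply: (Ck_on_MC1 oU gU).
pose F q := phi q * h q + gdot phi g q.
have F0 q : ~ K q -> F q = 0.
  by move=> Kq; rewrite /F phi0// mul0r add0r; exact: (gdot_off_compact _ cK).
have cF q : {for q, continuous F}.
  have [Kq|Kq] := pselect (K q).
    rewrite /F; apply: continuousD; last by apply: (@gdot_continuous _ _ _ phi g U) => //; exact: KU.
    by apply: continuousM; [exact: MC1_continuous|exact/ch/KU].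
  have oK : open (~` K) by apply: closed_openC; exact: compact_closed_manifold.
  apply: (@near_continuous _ _ (cst 0)); last exact: cst_continuous.
  by have := open_nbhs_nbhs (conj oK Kq); apply: filterS => q' /F0.
have iF := compact_support_integrable cK cF F0; split; first exact: iF.
(* The Euclidean divergence of [G] is [sqrt_det c] times the integrand [F]. Extended by zero, [G] is
   C^1 with compact support in R^n, so [m_pder] applies to each component. *)
pose G i x := if `[< ccod c x >] then phi (cinv c x) * (sqrt_det c x * gradient c g x 0 i) else 0.
have cK' := compact_image_cmap cK Kc; set K' := cmap c @` K in cK'.
have clK' : closed K' by apply: compact_closed => //; exact: norm_hausdorff.
have G0 i x : ~ K' x -> G i x = 0.
  move=> K'x; rewrite /G; case: asboolP => // cx; rewrite phi0 ?mul0r// => Kx.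
  by apply: K'x; exists (cinv c x) => //; rewrite cinvK.
have off x : ~ chart_codom c U x -> ~ K' x.
  move=> + [q Kq qx]; apply; rewrite -qx; split; first exact/cmap_cod/Kc.
  by rewrite /preimage /= cmapK; [exact: KU|exact: Kc].
have near_cod x : chart_codom c U x -> \forall y \near x, chart_codom c U y.
  by move=> Ux; apply: open_nbhs_nbhs; split => //; exact: open_chart_codom.
have phiC1 x : ccod c x -> C1 (phi \o cinv c) x.
  by move=> cx; have := phi1 _ c ac (cinv_dom cx); rewrite cinvK.
have wgC1 i x : chart_codom c U x -> C1 (fun y => sqrt_det c y * gradient c g y 0 i) x.
  move=> Ux; apply: C1M; last exact: (gradient_C1 _ ac oU gU).
  by apply: sqrt_det_C1 => //; case: Ux.
have nearG i x : chart_codom c U x -> \forall y \near x,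
    (phi \o cinv c) y * (sqrt_det c y * gradient c g y 0 i) = G i y.
  by move=> /near_cod; apply: filterS => y [cy _]; rewrite /G; case: asboolP.
have G1 i x : C1 (G i) x.
  have [Ux|Ux] := pselect (chart_codom c U x).
    apply: C1_near (nearG i x Ux) _.
    by apply: C1M; [apply: phiC1; case: Ux|exact: wgC1].
  apply: (@C1_near _ _ (fun=> 0)); last exact: C1_cst.
  have := open_nbhs_nbhs (conj (closed_openC clK') (off x Ux)).
  by apply: filterS => y /G0 ->.
have [A A0 GA] : exists2 A, 0 < A & forall i x, A <= `|x| -> G i x = 0.
  have [A [_ AP]] := compact_bounded cK'.
  exists (`|A| + 2); first by rewrite ltr_wpDl.
  move=> i x Ax; apply: G0 => K'x; have := AP (`|A| + 1) _ x K'x.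
  by rewrite (le_lt_trans (ler_norm _)) ?ltrDl// => /(_ isT) /=; lra.
have divG x : \sum_i pder i (G i) x =
    if `[< ccod c x >] then sqrt_det c x * F (cinv c x) else 0.
  have [Ux|Ux] := pselect (chart_codom c U x); last first.
    have -> : (if `[< ccod c x >] then sqrt_det c x * F (cinv c x) else 0) = 0.
      case: asboolP => // cx; rewrite F0 ?mulr0// => /KU UX.
      by apply: Ux; split.
    apply: big1 => i _; rewrite /pder (@near_eq_derive _ _ _ _ (cst 0)) ?derive_cst//.
    have := open_nbhs_nbhs (conj (closed_openC clK') (off x Ux)).
    by apply: filterS => y /G0 ->.
  have cx : ccod c x by case: Ux.
  have UcX : U (cinv c x) by case: Ux.
  case: asboolP => // _.
  have w0 : sqrt_det c x != 0 by rewrite gt_eqF// sqrt_det_gt0.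
  rewrite /F (gdotE ac (cinv_dom cx))//; last exact: g1.
  rewrite cinvK// mulrDr -gradient_dot// (gh c ac x cx UcX) /divergence -/(sqrt_det c x).
  rewrite [phi _ * _]mulrCA mulVKf// !mulr_sumr -big_split/=; apply: eq_bigr => i _.
  rewrite /pder -(near_eq_derive _ (nearG i x Ux)) [LHS]deriveM; first last.
    by apply/diff_derivable/C1_diff/wgC1.
    by apply/diff_derivable/C1_diff/phiC1.
  rewrite /=; congr (_ + _).
  by rewrite -[LHS]/(_ * _) -mulrA; congr (_ * _); exact: mulrC.
have intG i : m.-integrable setT (EFin \o pder i (G i)).
  apply: (@continuous_bounded_integrable _ _ m _ (A + 1)) => //.
    by move=> x; have [_] := G1 i x; apply.
  by apply: pder_support; exact: GA.
have [_] := @integral_sum0 _ _ _ m _ (enum 'I_n) (fun i => pder i (G i))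
  (fun i _ => conj (intG i) (m_pder A0 (G1 i) (GA i) i)).
under eq_integral do rewrite big_enum /= divG.
move=> <-; rewrite (_ : (fun x => _) = (fun x => (sqrt_det c x * F (cinv c x))%:E) \_ (ccod c)); last first.
  by apply/funext => x; rewrite patchE; case: asboolP => cx; [rewrite mem_set|rewrite memNset].
rewrite -integral_mkcond -integral_chart//; last first.
  by apply: (@continuous_borel _ M); [exact: open_cdom|move=> q _; exact: cF].
rewrite [RHS]integral_mkcond; apply: eq_integral => q _.
rewrite patchE; case: ifPn => //; rewrite notin_setE => cq.
by rewrite -/(F q) F0// => /Kc.
Qed.

Lemma gdot_sum (I : Type) (r : seq I) (f : I -> M -> R) g p :
  (forall i, MC1 (f i) p) -> gdot (fun q => \sum_(i <- r) f i q) g p = \sum_(i <- r) gdot (f i) g p.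
Proof.
move=> f1; elim: r => [|i r IH].
  rewrite big_nil (_ : (fun q => _) = fun=> 0); last by apply/funext => q; rewrite big_nil.
  have := @gdot_comp _ _ _ (fun=> 0) (fun=> 0) 0 g p (@MC1_cst _ _ M 0 p).
  by rewrite mul0r; apply; exact: is_derive_cst.
rewrite big_cons (_ : (fun q => _) = fun q => f i q + \sum_(j <- r) f j q); last first.
  by apply/funext => q; rewrite big_cons.
by rewrite gdotD ?IH//; exact: MC1_sum.
Qed.

(* A partition of unity on the support of [phi], made of normalized bumps. *)
Lemma green_compact K U phi g h : compact K -> K `<=` U ->
  open U -> (forall q, MC1 phi q) -> (forall q, ~ K q -> phi q = 0) ->
  Ck_on 2 U g -> laplacian_on U g h -> (forall q, U q -> {for q, continuous h}) ->
  vol.-integrable setT (EFin \o (fun q => phi q * h q + gdot phi g q)) /\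
  (\int[vol]_q (phi q * h q + gdot phi g q)%:E = 0)%E.
Proof.
move=> cK KU oU phi1 phi0 gU gh ch.
have /choice[psi psiP] : forall p, exists psi : M -> R,
    [/\ exists c K', [/\ atlas c, compact K', K' `<=` cdom c, K' `<=` U & forall q, ~ K' q -> psi q = 0],
        forall q, MC1 psi q, forall q, 0 <= psi q & K p -> 0 < psi p].
  move=> p; have [Kp|Kp] := pselect (K p); last first.
    (* Points outside [K] receive the zero function with empty support, so that the choice is a
       total family. *)
    exists (fun=> 0); split => //; last by move=> q; exact: MC1_cst.
    by have [ac _] := chart_atP p; exists (chart_at p), set0; split => //; exact: compact0.
  have [c [K' [psi [K'U [ac cK' K'c psi1 [psi0 psip psiK']]]]]] := exists_bump oU (KU p Kp).
  by exists psi; split => //; exists c, K'.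
have := cK; rewrite compact_cover => /(_ M K (fun p => [set q | 0 < psi p q])) [].
- move=> p _; have [_ psi1 _ _] := psiP p.
  have -> : [set q | 0 < psi p q] = psi p @^-1` [set s | 0 < s] by [].
  by apply: open_comp => [q _|]; [exact: MC1_continuous|exact: open_gt].
- by move=> p Kp; exists p => //=; have [_ _ _] := psiP p; apply.
move=> D DK KD; pose S q := \sum_(p <- D) psi p q.
have S0 q : K q -> 0 < S q.
  move=> /KD[p /= Dp psipq]; rewrite /S (big_rem p)//= ltr_wpDr//.
  by apply: sumr_ge0 => p' _; have [_ _ ge0 _] := psiP p'; exact: ge0.
have S1 q : MC1 S q by apply: MC1_sum => p; have [_ psi1 _ _] := psiP p.
(* [S] may vanish, but only off [K], where [phi] and hence [phi'] are zero. *)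
pose phi' q := phi q * (S q)^-1.
have phi'1 q : MC1 phi' q.
  have [Kq|Kq] := pselect (K q); last first.
    by apply: (MC1_off_compact cK) => // q' Kq'; rewrite /phi' phi0// mul0r.
  by apply: MC1M => //; apply: MC1V => //; rewrite gt_eqF// S0.
have phiE q : phi q = \sum_(p <- D) psi p q * phi' q.
  rewrite -mulr_suml -/(S q) /phi'; have [Kq|Kq] := pselect (K q).
    by rewrite mulrCA mulfV ?mulr1// gt_eqF// S0.
  by rewrite phi0// mul0r mulr0.
have pp1 p q : MC1 (fun q => psi p q * phi' q) q.
  by apply: MC1M => //; have [_ psi1 _ _] := psiP p.
pose A q := phi q * h q + gdot phi g q.
have E : A = (fun q => \sum_(p <- D) ((psi p q * phi' q) * h q + gdot (fun q => psi p q * phi' q) g q)).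
  apply/funext => q; rewrite /A big_split /= -mulr_suml -phiE; congr (_ + _).
  by rewrite -gdot_sum//; congr (gdot _ g q); apply/funext => q'; rewrite phiE.
suff : vol.-integrable setT (EFin \o A) /\ (\int[vol]_q (A q)%:E = 0)%E by [].
rewrite E; apply: integral_sum0 => p Dp.
have [[c [K' [ac cK' K'c K'U psiK']]] psi1 _ _] := psiP p.
apply: (green_in_chart ac cK' K'c K'U oU) => // q K'q.
by rewrite psiK'// mul0r.
Qed.

End riemannian_volume.

(** * The cutoff near the boundary values, and pointwise estimates *)

Section rho.
Context {R : realType}.

(* The cutoff vanishes for [s <= d] and tends to [1] for [s > 0] as [d] tends
   to [0], while [s * drho d s] stays bounded and tends to [0]. *)
Definition rho (d s : R) : R := 1 - d ^+ 2 * (pos2 (s - d) + d ^+ 2)^-1.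
Definition drho (d s : R) : R :=
  d ^+ 2 * (2 * Num.max 0 (s - d)) * (pos2 (s - d) + d ^+ 2) ^- 2.

Lemma rho_denom_gt0 d s : 0 < d -> 0 < pos2 (s - d) + d ^+ 2 :> R.
Proof. by move=> d0; rewrite ltr_wpDl ?pos2_ge0// exprn_gt0. Qed.

Lemma is_derive_rho (d s : R) : 0 < d -> is_derive s 1 (rho d) (drho d s).
Proof.
move=> d0; have Q0 := rho_denom_gt0 s d0.
have dS : is_derive s 1 (fun s : R => s - d) 1.
  by apply: is_derive_eq; rewrite subr0.
have dP := @is_derive1_comp R pos2 (fun s => s - d) s _ _ (is_derive_pos2 (s - d)) dS.
have dQ : is_derive s 1 (fun s => pos2 (s - d) + d ^+ 2) (2 * Num.max 0 (s - d) * 1 + 0).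
  exact: (@is_deriveD _ _ _ (pos2 \o (fun s => s - d)) (cst (d ^+ 2)) s 1 _ _ dP (is_derive_cst _ _ _)).
have dV := @is_deriveV R _ s _ _ (lt0r_neq0 Q0) dQ.
have dZ := @is_deriveZ _ _ _ _ (d ^+ 2) s 1 _ dV.
have dB := is_deriveB (is_derive_cst (1 : R) s (1 : R)) dZ.
apply: (is_derive_eq dB).
rewrite addr0 mulr1 sub0r -[_ *: (_ *: _)]/(_ * (_ * _)) /drho; ring.
Qed.

Lemma drho_continuous (d : R) : 0 < d -> continuous (drho d).
Proof.
move=> d0 s.
have cm : {for s, continuous (fun s => Num.max 0 (s - d))}.
  apply: (@continuous_comp _ _ _ (fun s => s - d) (fun s : R => Num.max 0 s)).
    by apply: continuousB; [exact: cvg_id|exact: cst_continuous].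
  exact: max0_continuous.
have cP : {for s, continuous (fun s => pos2 (s - d) + d ^+ 2)}.
  apply: continuousD; last exact: cst_continuous.
  apply: (@continuous_comp _ _ _ (fun s => Num.max 0 (s - d)) (fun x : R => x ^+ 2)) => //.
  exact: exprn_continuous.
apply: (@continuousM _ _ (fun s => d ^+ 2 * (2 * Num.max 0 (s - d))) (fun s => (pos2 (s - d) + d ^+ 2) ^- 2)).
  apply: (@continuousM _ _ (cst (d ^+ 2))); first exact: cst_continuous.
  by apply: (@continuousM _ _ (cst 2)) => //; exact: cst_continuous.
apply: continuousV; first by rewrite expf_neq0// gt_eqF// rho_denom_gt0.
apply: (@continuous_comp _ _ _ (fun s => pos2 (s - d) + d ^+ 2) (fun x : R => x ^+ 2)) => //.
exact: exprn_continuous.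
Qed.

Lemma rho0 d s : 0 < d -> s <= d -> rho d s = 0.
Proof.
move=> d0 sd; rewrite /rho /pos2 max_l ?subr_le0// expr0n add0r mulfV ?subrr//.
by rewrite expf_neq0// gt_eqF.
Qed.

Lemma drho0 d s : s <= d -> drho d s = 0.
Proof. by move=> sd; rewrite /drho max_l ?subr_le0// !mulr0 mul0r. Qed.

Lemma drho_ge0 d s : 0 <= drho d s.
Proof.
rewrite /drho mulr_ge0 ?invr_ge0 ?exprn_even_ge0//.
by rewrite mulr_ge0 ?sqr_ge0// mulr_ge0// le_max lexx.
Qed.

Lemma rho01 d s : 0 < d -> 0 <= rho d s <= 1.
Proof.
move=> d0; have Q0 := rho_denom_gt0 s d0; rewrite /rho; apply/andP; split.
  by rewrite subr_ge0 ler_pdivrMr// mul1r lerDr pos2_ge0.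
by rewrite gerBl mulr_ge0 ?sqr_ge0// invr_ge0 ltW.
Qed.

(** Monotonicity in the parameter is what allows monotone convergence for the energy, before any
    integrable bound is available. *)
Lemma rho_le d d' s : 0 < d' -> d' <= d -> rho d s <= rho d' s.
Proof.
move=> d'0 d'd; have d0 : 0 < d by exact: lt_le_trans d'd.
rewrite /rho lerD2l lerN2 ler_pdivrMr ?rho_denom_gt0// mulrAC ler_pdivlMr ?rho_denom_gt0//.
have PP : pos2 (s - d) <= pos2 (s - d').
  have uu : Num.max 0 (s - d) <= Num.max 0 (s - d').
    by rewrite ge_max !le_max lexx /=; apply/orP; right; lra.
  by rewrite /pos2 ler_pXn2r ?nnegrE// le_max lexx.
have dd : d' ^+ 2 <= d ^+ 2 by rewrite ler_pXn2r// nnegrE ltW.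
have : d' ^+ 2 * pos2 (s - d) <= d ^+ 2 * pos2 (s - d') by rewrite ler_pM ?sqr_ge0 ?pos2_ge0.
by rewrite !mulrDr [d' ^+ 2 * d ^+ 2]mulrC lerD2r.
Qed.

(** With [u = s - d], the product is [2 u (u + d) d^2 / (u^2 + d^2)^2]. The constant comes from
    [2 u^2 + 2 u d <= 3 (u^2 + d^2)], and the bound is uniform in [d]. *)
Lemma mul_drho_le3 d s : 0 < d -> s * drho d s <= 3.
Proof.
move=> d0; have [sd|sd] := leP s d; first by rewrite drho0// mulr0.
have [u [u0 ->]] : exists u, 0 < u /\ s = u + d by exists (s - d); rewrite subrK subr_gt0.
rewrite /drho /pos2 addrK max_r ?(ltW u0)//.
have Q0 : 0 < u ^+ 2 + d ^+ 2 by rewrite ltr_wpDl ?sqr_ge0// exprn_gt0.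
rewrite mulrA ler_pdivrMr ?exprn_gt0//.
have H : (u + d) * (2 * u) <= 3 * (u ^+ 2 + d ^+ 2) by have := sqr_ge0 (u - d); rewrite !expr2; nra.
have H0 : 0 <= (u + d) * (2 * u) by rewrite mulr_ge0 ?addr_ge0 ?mulr_ge0 ?ltW.
have -> : (u + d) * (d ^+ 2 * (2 * u)) = (u + d) * (2 * u) * d ^+ 2 by ring.
have -> : 3 * (u ^+ 2 + d ^+ 2) ^+ 2 = 3 * (u ^+ 2 + d ^+ 2) * (u ^+ 2 + d ^+ 2) by ring.
apply: ler_pM => //; first exact: sqr_ge0.
by rewrite lerDr sqr_ge0.
Qed.

(** Here [s - d >= s / 2], so the denominator is at least [s^2 / 4]. *)
Lemma rho_close d s : 0 < d -> d <= s / 2 -> 1 - rho d s <= 4 * d ^+ 2 / s ^+ 2.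
Proof.
move=> d0 ds; have s0 : 0 < s by lra.
have u0 : 0 < s - d by lra.
rewrite /rho opprB addrC subrK /pos2 max_r ?(ltW u0)//.
rewrite ler_pdivrMr; last by rewrite ltr_wpDl ?sqr_ge0// exprn_gt0.
have H : s ^+ 2 <= 4 * ((s - d) ^+ 2 + d ^+ 2).
  have : (s / 2) ^+ 2 <= (s - d) ^+ 2 by rewrite ler_pXn2r ?nnegrE ?(ltW u0)//; lra.
  have := sqr_ge0 d; rewrite expr_div_n; lra.
rewrite mulrAC ler_pdivlMr ?exprn_gt0//.
have -> : 4 * d ^+ 2 * ((s - d) ^+ 2 + d ^+ 2) = d ^+ 2 * (4 * ((s - d) ^+ 2 + d ^+ 2)) by ring.
by rewrite ler_wpM2l// sqr_ge0.
Qed.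

(** With [u = s - d >= s / 2], the constant [16] is [2 * 2^3], from [s^3 <= (2 u)^3] and
    [(u^2 + d^2)^2 >= u^4]. *)
Lemma drho_close d s : 0 < d -> d <= s / 2 -> s * drho d s <= 16 * d ^+ 2 / s ^+ 2.
Proof.
move=> d0 ds; have s0 : 0 < s by lra.
have u0 : 0 < s - d by lra.
have us : s <= 2 * (s - d) by lra.
rewrite /drho /pos2 max_r ?(ltW u0)//; move: u0 us; move: (s - d) => u u0 us.
have Q0 : 0 < u ^+ 2 + d ^+ 2 by rewrite ltr_wpDl ?sqr_ge0// exprn_gt0.
rewrite mulrA ler_pdivrMr ?exprn_gt0// [leRHS]mulrAC ler_pdivlMr ?exprn_gt0//.
have Qu : u ^+ 2 <= u ^+ 2 + d ^+ 2 by rewrite lerDl sqr_ge0.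
have H : (u ^+ 2) ^+ 2 <= (u ^+ 2 + d ^+ 2) ^+ 2 by rewrite ler_pXn2r ?nnegrE ?sqr_ge0// ltW.
have H3 : s ^+ 3 <= (2 * u) ^+ 3 by rewrite ler_pXn2r ?nnegrE ?(ltW s0)// mulr_ge0// ltW.
have -> : s * (d ^+ 2 * (2 * u)) * s ^+ 2 = d ^+ 2 * (2 * u * s ^+ 3) by ring.
have -> : 16 * d ^+ 2 * (u ^+ 2 + d ^+ 2) ^+ 2 = d ^+ 2 * (16 * (u ^+ 2 + d ^+ 2) ^+ 2) by ring.
rewrite ler_wpM2l ?sqr_ge0//.
apply: (@le_trans _ _ (16 * (u ^+ 2) ^+ 2)); last by rewrite ler_wpM2l.
have -> : 16 * (u ^+ 2) ^+ 2 = 2 * u * (2 * u) ^+ 3 by ring.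
by rewrite ler_wpM2l// mulr_ge0// ltW.
Qed.

(** The values of the cutoff parameter [d], taken along a sequence for the convergence theorems. *)
Definition step (k : nat) : R := k.+1%:R^-1.

Lemma step_gt0 k : 0 < step k. Proof. by rewrite invr_gt0. Qed.

Lemma step_le k l : (k <= l)%N -> step l <= step k.
Proof. by move=> kl; rewrite lef_pV2 ?posrE// ler_nat. Qed.

Lemma cvg_step : step @ \oo --> (0 : R).
Proof. exact: cvg_harmonic. Qed.

Lemma cvg_sq_step (a : R) : (fun k => a * step k ^+ 2) @ \oo --> (0 : R).
Proof.
rewrite -[X in _ --> X](mulr0 a); apply: cvgM; first exact: cvg_cst.
rewrite (_ : (fun k => step k ^+ 2) = fun k => step k * step k).
  by rewrite -[X in _ --> X](mulr0 0); apply: cvgM; exact: cvg_step.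
by apply/funext => k; rewrite expr2.
Qed.

Lemma step_small s : 0 < s -> \forall k \near \oo, step k <= s.
Proof.
move=> s0; have /cvgrPdist_le/(_ s s0) := cvg_step.
by apply: filterS => k; rewrite sub0r normrN gtr0_norm// step_gt0.
Qed.

Lemma cvg_rho s : 0 < s -> (fun k => rho (step k) s) @ \oo --> (1 : R).
Proof.
move=> s0; apply/cvgrPdist_le => e e0.
have /cvgrPdist_le/(_ e e0) := cvg_sq_step (4 / s ^+ 2).
apply: filterS2 (step_small (divr_gt0 s0 (ltr0n R 2))) => k ks.
rewrite sub0r normrN => H; have /andP[_ r1] := rho01 s (step_gt0 k).
rewrite ger0_norm ?subr_ge0//; apply: le_trans (rho_close (step_gt0 k) ks) _.
by rewrite mulrAC (le_trans (ler_norm _)).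
Qed.

Lemma cvg_mul_drho s : 0 < s -> (fun k => s * drho (step k) s) @ \oo --> (0 : R).
Proof.
move=> s0; apply/cvgrPdist_le => e e0.
have /cvgrPdist_le/(_ e e0) := cvg_sq_step (16 / s ^+ 2).
apply: filterS2 (step_small (divr_gt0 s0 (ltr0n R 2))) => k ks.
rewrite !sub0r !normrN => H.
rewrite ger0_norm; last by rewrite mulr_ge0 ?drho_ge0// ltW.
apply: le_trans (drho_close (step_gt0 k) ks) _.
by rewrite mulrAC (le_trans (ler_norm _)).
Qed.

End rho.

(** The Gram form of two gradients at [(1, 1)] and [(1, -1)], left unsimplified so as to match
    [gdot_lin_diag]. *)
Lemma norm_le_of_squares (R : realType) (a b c : R) :
  0 <= 1 ^+ 2 * a + 2 * (1 * 1) * b + 1 ^+ 2 * c ->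
  0 <= 1 ^+ 2 * a + 2 * (1 * -1) * b + (-1) ^+ 2 * c -> 2 * `|b| <= a + c.
Proof. by rewrite sqrrN !expr1n !mul1r mulr1 mulrN1 => ? ?; have [?|?] := ger0P b; lra. Qed.

(* [|f^2 - g^2|] and [2 |f g|] are at most [f^2 + g^2]. *)
Lemma boundary_layer_le (R : realType) (f g a b c : R) : 0 <= c -> 0 <= a ->
  2 * `|b| <= a + c ->
  `|f * (2 * (f * b + g * c)) - g * (2 * (f * a + g * b))| <= 2 * ((f * f + g * g) * (a + c)).
Proof.
move=> c0 a0 bac.
have -> : f * (2 * (f * b + g * c)) - g * (2 * (f * a + g * b)) =
  (f * f - g * g) * (2 * b) + 2 * (f * g) * (c - a) by ring.
have -> : 2 * ((f * f + g * g) * (a + c)) =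
  (f * f + g * g) * (a + c) + (f * f + g * g) * (a + c) by ring.
apply: (le_trans (ler_normD _ _)); apply: lerD; rewrite normrM ler_pM//.
- by rewrite ler_norml; have := sqr_ge0 f; have := sqr_ge0 g; rewrite !expr2 => ? ?; apply/andP; split; lra.
- by rewrite normrM ger0_norm.
- rewrite ler_norml; have := sqr_ge0 (f - g); have := sqr_ge0 (f + g).
  by rewrite !expr2 => ? ?; apply/andP; split; lra.
- by rewrite ler_norml; apply/andP; split; lra.
Qed.

(** For the energy bound: [r] is the cutoff, [e] the energy density, [w] the bounded part of the
    integrand and [b] the boundary layer term, nonnegative and so discarded. *)
Lemma mul_le_mulDD (R : realType) (r w e b C : R) : 0 <= r -> r <= 1 -> - C <= w ->
  0 <= C -> 0 <= b -> r * e <= r * (w + e) + b + C.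
Proof.
move=> r0 r1 Cw C0 b0; have H : - C <= r * w.
  by apply: le_trans (ler_wpM2l r0 Cw); rewrite mulrN lerN2 ler_piMl.
by rewrite mulrDr; move: (r * w) (r * e) H => x y; lra.
Qed.

(** The last term on the left is the cutoff times the square norm of [grad (a f + b g)]. On the
    right the first test occurs once and then [a ^+ 2 - 1] times because [Om_null_integralD] leaves
    its first summand unscaled. *)
Lemma form_split (R : realType) (r d f F g G x y z X Y a b : R) :
  r * ((a * f + b * g) * (a * F + b * G)) + d * ((a * f + b * g) * (a * X + b * Y)) +
    r * (a ^+ 2 * x + 2 * (a * b) * y + b ^+ 2 * z) =
  r * (f * F + x) + d * (f * X) + (a ^+ 2 - 1) * (r * (f * F + x) + d * (f * X)) +
  a * b * (r * (f * G + y) + d * (f * Y)) + a * b * (r * (g * F + y) + d * (g * X)) +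
  b ^+ 2 * (r * (g * G + z) + d * (g * Y)).
Proof. ring. Qed.

Lemma energy_split (R : realType) (r d f F a g G b x y : R) :
  r * (f * F + g * G + (a + b)) + d * (f * x + g * y) =
  (r * (f * F + a) + d * (f * x)) + 1 * (r * (g * G + b) + d * (g * y)).
Proof. ring. Qed.

Lemma symmetric_split (R : realType) (r d f F a g G x y : R) :
  r * (f * G - g * F) + d * (f * y - g * x) =
  (r * (f * G + a) + d * (f * y)) + -1 * (r * (g * F + a) + d * (g * x)).
Proof. ring. Qed.

Lemma test_split (R : realType) (r d k l L a b : R) :
  k * r * L + (k * (d * b) + r * a) = r * (k * L + a) + d * (k * b).
Proof. ring. Qed.

Lemma boundary_layer_bound (R : realType) (d s e K : R) : 0 <= K -> s * d <= 3 -> 0 <= e ->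
  d * (K * (s * e)) <= 3 * K * e.
Proof.
move=> K0 sd e0; have -> : d * (K * (s * e)) = K * e * (s * d) by ring.
have -> : 3 * K * e = K * e * 3 by ring.
by rewrite ler_wpM2l// mulr_ge0.
Qed.

(** [x], [y], [z] are the products of the gradients of [f] and [g]. Both factors are linear in [f]
    and [g], hence bounded through [s = |f| + |g|]; one factor [2] of the constant is visible in the
    statement, the other comes from [s^2 <= 2 (f^2 + g^2)]. *)
Lemma form_layer_le (R : realType) (f g x y z a b : R) : 0 <= x -> 0 <= z ->
  2 * `|y| <= x + z ->
  `|(a * f + b * g) * (a * (2 * (f * x + g * y)) + b * (2 * (f * y + g * z)))| <=
  4 * (`|a| + `|b|) ^+ 2 * ((f * f + g * g) * (x + z)).
Proof.
move=> x0 z0 yxz; set A := `|a| + `|b|; pose s := `|f| + `|g|.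
have s2 : s * s <= 2 * (f * f + g * g).
  rewrite /s -!expr2 -(real_normK (num_real f)) -(real_normK (num_real g)).
  have := sqr_ge0 (`|f| - `|g|); rewrite !expr2; move: `|f| `|g| => u v; nra.
have lin (p q u v : R) (t : R) : `|u| <= t -> `|v| <= t -> `|p * u + q * v| <= (`|p| + `|q|) * t.
  move=> ut vt; rewrite (le_trans (ler_normD _ _))// !normrM mulrDl.
  by rewrite lerD// ler_wpM2l.
have xE : `|x| <= x + z by rewrite ger0_norm ?lerDl.
have zE : `|z| <= x + z by rewrite ger0_norm ?lerDr.
have yE : `|y| <= x + z by have := normr_ge0 y; lra.
have H1 : `|a * f + b * g| <= A * s.
  by apply: lin; rewrite /s ?lerDl ?lerDr.
have two (t u : R) : `|t| <= u -> `|2 * t| <= 2 * u.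
  by move=> tu; rewrite normrM ger0_norm ?ler_wpM2l//.
have H2 : `|a * (2 * (f * x + g * y)) + b * (2 * (f * y + g * z))| <= A * (2 * (s * (x + z))).
  by apply: (lin _ _); apply: (two _); apply: (lin _ _).
rewrite normrM; apply: (le_trans (ler_pM _ _ H1 H2)) => //.
have -> : A * s * (A * (2 * (s * (x + z)))) = 2 * A ^+ 2 * (x + z) * (s * s) by ring.
have -> : 4 * A ^+ 2 * ((f * f + g * g) * (x + z)) = 2 * A ^+ 2 * (x + z) * (2 * (f * f + g * g)) by ring.
by rewrite ler_wpM2l// mulr_ge0 ?addr_ge0// mulr_ge0// sqr_ge0.
Qed.

Lemma mul_div_split (R : realType) (s d x : R) : 0 < s -> d * x = s * d * (x / s).
Proof. by move=> s0; field; rewrite gt_eqF. Qed.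

(** * Integration over the domain *)

Section dirichlet_green.
Context {R : realType} {n : nat} (M : riemannian_manifold R n).
Variable vol : {measure set (borel_manifold M) -> \bar R}.
Hypothesis volM : riemannian_measure vol.
Variable Om : set M.
Hypotheses (Om_open : open Om) (Om_compact : compact (closure Om)).
Implicit Types (f g h F G k : M -> R) (p q : M).

Lemma measurable_Om : measurable (Om : set (borel_manifold M)).
Proof. exact: borel_open. Qed.

Lemma vol_Om : (vol Om < +oo)%E.
Proof.
have [m [m_int m_ball _]] := @rV_measure R n.
apply: le_lt_trans (compact_finite_vol volM m_int m_ball Om_compact).
apply: le_measure; rewrite ?inE.
- exact: measurable_Om.
- by apply: borel_closed; exact: closed_closure.
- exact: subset_closure.
Qed.

Lemma continuous_on_measurable k : (forall q, Om q -> {for q, continuous k}) ->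
  measurable_fun (Om : set (borel_manifold M)) k.
Proof. by move=> ck; apply: (@continuous_borel _ M). Qed.

Definition bounded_on k := exists C, forall q, Om q -> `|k q| <= C.

Lemma Om_integrable k : (forall q, Om q -> {for q, continuous k}) -> bounded_on k ->
  vol.-integrable (Om : set (borel_manifold M)) (EFin \o k).
Proof.
move=> ck [C kC]; apply: (@bounded_integrable _ _ _ vol _ _ C) => //.
- exact: measurable_Om.
- exact: vol_Om.
- exact: continuous_on_measurable.
Qed.

Lemma within_closure_bounded k : {within closure Om, continuous k} -> bounded_on k.
Proof.
move=> ck; have /compact_bounded [C [_ CP]] := continuous_compact ck Om_compact.
exists (`|C| + 1) => q Oq; apply: (CP (`|C| + 1)); last by exists q => //; exact: subset_closure.
by rewrite (le_lt_trans (ler_norm _))// ltrDl.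
Qed.

Lemma bounded_onM k h : bounded_on k -> bounded_on h -> bounded_on (fun q => k q * h q).
Proof.
move=> [C kC] [D hD]; exists (C * D) => q Oq.
by rewrite normrM ler_pM// ?kC ?hD.
Qed.

Lemma bounded_onD k h : bounded_on k -> bounded_on h -> bounded_on (fun q => k q + h q).
Proof.
move=> [C kC] [D hD]; exists (C + D) => q Oq.
by rewrite (le_trans (ler_normD _ _))// lerD ?kC ?hD.
Qed.

Lemma gdot_lin (a b : R) f g k q : MC1 f q -> MC1 g q ->
  gdot (fun q => a * f q + b * g q) k q = a * gdot f k q + b * gdot g k q.
Proof.
move=> f1 g1; have c1 (c : R) l : MC1 l q -> MC1 (fun q => c * l q) q.
  by move=> l1; apply: (MC1M _ l1); exact: MC1_cst.
have d1 (c t : R) : is_derive t 1 (fun t : R => c * t) c.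
  by apply: is_derive_eq; rewrite -[LHS]/(c * 1) mulr1.
rewrite (gdotD _ (c1 a f f1) (c1 b g g1)).
by rewrite (gdot_comp _ f1 (d1 a (f q))) (gdot_comp _ g1 (d1 b (g q))).
Qed.

Lemma gdot_lin_diag (a b : R) f g q : MC1 f q -> MC1 g q ->
  gdot (fun q => a * f q + b * g q) (fun q => a * f q + b * g q) q =
  a ^+ 2 * gdot f f q + 2 * (a * b) * gdot f g q + b ^+ 2 * gdot g g q.
Proof.
move=> f1 g1; rewrite (gdot_lin _ _ _ f1 g1) (gdotC f) (gdotC g) !(gdot_lin _ _ _ f1 g1) (gdotC g f).
ring.
Qed.

Lemma not_Om_bdry q : closure Om q -> ~ Om q -> bdry Om q.
Proof. by move=> cq Oq; split => // /interior_subset. Qed.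

Lemma compact_superlevel h (d : R) : {within closure Om, continuous h} ->
  (forall q, bdry Om q -> h q = 0) -> 0 < d ->
  compact [set q | closure Om q /\ d <= h q] /\ [set q | closure Om q /\ d <= h q] `<=` Om.
Proof.
move=> ch h0 d0; split; last first.
  move=> q [cq dh]; apply: contrapT => Oq.
  by have := h0 q (not_Om_bdry cq Oq) => hq; move: dh; rewrite hq leNgt d0.
apply: (@subclosed_compact _ _ (closure Om)) => //; last by move=> q [].
have /continuous_closedP/(_ _ (@closed_ge R d)) := ch.
move=> /closed_subspaceP[V clV VE].
rewrite (_ : [set q | _] = V `&` closure Om); first by apply: closedI => //; exact: closed_closure.
rewrite VE; apply/seteqP; split => q /= [] //.
Qed.

Lemma Om_dominated (Y : nat -> M -> R) (Y0 B : M -> R) :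
  (forall i, measurable_fun (Om : set (borel_manifold M)) (Y i)) ->
  (forall q, Om q -> (fun i => Y i q) @ \oo --> Y0 q) ->
  vol.-integrable (Om : set (borel_manifold M)) (EFin \o B) ->
  (forall i q, Om q -> `|Y i q| <= B q) ->
  (fun i => \int[vol]_(q in (Om : set (borel_manifold M))) (Y i q)%:E)%E @ \oo
    --> (\int[vol]_(q in (Om : set (borel_manifold M))) (Y0 q)%:E)%E.
Proof.
move=> mY YY0 iB YB.
apply: (@dominated_cvg _ _ _ _ _ measurable_Om (fun i q => (Y i q)%:E) (EFin \o Y0) (EFin \o B)) => //.
- by move=> i; apply/measurable_EFinP.
- by move=> q Oq; apply: cvg_EFin; [exact: nearW|exact: YY0].
Qed.

(** Monotone convergence turns a uniform bound on the integrals into integrability of the limit. *)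
Lemma Om_monotone_integrable (Y : nat -> M -> R) (Y0 : M -> R) (C : \bar R) : (C < +oo)%E ->
  (forall i, measurable_fun (Om : set (borel_manifold M)) (Y i)) ->
  (forall i q, 0 <= Y i q) ->
  (forall q i j, (i <= j)%N -> Y i q <= Y j q) ->
  (forall q, Om q -> (fun i => Y i q) @ \oo --> Y0 q) ->
  (forall i, \int[vol]_(q in (Om : set (borel_manifold M))) (Y i q)%:E <= C)%E ->
  vol.-integrable (Om : set (borel_manifold M)) (EFin \o Y0).
Proof.
move=> Coo mY Y_ge0 Ymon YY0 YC.
have mY' i : measurable_fun (Om : set (borel_manifold M)) (fun q => (Y i q)%:E).
  by apply/measurable_EFinP; exact: mY.
have cY q : Om q -> (fun i => (Y i q)%:E) @ \oo --> (Y0 q)%:E.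
  by move=> Oq; apply: cvg_EFin; [exact: nearW|exact: YY0].
have Y0_ge0 q : Om q -> 0 <= Y0 q.
  by move=> Oq; rewrite -lee_fin; apply: (cvge_ge _ (cY q Oq)); apply: nearW => i; rewrite lee_fin.
apply/integrableP; split; first by apply/measurable_EFinP; exact: measurable_fun_cvg mY YY0.
have H := @cvg_monotone_convergence _ _ _ vol _ measurable_Om (fun i q => (Y i q)%:E) mY'.
have {}H := H (fun i q _ => Y_ge0 i q) (fun q _ i j ij => Ymon q i j ij).
rewrite (@eq_integral _ _ _ vol _ (fun q => limn (fun i => (Y i q)%:E))).
  by apply: le_lt_trans Coo; apply: (cvge_le _ H); exact: nearW.
move=> q /set_mem Oq; rewrite (cvg_lim _ (cY q Oq))//= ger0_norm//; exact: Y0_ge0.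
Qed.

Lemma Om_null_integralD (k l : M -> R) :
  vol.-integrable (Om : set (borel_manifold M)) (EFin \o k) /\
    (\int[vol]_(q in (Om : set (borel_manifold M))) (k q)%:E = 0)%E ->
  vol.-integrable (Om : set (borel_manifold M)) (EFin \o l) /\
    (\int[vol]_(q in (Om : set (borel_manifold M))) (l q)%:E = 0)%E ->
  forall a : R,
  vol.-integrable (Om : set (borel_manifold M)) (EFin \o (fun q => k q + a * l q)) /\
    (\int[vol]_(q in (Om : set (borel_manifold M))) (k q + a * l q)%:E = 0)%E.
Proof.
move=> [ik Ik] [il Il] a; have mO := measurable_Om.
have ial : vol.-integrable (Om : set (borel_manifold M)) (fun q => a%:E * (EFin \o l) q)%E.
  exact: integrableZl.
split; first by have := integrableD mO ik ial; apply: eq_integrable.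
under eq_integral do rewrite EFinD EFinM.
by rewrite integralD// integralZl// Ik Il mule0 adde0.
Qed.

Lemma Om_integrable_affine (k : M -> R) (a b : R) :
  vol.-integrable (Om : set (borel_manifold M)) (EFin \o k) ->
  vol.-integrable (Om : set (borel_manifold M)) (EFin \o (fun q => a + b * k q)).
Proof.
move=> ik; have mO := measurable_Om.
have ia : vol.-integrable (Om : set (borel_manifold M)) (EFin \o cst a).
  apply: (@Om_integrable (cst a)); last by exists `|a|.
  by move=> q _; exact: cst_continuous.
have ibk : vol.-integrable (Om : set (borel_manifold M)) (fun q => b%:E * (EFin \o k) q)%E.
  exact: integrableZl.
by have := integrableD mO ia ibk; apply: eq_integrable.
Qed.

(** * Green's formula for two Dirichlet solutions *)

Section pair.
Variables (f g F G : M -> R).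
Hypotheses (f_sol : dirichlet_solution Om f F) (g_sol : dirichlet_solution Om g G).
Hypotheses (cF : forall q, Om q -> {for q, continuous F}) (cG : forall q, Om q -> {for q, continuous G}).
Hypotheses (bF : bounded_on F) (bG : bounded_on G).

Let h q := f q * f q + g q * g q.
Let E q := gdot f f q + gdot g g q.

Let f1 q : Om q -> MC1 f q.
Proof. by case: f_sol => f2 _ _ _ Oq; apply: (Ck_on_MC1 Om_open f2). Qed.

Let g1 q : Om q -> MC1 g q.
Proof. by case: g_sol => g2 _ _ _ Oq; apply: (Ck_on_MC1 Om_open g2). Qed.

Let h1 q : Om q -> MC1 h q.
Proof. by move=> Oq; apply: MC1D; apply: MC1M; [exact: f1..|exact: g1|exact: g1]. Qed.

Let ch : {within closure Om, continuous h}.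
Proof.
case: f_sol => _ _ cf _; case: g_sol => _ _ cg _ => q.
by apply: cvgD; apply: cvgM; [exact: cf..|exact: cg|exact: cg].
Qed.

Let h_bdry q : bdry Om q -> h q = 0.
Proof.
case: f_sol => _ _ _ f0; case: g_sol => _ _ _ g0 => bq.
by rewrite /h f0// g0// !mulr0 addr0.
Qed.

Let h_ge0 q : 0 <= h q. Proof. by rewrite /h addr_ge0// -expr2 sqr_ge0. Qed.

Let E_ge0 q : 0 <= E q. Proof. by rewrite addr_ge0// gdot_ge0. Qed.

(* Green's formula for the test function [k * rho d h], extended by zero. *)
Let test_green (k l L : M -> R) (d : R) : 0 < d -> (forall q, Om q -> MC1 k q) ->
  Ck_on 2 Om l -> laplacian_on Om l L -> (forall q, Om q -> {for q, continuous L}) ->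
  let Z q := rho d (h q) * (k q * L q + gdot k l q) + drho d (h q) * (k q * gdot h l q) in
  vol.-integrable (Om : set (borel_manifold M)) (EFin \o Z) /\
  (\int[vol]_(q in (Om : set (borel_manifold M))) (Z q)%:E = 0)%E.
Proof.
move=> d0 k1 l2 lL cL Z.
have [cK KO] := compact_superlevel ch h_bdry d0.
set K := [set q | _] in cK KO.
pose phi q := if `[< Om q >] then k q * rho d (h q) else 0.
have phiE q : Om q -> phi q = k q * rho d (h q) by rewrite /phi; case: asboolP.
have phi0 q : ~ K q -> phi q = 0.
  move=> Kq; rewrite /phi; case: asboolP => // Oq; rewrite rho0 ?mulr0//.
  rewrite leNgt; apply/negP => dh; apply: Kq; split; [exact: subset_closure|exact: ltW].
have near_phi q : Om q -> \forall q' \near q, k q' * rho d (h q') = phi q'.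
  move=> Oq; have := open_nbhs_nbhs (conj Om_open Oq).
  by apply: filterS => q' Oq'; rewrite /phi; case: asboolP.
have rho1 q : Om q -> MC1 (fun q => rho d (h q)) q.
  move=> Oq; apply: (@MC1_comp _ _ _ _ _ (drho d)); first exact: h1.
    by move=> t; exact: is_derive_rho.
  exact: drho_continuous.
have phi1 q : MC1 phi q.
  have [Oq|Oq] := pselect (Om q); last by apply: (MC1_off_compact cK) => // /KO.
  by apply: MC1_near (near_phi q Oq) _; apply: MC1M; [exact: k1|exact: rho1].
have [m [m_int m_ball m_pder]] := @rV_measure R n.
have [iZ IZ] := green_compact volM m_int m_ball m_pder cK KO Om_open phi1 phi0 l2 lL cL.
pose A q := phi q * L q + gdot phi l q.
have AE q : Om q -> A q = Z q.
  move=> Oq; rewrite /A -(gdot_near _ (near_phi q Oq)) gdotM; [|exact: k1|exact: rho1].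
  rewrite (gdot_comp l (h1 Oq) (is_derive_rho (h q) d0)).
  rewrite phiE//; exact: test_split.
have A0 q : ~ Om q -> A q = 0.
  move=> Oq; have Kq : ~ K q by move=> /KO.
  by rewrite /A phi0// mul0r add0r (gdot_off_compact _ cK).
split.
  apply: (@eq_integrable _ _ _ _ _ measurable_Om (EFin \o A)).
    by move=> q; rewrite inE /= => Oq; rewrite AE.
  by apply: integrableS iZ => //; exact: measurable_Om.
rewrite -[RHS]IZ integral_mkcond; apply: eq_integral => q _; rewrite patchE.
case: ifPn; first by rewrite inE => Oq; rewrite -AE.
by rewrite notin_setE => Oq; rewrite -/(A q) A0.
Qed.

Let f2 : Ck_on 2 Om f. Proof. by case: f_sol. Qed.
Let g2 : Ck_on 2 Om g. Proof. by case: g_sol. Qed.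
Let fF : laplacian_on Om f F. Proof. by case: f_sol. Qed.
Let gG : laplacian_on Om g G. Proof. by case: g_sol. Qed.

Let f_cont q : Om q -> {for q, continuous f}.
Proof. by move=> Oq; apply: MC1_continuous; exact: f1. Qed.

Let g_cont q : Om q -> {for q, continuous g}.
Proof. by move=> Oq; apply: MC1_continuous; exact: g1. Qed.

Let h_cont q : Om q -> {for q, continuous h}.
Proof. by move=> Oq; apply: MC1_continuous; exact: h1. Qed.

Let bf : bounded_on f.
Proof. by case: f_sol => _ _ cf _; exact: within_closure_bounded. Qed.

Let bg : bounded_on g.
Proof. by case: g_sol => _ _ cg _; exact: within_closure_bounded. Qed.

Let gdot_h k q : Om q -> gdot h k q = 2 * (f q * gdot f k q + g q * gdot g k q).
Proof.
move=> Oq; rewrite gdotD; [|by apply: MC1M; exact: f1|by apply: MC1M; exact: g1].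
by rewrite !gdotM; [ring|exact: g1..|exact: f1|exact: f1].
Qed.

Let gdot_fg_le q : Om q -> 2 * `|gdot f g q| <= E q.
Proof.
move=> Oq; have fq := f1 Oq; have gq := g1 Oq.
have P := gdot_ge0 (fun q => 1 * f q + 1 * g q) q.
have N := gdot_ge0 (fun q => 1 * f q + -1 * g q) q.
move: P N; rewrite !(gdot_lin_diag _ _ fq gq); exact: norm_le_of_squares.
Qed.

Let fg0 q : ~~ (0 < h q) -> f q = 0 /\ g q = 0.
Proof.
rewrite -leNgt => hq.
have /eqP : h q = 0 by apply/eqP; rewrite eq_le hq h_ge0.
by rewrite /h paddr_eq0 -?expr2 ?sqr_ge0// !sqrf_eq0 => /andP[/eqP-> /eqP->].
Qed.

Let rho_h_cont (i : nat) q : Om q -> {for q, continuous (fun q => rho (step i : R) (h q))}.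
Proof.
move=> Oq; apply: MC1_continuous; apply: (@MC1_comp _ _ _ _ _ (drho (step i))).
- exact: h1.
- by move=> t; apply: is_derive_rho; exact: step_gt0.
- by apply: drho_continuous; exact: step_gt0.
Qed.

(** Each of [f] and [g] is tested against itself with the common cutoff. The two boundary layer
    terms have a nonnegative sum, although one of them alone can be negative. *)
Let energy_test (k : nat) :
  let Z q := rho (step k) (h q) * (f q * F q + g q * G q + E q) +
    drho (step k) (h q) * (f q * gdot h f q + g q * gdot h g q) in
  vol.-integrable (Om : set (borel_manifold M)) (EFin \o Z) /\
  (\int[vol]_(q in (Om : set (borel_manifold M))) (Z q)%:E = 0)%E.
Proof.
move=> Z; rewrite (_ : Z = fun q => (rho (step k) (h q) * (f q * F q + gdot f f q) +
  drho (step k) (h q) * (f q * gdot h f q)) + 1 * (rho (step k) (h q) * (g q * G q + gdot g g q) +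
  drho (step k) (h q) * (g q * gdot h g q))); last first.
  by apply/funext => q; exact: energy_split.
exact: (Om_null_integralD (test_green (step_gt0 k) f1 f2 fF cF)
  (test_green (step_gt0 k) g1 g2 gG cG)).
Qed.

(** In the difference of the two crossed tests the terms [gdot f g] cancel. *)
Let symmetric_test (k : nat) :
  let Z q := rho (step k) (h q) * (f q * G q - g q * F q) +
    drho (step k) (h q) * (f q * gdot h g q - g q * gdot h f q) in
  vol.-integrable (Om : set (borel_manifold M)) (EFin \o Z) /\
  (\int[vol]_(q in (Om : set (borel_manifold M))) (Z q)%:E = 0)%E.
Proof.
move=> Z; rewrite (_ : Z = fun q => (rho (step k) (h q) * (f q * G q + gdot f g q) +
  drho (step k) (h q) * (f q * gdot h g q)) + -1 * (rho (step k) (h q) * (g q * F q + gdot g f q) +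
  drho (step k) (h q) * (g q * gdot h f q))); last first.
  by apply/funext => q; rewrite (gdotC g f); exact: symmetric_split.
exact: (Om_null_integralD (test_green (step_gt0 k) f1 g2 gG cG)
  (test_green (step_gt0 k) g1 f2 fF cF)).
Qed.

Let W q := f q * F q + g q * G q.

Let bW : bounded_on W.
Proof. by apply: bounded_onD; apply: bounded_onM. Qed.

Let E_cont q : Om q -> {for q, continuous E}.
Proof.
move=> Oq; apply: (@continuousD _ _ _ (gdot f f) (gdot g g)).
  exact: (gdot_continuous Om_open Oq f1 f1).
exact: (gdot_continuous Om_open Oq g1 g1).
Qed.

(** The expression is half of [gdot h h]. *)
Let P_ge0 q : Om q -> 0 <= f q * gdot h f q + g q * gdot h g q.
Proof.
move=> Oq; have := gdot_ge0 h q; rewrite gdot_h// !(gdotC _ h); lra.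
Qed.

(** The limit of the cut-off energy density: at a zero of [h] the cutoff vanishes for every
    parameter. *)
Let bnd := fun q => if 0 < h q then E q else 0.

(* [h * drho d h] stays bounded, so the energy of [f] and [g] on [h > 0]
   dominates the boundary layer terms below. *)
Let bnd_integrable : vol.-integrable (Om : set (borel_manifold M)) (EFin \o bnd).
Proof.
have [C [C0 WC]] : exists C, 0 <= C /\ forall q, Om q -> `|W q| <= C.
  by have [C WC] := bW; exists `|C|; split => // q /WC WqC; exact: le_trans (ler_norm _).
pose e (i : nat) q := rho (step i) (h q) * E q.
have e_meas i : measurable_fun (Om : set (borel_manifold M)) (e i).
  apply: continuous_on_measurable => q Oq.
  by apply: continuousM; [exact: rho_h_cont|exact: E_cont].
have e_le i : (\int[vol]_(q in (Om : set (borel_manifold M))) (e i q)%:E <= C%:E * vol Om)%E.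
  have [iZ IZ] := energy_test i; set Z := (fun q : M => _) in iZ IZ.
  have iC : vol.-integrable (Om : set (borel_manifold M)) (EFin \o cst C).
    apply: (@Om_integrable (cst C)); last by exists `|C|.
    by move=> q _; exact: cst_continuous.
  have ZC : (\int[vol]_(q in (Om : set (borel_manifold M))) ((EFin \o Z) q + (EFin \o cst C) q) =
      C%:E * vol Om)%E.
    rewrite integralD//; last exact: measurable_Om.
    rewrite -[X in (X + _)%E]/(integral vol Om (fun q => (Z q)%:E)) IZ add0e.
    exact: (@integral_cst _ _ _ vol _ measurable_Om C%:E).
  have Ze q : Om q -> 0 <= e i q /\ e i q <= Z q + C.
    move=> Oq; have := WC q Oq; rewrite ler_norml => /andP[wC _].
    have /andP[r0 r1] := rho01 (h q) (step_gt0 i).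
    split; first by rewrite /e mulr_ge0 ?E_ge0.
    have b0 := mulr_ge0 (drho_ge0 (step i) (h q)) (P_ge0 Oq).
    exact: (mul_le_mulDD (E q) r0 r1 wC C0 b0).
  rewrite -ZC; apply: ge0_le_integral.
  - exact: measurable_Om.
  - by move=> q /Ze[].
  - by apply/measurable_EFinP; exact: e_meas.
  - have := integrableD measurable_Om iZ iC.
    by move=> /integrableP[].
  - by move=> q /Ze[_ b]; rewrite /= -EFinD lee_fin.
apply: (@Om_monotone_integrable e bnd (C%:E * vol Om)%E) => //.
- rewrite lte_mul_pinfty ?vol_Om// lee_fin.
- by move=> i q; rewrite mulr_ge0//; have /andP[] := rho01 (h q) (step_gt0 i).
- by move=> q i j ij; rewrite /e ler_wpM2r// rho_le ?step_gt0// step_le.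
- move=> q Oq; rewrite /bnd; case: ifPn => [hq|].
    by rewrite -[X in _ --> X]mul1r; apply: cvgMl; exact: cvg_rho.
  rewrite -leNgt => hq; rewrite (_ : (fun i : nat => _) = cst 0); first exact: cvg_cst.
  by apply/funext => i; rewrite /e rho0 ?mul0r ?step_gt0// (le_trans hq)// ltW ?step_gt0.
Qed.

Let layer (V Q : M -> R) (i : nat) q := rho (step i) (h q) * V q + drho (step i) (h q) * Q q.

(** [V] is the integrand of interest and [Q] the factor of the boundary layer, bounded by [h E]. By
    [mul_drho_le3], [C + 3 K bnd] dominates; where [h = 0], both [V] and [Q] vanish, so the
    pointwise limit is [V] everywhere. *)
Let layer_cvg (V Q : M -> R) (C K : R) :
  (forall q, Om q -> {for q, continuous V}) -> (forall q, Om q -> {for q, continuous Q}) ->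
  0 <= C -> (forall q, Om q -> `|V q| <= C) ->
  0 <= K -> (forall q, Om q -> `|Q q| <= K * (h q * E q)) ->
  (forall q, ~~ (0 < h q) -> V q = 0 /\ Q q = 0) ->
  (forall i, vol.-integrable (Om : set (borel_manifold M)) (EFin \o layer V Q i)) /\
  (fun i => \int[vol]_(q in (Om : set (borel_manifold M))) (layer V Q i q)%:E)%E @ \oo
    --> (\int[vol]_(q in (Om : set (borel_manifold M))) (V q)%:E)%E.
Proof.
move=> cV cQ C0 VC K0 QK VQ0.
have mY i : measurable_fun (Om : set (borel_manifold M)) (layer V Q i).
  apply: continuous_on_measurable => q Oq.
  apply: (@continuousD _ _ _ (fun q => rho (step i) (h q) * V q) (fun q => drho (step i) (h q) * Q q)).
    by apply: (@continuousM _ _ (fun q => rho (step i) (h q)) V); [exact: rho_h_cont|exact: cV].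
  apply: (@continuousM _ _ (fun q => drho (step i) (h q)) Q); last exact: cQ.
  apply: (@continuous_comp _ _ _ h (drho (step i))); first exact: h_cont.
  by apply: drho_continuous; exact: step_gt0.
have Y_le i q : Om q -> `|layer V Q i q| <= C + 3 * K * bnd q.
  move=> Oq; have /andP[r0 r1] := rho01 (h q) (step_gt0 i).
  apply: (le_trans (ler_normD _ _)); apply: lerD.
    rewrite normrM (ger0_norm r0); apply: (@le_trans _ _ (`|V q|)); last exact: VC.
    by rewrite ler_piMl.
  rewrite normrM (ger0_norm (drho_ge0 _ _)) /bnd; case: ifPn => [hq|/VQ0[_ ->]].
    apply: (le_trans (ler_wpM2l (drho_ge0 _ _) (QK q Oq))).
    exact: boundary_layer_bound K0 (mul_drho_le3 _ (step_gt0 i)) (E_ge0 q).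
  by rewrite normr0 !mulr0.
have ZZ q : Om q -> (fun i => layer V Q i q) @ \oo --> V q.
  move=> Oq; rewrite /layer; have [hq|hq] := boolP (0 < h q); last first.
    have [-> ->] := VQ0 q hq.
    rewrite (_ : (fun i : nat => _) = cst 0); first exact: cvg_cst.
    by apply/funext => i /=; rewrite !mulr0 addr0.
  rewrite -[X in _ --> X]addr0; apply: cvgD.
    by rewrite -[X in _ --> X]mul1r; apply: cvgMl; exact: cvg_rho.
  (* Only [h * drho] is known to tend to [0], so a factor [h q > 0] is inserted and divided out. *)
  rewrite (_ : (fun i : nat => _) = fun i : nat => h q * drho (step i) (h q) * (Q q / h q)).
    by rewrite -[X in _ --> X](mul0r (Q q / h q)); apply: cvgMl; exact: cvg_mul_drho.
  by apply/funext => i; exact: mul_div_split.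
have iB := Om_integrable_affine C (3 * K) bnd_integrable.
split; last exact: Om_dominated iB Y_le.
move=> i; apply: (@le_integrable _ _ _ vol _ measurable_Om _ _ _ _ iB).
  by apply/measurable_EFinP.
by move=> q Oq; rewrite lee_fin (le_trans (Y_le i q Oq))// ler_norm.
Qed.

Let gdot_h_cont k q : (forall q, Om q -> MC1 k q) -> Om q -> {for q, continuous (gdot h k)}.
Proof. by move=> k1 Oq; exact: (gdot_continuous Om_open Oq h1 k1). Qed.

(** By [symmetric_test] the integrals with cutoff are all zero, and they converge to this one. *)
Lemma dirichlet_symmetric :
  \int[vol]_(q in (Om : set (borel_manifold M))) (f q * G q - g q * F q) = 0.
Proof.
have [C1 VC1] := bounded_onM bf bG; have [C2 VC2] := bounded_onM bg bF.
have V_le q : Om q -> `|f q * G q - g q * F q| <= `|C1| + `|C2|.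
  move=> Oq; apply: (le_trans (ler_normB _ _)); apply: lerD.
    by apply: (le_trans (VC1 q Oq)); exact: ler_norm.
  by apply: (le_trans (VC2 q Oq)); exact: ler_norm.
have Q_le q : Om q -> `|f q * gdot h g q - g q * gdot h f q| <= 2 * (h q * E q).
  move=> Oq; have := gdot_fg_le Oq; rewrite !gdot_h// (gdotC g f).
  have := gdot_ge0 f q; have := gdot_ge0 g q; rewrite /E /h.
  exact: boundary_layer_le.
have [|||||_ H] := @layer_cvg (fun q => f q * G q - g q * F q)
    (fun q => f q * gdot h g q - g q * gdot h f q) (`|C1| + `|C2|) 2 _ _ _ V_le _ Q_le.
- move=> q Oq; apply: (@continuousB _ _ _ (fun q => f q * G q) (fun q => g q * F q)).
    by apply: (@continuousM _ _ f G); [exact: f_cont|exact: cG].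
  by apply: (@continuousM _ _ g F); [exact: g_cont|exact: cF].
- move=> q Oq; apply: (@continuousB _ _ _ (fun q => f q * gdot h g q) (fun q => g q * gdot h f q)).
    by apply: (@continuousM _ _ f (gdot h g)); [exact: f_cont|exact: gdot_h_cont].
  by apply: (@continuousM _ _ g (gdot h f)); [exact: g_cont|exact: gdot_h_cont].
- exact: addr_ge0.
- by [].
- by move=> q /fg0[-> ->]; rewrite !mul0r subrr.
have {}H : (fun _ : nat => 0%E : \bar R) @ \oo -->
   (\int[vol]_(q in (Om : set (borel_manifold M))) (f q * G q - g q * F q)%:E)%E.
  by apply: cvg_trans H; apply: near_eq_cvg; apply: nearW => i; rewrite (symmetric_test i).2.
by rewrite /Rintegral -(cvg_unique _ (cvg_cst _) H).
Qed.

(** With [w = a f + b g], the four tests combine so that the integral with cutoff plus that of the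
    cutoff times [|grad w|^2] is zero. Dropping the second, nonnegative, term before the limit
    leaves an inequality. *)
Lemma dirichlet_form_le0 (a b : R) :
  \int[vol]_(q in (Om : set (borel_manifold M))) ((a * f q + b * g q) * (a * F q + b * G q)) <= 0.
Proof.
have bc (c : R) k : bounded_on k -> bounded_on (fun q => c * k q).
  by apply: bounded_onM; exists `|c|.
have cc (c : R) k q : {for q, continuous k} -> {for q, continuous (fun q => c * k q)}.
  by move=> ck; apply: (@continuousM _ _ (cst c) k) => //; exact: cst_continuous.
have clin (k l : M -> R) q : {for q, continuous k} -> {for q, continuous l} ->
    {for q, continuous (fun q => a * k q + b * l q)}.
  by move=> ck cl; apply: (@continuousD _ _ _ (fun q => a * k q) (fun q => b * l q)); exact: cc.
have [C VC] : bounded_on (fun q => (a * f q + b * g q) * (a * F q + b * G q)).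
  by apply: bounded_onM; apply: bounded_onD; exact: bc.
have Q_le q : Om q ->
    `|(a * f q + b * g q) * (a * gdot h f q + b * gdot h g q)| <= 4 * (`|a| + `|b|) ^+ 2 * (h q * E q).
  move=> Oq; have := gdot_fg_le Oq; rewrite !gdot_h// (gdotC g f).
  have := gdot_ge0 g q; have := gdot_ge0 f q; rewrite /E /h.
  exact: form_layer_le.
have V_le q : Om q -> `|(a * f q + b * g q) * (a * F q + b * G q)| <= `|C|.
  by move=> Oq; apply: (le_trans (VC q Oq)); exact: ler_norm.
have [|||||iV H] := @layer_cvg (fun q => (a * f q + b * g q) * (a * F q + b * G q))
    (fun q => (a * f q + b * g q) * (a * gdot h f q + b * gdot h g q)) `|C| _ _ _ _ V_le _ Q_le.
- move=> q Oq; apply: (@continuousM _ _ (fun q => a * f q + b * g q) (fun q => a * F q + b * G q)).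
    by apply: clin; [exact: f_cont|exact: g_cont].
  by apply: clin; [exact: cF|exact: cG].
- move=> q Oq; apply: (@continuousM _ _ (fun q => a * f q + b * g q)
    (fun q => a * gdot h f q + b * gdot h g q)).
    by apply: clin; [exact: f_cont|exact: g_cont].
  by apply: clin; exact: gdot_h_cont.
- by [].
- by rewrite mulr_ge0// sqr_ge0.
- by move=> q /fg0[-> ->]; rewrite !mulr0 addr0 !mul0r.
have H0 : (\int[vol]_(q in (Om : set (borel_manifold M)))
    ((a * f q + b * g q) * (a * F q + b * G q))%:E <= 0)%E.
  apply: (cvge_le _ H); apply: nearW => i.
  have tff := test_green (step_gt0 i) f1 f2 fF cF.
  have [iZ <-] := Om_null_integralD (Om_null_integralD (Om_null_integralD
    (Om_null_integralD tff tff (a ^+ 2 - 1))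
    (test_green (step_gt0 i) f1 g2 gG cG) (a * b))
    (test_green (step_gt0 i) g1 f2 fF cF) (a * b))
    (test_green (step_gt0 i) g1 g2 gG cG) (b ^+ 2).
  apply: le_integral; [exact: measurable_Om|exact: iV|exact: iZ|].
  move=> q /set_mem Oq; rewrite lee_fin (gdotC g f) -form_split lerDl.
  rewrite mulr_ge0 -?gdot_lin_diag ?gdot_ge0//; [|exact: f1|exact: g1].
  by have /andP[] := rho01 (h q) (step_gt0 i).
(* An infinite integral is read as [0] by [fine], which agrees with the bound. *)
by move: H0; rewrite /Rintegral; case: integral => //= r; rewrite lee_fin.
Qed.

End pair.

End dirichlet_green.

(** Both parities at once: with [x = lambda^i], [y = lambda^j], [A = (u_i, u_j)], [A0 = (u_k, u_0)],
    [a = (p, p)], [b = (u_i, p)] and [c = (u_j, p)], the second premise expands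
    [0 <= (x u_i - i! p, y u_j - j! p)]. *)
Lemma moment_arith (R : realType) (i j k : nat) (x y a A b c A0 : R) :
  i`!%:R * j`!%:R * A0 = k`!%:R * A ->
  0 <= x * (y * A + - j`!%:R * b) + - i`!%:R * (y * c + - j`!%:R * a) ->
  x * b = i`!%:R * a -> y * c = j`!%:R * a ->
  k`!%:R * a <= x * y * A0.
Proof.
have f0 (l : nat) : 0 < l`!%:R :> R by rewrite ltr0n fact_gt0.
have := f0 k; have := mulr_gt0 (f0 i) (f0 j).
move: i`!%:R j`!%:R k`!%:R => s t r st0 r0 H P xb yc.
have {}P : 0 <= x * y * A - s * t * a.
  by rewrite (le_trans P)// le_eqVlt; apply/orP; left; apply/eqP; ring: xb yc.
rewrite -subr_ge0 -(pmulr_rge0 _ st0) mulrBr.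
have -> : s * t * (x * y * A0) - s * t * (r * a) = r * (x * y * A - s * t * a) by ring: H.
by rewrite pmulr_rge0.
Qed.

(** * Positivity of the volume of open sets *)

Section volume_positive.
Context {R : realType} {n : nat} (M : riemannian_manifold R n).
Variable vol : {measure set (borel_manifold M) -> \bar R}.
Hypothesis volM : riemannian_measure vol.

(** In a chart, a small cube has positive mass and the density stays above half its value at the
    centre. This makes the norm of a nonzero eigenfunction positive. *)
Lemma open_vol_gt0 (U : set M) q : open U -> U q -> (0 < vol U)%E.
Proof.
move=> oU Uq; have [m [m_int m_ball _]] := @rV_measure R n.
have [ac cq] := chart_atP q; set c := chart_at q in ac cq.
pose A : set (borel_manifold M) := U `&` cdom c.
have mA : measurable A by apply: borel_open; apply: openI => //; exact: open_cdom.
have mU : measurable (U : set (borel_manifold M)) by exact: borel_open.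
apply: (@lt_le_trans _ _ (vol A)); last by apply: le_measure; rewrite ?inE// => ? [].
rewrite (volE volM m_int ac mA); last by move=> ? [].
set x := cmap c q; have cx : ccod c x by exact: cmap_cod.
have s0 := sqrt_det_gt0 ac cx; set s := sqrt_det c x in s0.
have near_s : \forall y \near x, s / 2 < sqrt_det c y.
  have cs := C1_continuous (sqrt_det_C1 ac cx).
  have lt : s / 2 < s by rewrite ltr_pdivrMr// ltr_pMr// ltr1n.
  exact: (cvgr_gt _ cs _ lt).
have : \forall y \near x, s / 2 < sqrt_det c y /\ chart_codom c U y.
  by apply: filterI near_s _; exact: near_cinv.
move=> /nbhs_ballP[r /= r0 xr].
have mball : measurable (ball x r : set (borel 'rV[R]_n)) by apply: borel_open; exact: ball_open.
have mccod : measurable (ccod c : set (borel 'rV[R]_n)) by exact: measurable_ccod.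
have mg : measurable_fun (ccod c : set (borel 'rV[R]_n)) (fun x => (sqrt_det c x * \1_A (cinv c x))%:E).
  apply/measurable_EFinP; apply: measurable_funM; first exact: measurable_sqrt_det.
  exact: measurable_indic_cinv.
have bc : ball x r `<=` ccod c by move=> y /xr[_ []].
apply: (@lt_le_trans _ _ ((s / 2)%:E * m (ball x r))%E).
  by rewrite m_ball// mule_gt0// lte_fin ?divr_gt0// exprn_gt0// mulrn_wgt0.
rewrite -(integral_cst m mball).
apply: (@le_trans _ _ (\int[m]_(y in ball x r) (sqrt_det c y * \1_A (cinv c y))%:E)%E).
  apply: ge0_le_integral => //.
  - by move=> y _; rewrite lee_fin ltW// divr_gt0.
  - exact: measurable_funS mg.
  - move=> y /xr[sy [cy Uy]]; rewrite lee_fin indicE mem_set ?mulr1 ?ltW//.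
    by split => //; exact: cinv_dom.
apply: ge0_subset_integral => //.
by move=> y _; rewrite lee_fin mulr_ge0// sqrtr_ge0.
Qed.

End volume_positive.

(** * Inner products of the moment functions and the eigenfunction *)

Section spectral.
Context {R : realType} {n : nat} (M : riemannian_manifold R n).
Variable vol : {measure set (borel_manifold M) -> \bar R}.
Hypothesis volM : riemannian_measure vol.
Variable Om : set M.
Hypotheses (Om_open : open Om) (Om_compact : compact (closure Om)).
Implicit Types f g h : M -> R.

Let mOm : measurable (Om : set (borel_manifold M)). Proof. exact: borel_open. Qed.

(** A class closed under products and linear combinations whose members are integrable, the domain
    having finite volume; all functions of the hierarchy and all eigenfunctions belong to it. *)
Definition cbounded f := (forall q, Om q -> {for q, continuous f}) /\ bounded_on Om f.

Local Notation "'[ f , g ]" := (l2dot vol Om f g) (format "''[' f ,  g ]").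

Lemma cboundedM f g : cbounded f -> cbounded g -> cbounded (fun q => f q * g q).
Proof.
move=> [cf bf] [cg bg]; split; last exact: bounded_onM.
by move=> q Oq; apply: (@continuousM _ _ f g); [exact: cf|exact: cg].
Qed.

Lemma cboundedZ (a : R) f : cbounded f -> cbounded (fun q => a * f q).
Proof.
apply: cboundedM; split; last by exists `|a|.
by move=> q _; exact: cst_continuous.
Qed.

Lemma cboundedD f g : cbounded f -> cbounded g -> cbounded (fun q => f q + g q).
Proof.
move=> [cf bf] [cg bg]; split; last exact: bounded_onD.
by move=> q Oq; apply: (@continuousD _ _ _ f g); [exact: cf|exact: cg].
Qed.

Lemma eq_cbounded f g : (forall q, Om q -> f q = g q) -> cbounded f -> cbounded g.
Proof.
move=> fg [cf [C fC]]; split; last by exists C => q Oq; rewrite -fg// fC.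
move=> q Oq; apply: (near_continuous _ (cf q Oq)).
by apply: filterS (open_nbhs_nbhs (conj Om_open Oq)) => q' /fg.
Qed.

Lemma solution_cbounded f h : dirichlet_solution Om f h -> cbounded f.
Proof.
case=> f2 _ cf _; split; last exact: within_closure_bounded.
by move=> q Oq; apply: MC1_continuous; exact: (Ck_on_MC1 Om_open f2).
Qed.

Lemma cbounded_integrable f : cbounded f -> vol.-integrable (Om : set (borel_manifold M)) (EFin \o f).
Proof. by case; exact: Om_integrable. Qed.

Lemma l2dotC f g : '[f, g] = '[g, f].
Proof. by apply: eq_Rintegral => q _; rewrite mulrC. Qed.

Lemma eq_l2dot f f' g g' : (forall q, Om q -> f q = f' q) -> (forall q, Om q -> g q = g' q) ->
  '[f, g] = '[f', g'].
Proof. by move=> ff' gg'; apply: eq_Rintegral => q /set_mem Oq; rewrite ff'// gg'. Qed.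

Lemma l2dot_linl (a b : R) f g h : cbounded f -> cbounded g -> cbounded h ->
  '[fun q => a * f q + b * g q, h] = a * '[f, h] + b * '[g, h].
Proof.
move=> cf cg ch; have ifh := cbounded_integrable (cboundedM cf ch).
have igh := cbounded_integrable (cboundedM cg ch).
rewrite /l2dot -(RintegralZl _ mOm ifh) -(RintegralZl _ mOm igh) -RintegralD//.
- by apply: eq_Rintegral => q _; ring.
- exact: cbounded_integrable (cboundedZ a (cboundedM cf ch)).
- exact: cbounded_integrable (cboundedZ b (cboundedM cg ch)).
Qed.

Lemma l2dot_linr (a b : R) f g h : cbounded f -> cbounded g -> cbounded h ->
  '[h, fun q => a * f q + b * g q] = a * '[h, f] + b * '[h, g].
Proof. by move=> cf cg ch; rewrite l2dotC l2dot_linl// ![l2dot _ _ h _]l2dotC. Qed.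

Lemma l2dotZr (a : R) f h : cbounded f -> cbounded h -> '[h, fun q => a * f q] = a * '[h, f].
Proof.
move=> cf ch; rewrite /l2dot -(RintegralZl _ mOm (cbounded_integrable (cboundedM ch cf))).
by apply: eq_Rintegral => q _; ring.
Qed.

Lemma l2dot_ge0 f : 0 <= '[f, f].
Proof. by apply: Rintegral_ge0 => q _; rewrite -expr2 sqr_ge0. Qed.

Lemma l2dot_gt0 f q : cbounded f -> Om q -> f q != 0 -> 0 < '[f, f].
Proof.
move=> cf Oq fq0; pose e := (f q * f q) / 2.
have e0 : 0 < e by rewrite divr_gt0// -expr2 exprn_even_gt0.
have [cff bff] := cboundedM cf cf.
have : \forall q' \near q, Om q' /\ e < f q' * f q'.
  apply: filterI; first by apply: open_nbhs_nbhs.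
  have lt : e < f q * f q by rewrite ltr_pdivrMr// ltr_pMr ?ltr1n// -expr2 exprn_even_gt0.
  exact: (cvgr_gt _ (cff q Oq) _ lt).
rewrite /prop_near1 nbhsE => -[V [oV Vq] VP].
have mV : measurable (V : set (borel_manifold M)) by exact: borel_open.
have VO : V `<=` Om by move=> x /VP[].
have : (e%:E * vol V <= \int[vol]_(x in (Om : set (borel_manifold M))) (f x * f x)%:E)%E.
  rewrite -(integral_cst _ mV).
  apply: (@le_trans _ _ (\int[vol]_(x in (V : set (borel_manifold M))) (f x * f x)%:E)%E).
    apply: ge0_le_integral => //.
    - by move=> x _; rewrite lee_fin ltW.
    - apply/measurable_EFinP; apply: (@measurable_funS _ _ _ _ (Om : set (borel_manifold M))) => //.
      exact: continuous_on_measurable.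
    - by move=> x /VP[_ ex]; rewrite lee_fin ltW.
  apply: ge0_subset_integral => //.
    by apply/measurable_EFinP; exact: continuous_on_measurable.
  by move=> x _; rewrite lee_fin -expr2 sqr_ge0.
have V0 := open_vol_gt0 volM oV Vq.
have : (0 < e%:E * vol V)%E by rewrite mule_gt0.
have /integrableP[_] := cbounded_integrable (cboundedM cf cf).
rewrite /l2dot /Rintegral => _ a b; have := lt_le_trans a b.
have := integrable_fin_num mOm (cbounded_integrable (cboundedM cf cf)).
by move=> /fineK <-; rewrite lte_fin.
Qed.

Definition cb_solution f h := dirichlet_solution Om f h /\ cbounded h.

Lemma l2dot_symmetric f g F G : cb_solution f F -> cb_solution g G -> '[f, G] = '[g, F].
Proof.
move=> [f_sol cF] [g_sol cG]; have cf := solution_cbounded f_sol; have cg := solution_cbounded g_sol.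
apply/eqP; rewrite -subr_eq0; apply/eqP.
rewrite -(dirichlet_symmetric volM Om_open Om_compact f_sol g_sol cF.1 cG.1 cF.2 cG.2).
by rewrite RintegralB//; apply: cbounded_integrable; exact: cboundedM.
Qed.

Lemma l2dot_form_le0 (a b : R) f g F G : cb_solution f F -> cb_solution g G ->
  '[fun q => a * f q + b * g q, fun q => a * F q + b * G q] <= 0.
Proof.
move=> [f_sol cF] [g_sol cG].
exact: (dirichlet_form_le0 volM Om_open Om_compact f_sol g_sol cF.1 cG.1 cF.2 cG.2).
Qed.

Lemma eigen_solution (lambda : R) phi : dirichlet_eigenspace Om lambda phi ->
  cb_solution phi (fun q => - (lambda * phi q)).
Proof.
move=> e; split=> //; have c := cboundedZ (- lambda) (solution_cbounded e).
by apply: (eq_cbounded _ c) => q _; rewrite mulNr.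
Qed.

Lemma l2dot_eigen (lambda : R) f phi : cbounded f -> cbounded phi ->
  '[f, fun q => - (lambda * phi q)] = - lambda * '[f, phi].
Proof.
move=> cf cp; rewrite -l2dotZr//; apply: eq_l2dot => // q _; by rewrite mulNr.
Qed.

Lemma eigenvalue_ge0 (lambda : R) : dirichlet_eigenvalue Om lambda -> 0 <= lambda.
Proof.
move=> [phi e [q Oq phiq]]; have s := eigen_solution e; have c := solution_cbounded e.
(* The coefficients [1] and [0] reduce the form of the pair [(phi, phi)] to that of [phi] alone. *)
have := l2dot_form_le0 1 0 s s.
rewrite (@eq_l2dot _ phi _ (fun q => - (lambda * phi q))); [|by move=> ? _; ring..].
rewrite l2dot_eigen// mulNr oppr_le0 pmulr_lge0//; exact: l2dot_gt0 Oq phiq.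
Qed.

Section moments.
Variables (u : nat -> M -> R) (lambda : R) (p : M -> R).
Hypothesis u0 : forall q, Om q -> u 0%N q = 1.
Hypothesis u_sol : forall k, (0 < k)%N ->
  dirichlet_solution Om (u k) (fun q => - (k%:R * u k.-1 q)).
Hypothesis p_eigen : dirichlet_eigenspace Om lambda p.

Lemma moment_cbounded k : cbounded (u k).
Proof.
case: k => [|k]; last exact: solution_cbounded (u_sol _).
apply: (@eq_cbounded (cst 1)); first by move=> q /u0.
by split; [move=> q _; exact: cst_continuous|exists `|1|].
Qed.

Let cu := moment_cbounded.

Let cp : cbounded p. Proof. exact: solution_cbounded p_eigen. Qed.

Let us k : cb_solution (u k.+1) (fun q => - (k.+1%:R * u k q)).
Proof.
split; first exact: (@u_sol k.+1).
by apply: (eq_cbounded _ (cboundedZ (- k.+1%:R) (cu k))) => q _; rewrite mulNr.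
Qed.

Let ps := eigen_solution p_eigen.

Let moment_p k : lambda * '[u k.+1, p] = k.+1%:R * '[u k, p].
Proof.
have := l2dot_symmetric (us k) ps; rewrite l2dot_eigen// l2dot_eigen//.
by rewrite !mulNr => /oppr_inj ->; rewrite l2dotC.
Qed.

Let moment_shift i j : j.+1%:R * '[u i.+1, u j] = i.+1%:R * '[u i, u j.+1].
Proof.
have := l2dot_symmetric (us i) (us j); rewrite !l2dot_eigen//.
by rewrite !mulNr => /oppr_inj ->; rewrite l2dotC.
Qed.

(** Written without dividing by [lambda ^+ k], so that it also decides the case [lambda = 0]. *)
Lemma moment_eigen k : lambda ^+ k * '[u k, p] = k`!%:R * '[u 0%N, p].
Proof.
elim: k => [|k IH]; first by rewrite expr0 fact0.
by rewrite exprSr -mulrA moment_p mulrCA IH mulrA factS natrM.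
Qed.

Let moment_fold i j : i`!%:R * j`!%:R * '[u (i + j)%N, u 0%N] = (i + j)`!%:R * '[u i, u j].
Proof.
elim: j i => [|j IH] i; first by rewrite fact0 mulr1 addn0.
(* [moment_shift] moves one unit of index from [j + 1] to [i]; the factor [i + 1] turns [i!] into
   the [(i + 1)!] of the induction hypothesis. *)
rewrite addnS -addSn; apply: (mulfI (lt0r_neq0 (ltr0Sn R i))).
have := IH i.+1; rewrite factS natrM => H.
rewrite [RHS]mulrCA -moment_shift [RHS]mulrCA -H factS natrM; ring.
Qed.

Lemma moment_ge (k : nat) : 0 < lambda -> '[u 0%N, p] = '[p, p] ->
  k`!%:R * '[p, p] <= lambda ^+ k * '[u k, u 0%N].
Proof.
move=> l0 a2; have moment_eigen' j := etrans (moment_eigen j) (congr1 (fun x => j`!%:R * x) a2).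
have [m [E|E]] : exists m, k = (m + m)%N \/ k = (m.+1 + m)%N.
  exists k./2; have := odd_double_half k; rewrite -addnn.
  by case: odd => /= kE; [right; rewrite -[in LHS]kE|left].
- rewrite E exprD; apply: (moment_arith (moment_fold m m) _ (moment_eigen' m) (moment_eigen' m)).
  have := l2dot_ge0 (fun q => lambda ^+ m * u m q + - m`!%:R * p q).
  rewrite l2dot_linl ?l2dot_linr//; last by apply: cboundedD; exact: cboundedZ.
  by rewrite [l2dot _ _ p (u m)]l2dotC.
- rewrite E exprD; apply: (moment_arith (moment_fold m.+1 m) _ (moment_eigen' m.+1) (moment_eigen' m)).
  have := l2dot_form_le0 (lambda ^+ m.+1) (- m.+1`!%:R) (us m) ps.
  (* Applying the Laplacian to the combination at rank [m + 1] gives [- lambda (m + 1)] times the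
     combination at rank [m]. The form is thus a negative multiple of the inner product of the
     two. *)
  rewrite (@eq_l2dot _ (fun q => lambda ^+ m.+1 * u m.+1 q + - m.+1`!%:R * p q) _
    (fun q => - (lambda * m.+1%:R) * (lambda ^+ m * u m q + - m`!%:R * p q)))//; last first.
    by move=> q _; rewrite factS natrM exprS; ring.
  have cw : cbounded (fun q => lambda ^+ m * u m q + - m`!%:R * p q).
    by apply: cboundedD; exact: cboundedZ.
  have cw' : cbounded (fun q => lambda ^+ m.+1 * u m.+1 q + - m.+1`!%:R * p q).
    by apply: cboundedD; exact: cboundedZ.
  rewrite (l2dotZr _ cw cw') nmulr_rle0; last by rewrite oppr_lt0 mulr_gt0.
  by rewrite l2dot_linl ?l2dot_linr// [l2dot _ _ p (u m)]l2dotC.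
Qed.

End moments.

End spectral.

(** * The eigenvalue bound *)

Theorem theorem1p3 (R : realType) (n : nat) (M : riemannian_manifold R n)
  (M_complete : complete_manifold M)
  (vol : {measure set (borel_manifold M) -> \bar R})
  (vol_riemannian : riemannian_measure vol)
  (d : measure_display) (W : measurableType d)
  (P : M -> probability W R) (X : R -> W -> one_point_compactification M)
  (X_brownian : brownian_motion P X)
  (Omega : set M) (Omega_open : open Omega)
  (Omega_bounded : bounded_domain Omega)
  (Omega_bdry : bdry Omega !=set0)
  (Omega_smooth : smooth_boundary Omega)
  (moments : moment_hierarchy P X Omega)
  (lambda : R) (lambda_eigenvalue : dirichlet_eigenvalue Omega lambda)
  (p : M -> R)
  (p_proj : orthogonal_projection vol Omega (dirichlet_eigenspace Omega lambda)
              (fun=> 1) p)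
  (k : nat) (k_gt0 : (0 < k)%N) :
  ((k`!)%:R * l2dot vol Omega p p / fine (total_moment vol P X Omega k))
    `^ (k%:R^-1) <= lambda.
Proof.
have K := bounded_domain_compact M_complete Omega_bounded.
have [u [u0 u_sol u_moment]] := moments; have [p_eigen p_orth] := p_proj.
have cp := solution_cbounded Omega_open K p_eigen.
have cu := moment_cbounded Omega_open K u0 u_sol.
(* [1 - p] is orthogonal to the eigenspace, in particular to [p] itself. *)
have a2 : l2dot vol Omega (u 0%N) p = l2dot vol Omega p p.
  have := p_orth p p_eigen; rewrite (@eq_l2dot _ _ _ _ _ _ (fun q => 1 * u 0%N q + -1 * p q) _ p)//.
    by rewrite l2dot_linl// mul1r mulN1r => /subr0_eq.
  by move=> q /u0 ->; rewrite !mul1r mulN1r.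
have -> : fine (total_moment vol P X Omega k) = l2dot vol Omega (u k) (u 0%N).
  congr fine; apply: eq_integral => q /set_mem Oq.
  by rewrite u_moment// u0// mulr1.
have := eigenvalue_ge0 vol_riemannian Omega_open K lambda_eigenvalue.
(* If [lambda = 0], [moment_eigen] with [k > 0] gives [k! (p, p) = 0], and the left side of the
   bound is a power of [0] with nonzero exponent. *)
rewrite le_eqVlt => /predU1P[l0|l0].
  have := moment_eigen vol_riemannian Omega_open K u0 u_sol p_eigen k.
  rewrite -l0 expr0n eqn0Ngt k_gt0 mul0r a2 => <-.
  by rewrite mul0r powR0// invr_eq0 pnatr_eq0 -lt0n.
have kp := moment_ge vol_riemannian Omega_open K u0 u_sol p_eigen k l0 a2.
set A := _ * _ in kp *; set T := l2dot _ _ _ _ in kp *.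
have A0 : 0 <= A by rewrite mulr_ge0// l2dot_ge0.
have T0 : 0 <= T by rewrite -(pmulr_rge0 _ (exprn_gt0 k l0)); exact: le_trans kp.
have ATl : A / T <= lambda ^+ k.
  (* Division by zero gives [0], so the quotient is harmless when [T = 0]. *)
  have [->|T1] := eqVneq T 0; first by rewrite invr0 mulr0 exprn_ge0// ltW.
  by rewrite ler_pdivrMr// lt0r T1.
apply: (@le_trans _ _ ((lambda ^+ k) `^ k%:R^-1)).
  by apply: ge0_ler_powR; rewrite ?invr_ge0// nnegrE ?divr_ge0// exprn_ge0// ltW.
rewrite -powR_mulrn ?(ltW l0)// -powRrM mulfV ?powRr1 ?(ltW l0)//.
by rewrite pnatr_eq0 -lt0n.
Qed.
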